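(* Let $\alpha>1$, let $\mathrm{J}(k)=\mathrm{J}^\alpha(k)=k^{-\alpha}$ for $k\ge1$ and $\mathrm{J}(0)=0$, and let $\phi(x)=x_0\sum_{k=1}^\infty k^{-\alpha}x_k$ for $x\in X=\{-1,+1\}^{\mathbb{N}}$ (the Dyson potential). If $\alpha>3/2$ and $0\le\beta<\beta_c(J^\alpha_{\mathbb{Z}})$, then there is a continuous eigenfunction $h\in C(X)$, $h\ne0$, of the transfer operator $\mathscr{L}_{\beta\phi}$, with $\mathscr{L}_{\beta\phi}h=\lambda_{\beta\phi}h$, where $\lambda_{\beta\phi}$ is the spectral radius of $\mathscr{L}_{\beta\phi}$.
   Context: $\mathbb{N}=\{0,1,2,\dots\}$. The space $X=\{-1,+1\}^{\mathbb{N}}$ has the product topology; $C(X)$ is the space of continuous real functions on $X$. $T:X\to X$ is the left shift $(Tx)_i=x_{i+1}$. For $\psi\in C(X)$ the transfer operator is $\mathscr{L}_\psi f(x)=\sum_{y\in T^{-1}x}e^{\psi(y)}f(y)$, $f\in C(X)$. Critical value: let $J^\alpha_{\mathbb{Z}}(ij)=\mathrm{J}^\alpha(|i-j|)$ for unordered pairs $ij$ of integers. For $\beta\ge0$ let $\mathscr{G}(\beta\Phi_{\mathbb{Z}})$ be the set of two-sided Ising Gibbs measures, i.e. Borel probability measures on $\{-1,+1\}^{\mathbb{Z}}$ such that for every finite $\Lambda\subset\mathbb{Z}$ the conditional probability of $x_\Lambda$ given $x_{\mathbb{Z}\setminus\Lambda}$ is proportional to $\exp\big(\beta\sum_{ij:\{i,j\}\cap\Lambda\ne\emptyset}J^\alpha_{\mathbb{Z}}(ij)x_ix_j\big)$,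 the sum being over unordered pairs $ij$ of integers. Then $\beta_c(J^\alpha_{\mathbb{Z}})\in[0,\infty]$ is the critical value such that $|\mathscr{G}(\beta\Phi_{\mathbb{Z}})|=1$ for $0\le\beta<\beta_c(J^\alpha_{\mathbb{Z}})$ and $|\mathscr{G}(\beta\Phi_{\mathbb{Z}})|>1$ for $\beta>\beta_c(J^\alpha_{\mathbb{Z}})$. *)

(* Defs.v *)
(* World: MathComp + MathComp-Analysis. *)
From HB Require Import structures.
From mathcomp Require Import all_boot all_order all_algebra finmap.
From mathcomp Require Import complex.
From mathcomp Require Import all_classical all_reals all_analysis.

Set Implicit Arguments.
Unset Strict Implicit.
Unset Printing Implicit Defensive.

Import Order.TTheory GRing.Theory Num.Theory.
Import numFieldNormedType.Exports.

Local Open Scope classical_set_scope.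
Local Open Scope ring_scope.
Local Open Scope complex_scope.

(* {-1,+1}^I with the product topology; the two-point discrete space {-1,+1}
   is represented by bool, decoded by [spin]. *)
Definition config (I : Type) := prod_topology (fun _ : I => bool).

Definition spin (R : realType) (b : bool) : R := if b then 1 else -1.

Definition left_shift (x : config nat) : config nat := fun i => x i.+1.

(* The operator on all real functions on {-1,+1}^nat; it preserves continuity
   when [psi] is continuous. The fibres of the shift have two elements, so the
   sum is a genuine finite sum. *)
Definition transfer (R : realType) (psi f : config nat -> R) : config nat -> R :=
  fun x => \sum_(y \in left_shift @^-1` [set x]) expR (psi y) * f y.

Section spectrum.
Variables (R : realType) (X : topologicalType).
Implicit Types (P : (X -> R) -> (X -> R)) (z : R[i]).

Definition modulus z : R := Num.sqrt (complex.Re z ^+ 2 + complex.Im z ^+ 2).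

Definition ccontinuous (f : X -> R[i]) : Prop :=
  continuous (fun x => complex.Re (f x)) /\
  continuous (fun x => complex.Im (f x)).

Definition complexify P (f : X -> R[i]) : X -> R[i] := fun x =>
  P (fun y => complex.Re (f y)) x +i* P (fun y => complex.Im (f y)) x.

(* [z] is in the resolvent set of [P] acting on C(X): z - P has a bounded
   two-sided inverse S on the complexification of C(X), for the supremum norm.
   Linearity of S on that space is automatic when [P] is linear. *)
Definition resolvent P z : Prop :=
  exists (S : (X -> R[i]) -> (X -> R[i])) (M : R),
    [/\ forall f, ccontinuous f -> ccontinuous (S f),
        forall f, ccontinuous f -> forall K : R,
          (forall x, modulus (f x) <= K) ->
          forall x, modulus (S f x) <= M * K,
        forall f, ccontinuous f ->
          S (fun x => z * f x - complexify P f x) = f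
      & forall f, ccontinuous f ->
          (fun x => z * S f x - complexify P (S f) x) = f].

Definition spectrum P : set R[i] := [set z | ~ resolvent P z].

(* For a bounded operator on C(X), with X compact and nonempty, the set of
   moduli is nonempty and bounded, so [sup] is the true supremum. *)
Definition spectral_radius P : R := sup [set modulus z | z in spectrum P].

End spectrum.

Definition dyson_coupling (R : realType) (alpha : R) (k : nat) : R :=
  if k == 0%N then 0 else k%:R `^ (- alpha).

Definition dyson_potential (R : realType) (alpha : R) (x : config nat) : R :=
  spin R (x 0%N) *
  limn (fun n => \sum_(1 <= k < n) dyson_coupling alpha k * spin R (x k)).

(* Sum of an absolutely summable real family over a possibly infinite index
   set, as the sum of the positive parts minus that of the negative parts. *)
Definition rsum (R : realType) (T : choiceType) (D : set T) (a : T -> R) : R :=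
  fine (\esum_(t in D) (EFin \o a)^\+ t)%E -
  fine (\esum_(t in D) (EFin \o a)^\- t)%E.

Definition configZ := g_sigma_algebraType (@open (config int)).

Section gibbs.
Variable R : realType.

(* [g] is a version of the conditional probability of the event [E] given the
   sub-sigma-algebra [F]. *)
Definition is_cond_probability d (T : measurableType d) (mu : probability T R)
    (F : set (set T)) (E : set T) (g : T -> R) : Prop :=
  (forall B : set R, measurable B -> F (g @^-1` B)) /\
  (forall A, F A -> mu (E `&` A) = (\int[mu]_(x in A) (g x)%:E)%E).

Definition outside_sigma_algebra (L : {fset int}) : set (set (config int)) :=
  <<s [set A | exists (i : int) (b : bool),
        i \notin L /\ A = [set x : config int | x i = b]] >>.

Definition cylinder (L : {fset int}) (s : {ffun L -> bool}) :
    set (config int) :=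
  [set x : config int | forall i : L, x (val i) = s i].

Definition glue_config (L : {fset int}) (s : {ffun L -> bool}) (x : config int) :
    config int :=
  fun i => if insub i is Some j then s j else x i.

(* Unordered pairs of distinct integers are represented by ordered pairs
   (i, j) with i < j; [J 0 = 0] makes diagonal pairs irrelevant. *)
Definition interaction (J : nat -> R) (L : {fset int}) (x : config int) : R :=
  rsum [set p : int * int | (p.1 < p.2) && ((p.1 \in L) || (p.2 \in L))]
    (fun p => J `|p.1 - p.2|%N * spin R (x p.1) * spin R (x p.2)).

Definition boltzmann (beta : R) (J : nat -> R) (L : {fset int})
    (x : config int) : R :=
  expR (beta * interaction J L x).

Definition gibbs_kernel (beta : R) (J : nat -> R) (L : {fset int})
    (s : {ffun L -> bool}) (x : config int) : R :=
  boltzmann beta J L (glue_config s x) /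
  \sum_(t : {ffun L -> bool}) boltzmann beta J L (glue_config t x).

Definition is_gibbs (beta : R) (J : nat -> R) (mu : probability configZ R) :
    Prop :=
  forall (L : {fset int}) (s : {ffun L -> bool}),
    is_cond_probability mu (outside_sigma_algebra L) (cylinder s)
      (gibbs_kernel beta J s).

(* A [probability] assigns values also to non-measurable sets, so measures are
   compared on measurable sets only. *)
Definition same_measure (mu nu : probability configZ R) : Prop :=
  forall A : set configZ, measurable A -> mu A = nu A.

Definition unique_gibbs (beta : R) (J : nat -> R) : Prop :=
  exists2 mu, is_gibbs beta J mu &
    forall nu, is_gibbs beta J nu -> same_measure nu mu.

Definition several_gibbs (beta : R) (J : nat -> R) : Prop :=
  exists mu nu, [/\ is_gibbs beta J mu, is_gibbs beta J nu &
                    ~ same_measure mu nu].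

Definition is_critical_value (J : nat -> R) (c : \bar R) : Prop :=
  [/\ (0 <= c)%E,
      forall beta : R, 0 <= beta -> (beta%:E < c)%E -> unique_gibbs beta J
    & forall beta : R, (c < beta%:E)%E -> several_gibbs beta J].

Lemma is_critical_value_unique (J : nat -> R) (c c' : \bar R) :
  is_critical_value J c -> is_critical_value J c' -> c = c'.
Proof.
suff H a a' : is_critical_value J a -> is_critical_value J a' -> ~ (a < a')%E.
  move=> hc hc'; apply/eqP; rewrite eq_le !leNgt.
  by apply/andP; split; apply/negP; exact: H.
move=> [a0 _ aS] [_ aU _] aa'.
have [b ab ba'] : exists2 b : R, (a < b%:E)%E & (b%:E < a')%E.
  case: a a' a0 aa' {aS aU} => [a||] [a'||]//= a0 aa'.
  - by exists ((a + a') / 2); rewrite lte_fin midf_lt// -lte_fin.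
  - by exists (a + 1); rewrite ?ltry// lte_fin ltrDl.
have b0 : 0 <= b by rewrite -lee_fin; exact: le_trans (ltW ab).
have [mu _ muU] := aU b b0 ba'.
have [m1 [m2 [g1 g2 n12]]] := aS b ab.
by apply: n12 => A mA; rewrite (muU _ g1 A mA) (muU _ g2 A mA).
Qed.

(* The critical value, as a definite description: it is unique by the previous
   lemma. Its existence is a classical fact for ferromagnetic couplings; the
   default 0 would only be taken if there were no critical value. *)
Definition critical_value (J : nat -> R) : \bar R :=
  xget 0%E [set c | is_critical_value J c].

End gibbs.

(* Main.v *)
(** The proof rests on three facts about the ferromagnetic pair model.

    (1) Sharpness. On a ring of N sites let m(b, H) be the magnetization at
    inverse temperature b in the field H. The random-cluster representation,
    the FKG inequality and Lieb's form of Simon's inequality give the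
    differential inequality m (1 - m) <= H dm/dH + b m dm/db. Hence, if
    m(b', H) is small for one b' > b and one H > 0, then m(b, h) <= C h and the
    susceptibility at b is bounded by a constant independent of N. The
    magnetization at b' < beta_c is uniformly small: otherwise limits of the
    ring measures with fields tending to 0 from above and from below would be
    two distinct Gibbs measures.

    (2) Gaussian domination. A bound on the susceptibility of a finite free
    chain gives E exp(sum_i h_i s_i) <= exp(C sum_i h_i^2). For the Dyson
    coupling, the field exerted by x on the site at distance i from the
    half-line is O(i^(1 - alpha)), which is square summable for alpha > 3/2.

    (3) Let u_n(x) be the expectation of exp(beta sum_i s_i h_i(x)) for the free
    chain of n sites next to the half-line carrying x. Then
    L u_n = (Z_(n+1) / Z_n) u_(n+1), the ratios increase to a positive limit,
    and by (2) the u_n are bounded between 1 and a constant and equicontinuous;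
    a generalized limit of their Cesaro means is a continuous eigenfunction
    h >= 1. Its eigenvalue is the spectral radius, because the operator has
    norm lam for the weighted norm sup |f| / h. *)
From HB Require Import structures.
Require Import Defs.
From mathcomp Require Import all_boot all_order all_algebra finmap.
From mathcomp Require Import complex ring lra zify.
From mathcomp Require Import all_classical all_reals all_analysis measurable_realfun.
Set Implicit Arguments.
Unset Strict Implicit.
Unset Printing Implicit Defensive.
Import Order.TTheory GRing.Theory Num.Theory.
Import numFieldNormedType.Exports.
Local Open Scope ring_scope.

(** * Griffiths inequalities *)

Lemma le_of_derive_ge0 (R : realType) (f df : R -> R) (a b : R) : a <= b ->
  (forall x : R, is_derive x (1 : R) f (df x)) ->
  (forall x, a <= x <= b -> 0 <= df x) -> f a <= f b.
Proof.
move=> ab fdf df0; apply: (@ger0_derive1_le_cc _ f a b) => //.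
- move=> x; rewrite in_itv /= => /andP[ax xb].
  by rewrite derive1E (@derive_val _ _ _ _ _ _ _ (fdf x)) df0 // !ltW.
- by apply: derivable_within_continuous => x _; case: (fdf x).
- by rewrite in_itv /= lexx ab.
- by rewrite in_itv /= ab lexx.
Qed.

Section Walsh.
Variables (R : realType) (V : finType).
Implicit Types (s t : {ffun V -> bool}) (l : seq V) (f g : {ffun V -> bool} -> R).

Definition chi l s : R := \prod_(v <- l) spin R (s v).

Definition cmul s t : {ffun V -> bool} := [ffun v => s v == t v].

Lemma spin_eqb (a b : bool) : spin R (a == b) = spin R a * spin R b.
Proof. by case: a; case: b; rewrite /spin /= ?mulr1 ?mul1r ?mulrNN ?mulr1. Qed.

Lemma spin_sqr (b : bool) : spin R b * spin R b = 1.
Proof. by rewrite -spin_eqb eqxx. Qed.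

Lemma norm_spin (b : bool) : `|spin R b| = 1.
Proof. by case: b; rewrite /spin ?normrN normr1. Qed.

Lemma cmulKl s : involutive (cmul s).
Proof. by move=> t; apply/ffunP => v; rewrite !ffunE; case: (s v); case: (t v). Qed.

Lemma cmulC s t : cmul s t = cmul t s.
Proof. by apply/ffunP => v; rewrite !ffunE eq_sym. Qed.

Lemma chi_nil s : chi [::] s = 1. Proof. exact: big_nil. Qed.

Lemma chi_cat l1 l2 s : chi (l1 ++ l2) s = chi l1 s * chi l2 s.
Proof. exact: big_cat. Qed.

Lemma chi1 v s : chi [:: v] s = spin R (s v).
Proof. exact: big_seq1. Qed.

Lemma chi2 v w s : chi [:: v; w] s = spin R (s v) * spin R (s w).
Proof. by rewrite /chi big_cons big_seq1. Qed.

Lemma chi_cmul l s t : chi l (cmul s t) = chi l s * chi l t.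
Proof. by rewrite /chi -big_split /=; apply: eq_bigr => v _; rewrite ffunE spin_eqb. Qed.

Lemma chi_sqr l s : chi l s * chi l s = 1.
Proof. by rewrite /chi -big_split big1 //= => v _; rewrite spin_sqr. Qed.

Lemma chi_pm l s : chi l s = 1 \/ chi l s = -1.
Proof.
have /eqP := chi_sqr l s; rewrite -expr2 sqrf_eq1 => /orP[] /eqP ->; [by left|by right].
Qed.

Lemma norm_chi l s : `|chi l s| = 1.
Proof. by case: (chi_pm l s) => ->; rewrite ?normrN normr1. Qed.

Lemma reindex_cmul t (F : {ffun V -> bool} -> R) :
  \sum_s F s = \sum_s F (cmul t s).
Proof. exact: (reindex_inj (inv_inj (cmulKl t))). Qed.

Lemma sum_chi_ge0 l : 0 <= \sum_s chi l s.
Proof.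
have -> : \sum_s chi l s = \prod_v \sum_(b : bool) spin R b ^+ count_mem v l.
  rewrite bigA_distr_bigA /=; apply: eq_bigr => s _.
  elim: l => [|v l IH]; first by rewrite chi_nil big1.
  rewrite /chi big_cons -/(chi l s) IH.
  under [RHS]eq_bigr => w _ do rewrite /= exprD.
  rewrite big_split /=; congr (_ * _); rewrite (bigD1 v) //= eqxx expr1 big1 ?mulr1 //.
  move=> w; rewrite eq_sym => /negPf ->. by rewrite expr0.
apply: prodr_ge0 => v _; rewrite big_bool /spin expr1n.
by rewrite -signr_odd; case: odd; rewrite /= ?expr1 ?expr0 ?subrr ?addr_ge0.
Qed.

(* The cone of positive definite functions on the group of spin configurations,
   on which the Griffiths inequalities hold. *)
Inductive pd : ({ffun V -> bool} -> R) -> Prop :=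
| pd_mono c l : 0 <= c -> pd (fun s => c * chi l s)
| pd_add f g : pd f -> pd g -> pd (fun s => f s + g s).

Lemma pd_ext f g : f =1 g -> pd f -> pd g.
Proof. by move=> /funext ->. Qed.

Lemma pd_const c : 0 <= c -> pd (fun=> c).
Proof. by move=> c0; apply: pd_ext (pd_mono [::] c0) => s; rewrite chi_nil mulr1. Qed.

Lemma pd_chi l : pd (chi l).
Proof. by apply: pd_ext (pd_mono l ler01) => s; rewrite mul1r. Qed.

Lemma pd_mul f g : pd f -> pd g -> pd (fun s => f s * g s).
Proof.
elim=> [c l c0|f1 f2 _ IH1 _ IH2] pg; last first.
  by apply: pd_ext (pd_add (IH1 pg) (IH2 pg)) => s; rewrite mulrDl.
elim: pg => [d m d0|g1 g2 _ IH1 _ IH2].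
  by apply: pd_ext (pd_mono (l ++ m) (mulr_ge0 c0 d0)) => s; rewrite chi_cat mulrACA.
by apply: pd_ext (pd_add IH1 IH2) => s; rewrite mulrDr.
Qed.

Lemma pd_scale c f : 0 <= c -> pd f -> pd (fun s => c * f s).
Proof. by move=> c0; apply: pd_mul; exact: pd_const. Qed.

Lemma pd_sum (I : Type) (r : seq I) (P : pred I) (F : I -> {ffun V -> bool} -> R) :
  (forall i, P i -> pd (F i)) -> pd (fun s => \sum_(i <- r | P i) F i s).
Proof.
move=> PF; elim: r => [|i r IH].
  by apply: pd_ext (pd_const (lexx 0)) => s; rewrite big_nil.
case Pi : (P i); last by apply: pd_ext IH => s; rewrite big_cons Pi.
by apply: pd_ext (pd_add (PF _ Pi) IH) => s; rewrite big_cons Pi.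
Qed.

Lemma pd_prod (I : Type) (r : seq I) (P : pred I) (F : I -> {ffun V -> bool} -> R) :
  (forall i, P i -> pd (F i)) -> pd (fun s => \prod_(i <- r | P i) F i s).
Proof.
move=> PF; elim: r => [|i r IH].
  by apply: pd_ext (pd_const ler01) => s; rewrite big_nil.
case Pi : (P i); last by apply: pd_ext IH => s; rewrite big_cons Pi.
by apply: pd_ext (pd_mul (PF _ Pi) IH) => s; rewrite big_cons Pi.
Qed.

Lemma sum_pd_ge0 f : pd f -> 0 <= \sum_s f s.
Proof.
elim=> [c l c0|f1 f2 _ IH1 _ IH2]; last by rewrite big_split addr_ge0.
by rewrite -mulr_sumr mulr_ge0 // sum_chi_ge0.
Qed.

Definition ch (x : R) : R := (expR x + expR (- x)) / 2.
Definition sh (x : R) : R := (expR x - expR (- x)) / 2.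

Lemma ch_ge1 x : 1 <= ch x.
Proof.
have := sqr_ge0 (expR (x / 2) - expR (- x / 2)).
have e1 : expR (x / 2) * expR (- x / 2) = 1 by rewrite -expRD -mulrDl subrr mul0r expR0.
have e2 : expR x = expR (x / 2) ^+ 2 by rewrite expr2 -expRD -splitr.
have e3 : expR (- x) = expR (- x / 2) ^+ 2 by rewrite expr2 -expRD -splitr.
rewrite /ch e2 e3; nra.
Qed.

Lemma sh_ge0 x : 0 <= x -> 0 <= sh x.
Proof. by move=> x0; rewrite /sh divr_ge0 // subr_ge0 ler_expR; lra. Qed.

Lemma shN x : sh (- x) = - sh x.
Proof. by rewrite /sh opprK; ring. Qed.

Lemma chN x : ch (- x) = ch x.
Proof. by rewrite /ch opprK addrC. Qed.

Lemma chD x y : ch (x + y) = ch x * ch y + sh x * sh y.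
Proof. by rewrite /ch /sh opprD !expRD; field. Qed.

Lemma shD x y : sh (x + y) = sh x * ch y + ch x * sh y.
Proof. by rewrite /ch /sh opprD !expRD; field. Qed.

Lemma expR_ch_sh x : expR x = ch x + sh x.
Proof. by rewrite /ch /sh; field. Qed.

Lemma ch_chi c l s : ch (c * chi l s) = ch c.
Proof. by case: (chi_pm l s) => ->; rewrite ?mulr1 ?mulrN1 ?chN. Qed.

Lemma sh_chi c l s : sh (c * chi l s) = sh c * chi l s.
Proof. by case: (chi_pm l s) => ->; rewrite ?mulr1 ?mulrN1 ?shN. Qed.

Lemma sh_le_ch (x : R) : 0 <= x -> sh x <= x * ch x.
Proof.
move=> x0; rewrite -subr_ge0.
pose F y : R := y * ch y - sh y.
have dF (y : R) : is_derive y (1 : R) F (y * sh y).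
  rewrite /F /ch /sh.
  apply: is_derive_eq; rewrite ?scaler1 /GRing.scale /=.
  by field.
have F0 : F 0 = 0 by rewrite /F /sh oppr0 subrr mul0r mul0r subr0.
rewrite -/(F x) -F0.
apply: (le_of_derive_ge0 x0 dF) => y /andP[y0 _].
by rewrite mulr_ge0 ?sh_ge0.
Qed.

Lemma pd_ch_sh f : pd f ->
  [/\ pd (fun s => ch (f s)), pd (fun s => sh (f s)) &
      pd (fun s => f s * ch (f s) - sh (f s))].
Proof.
elim=> [c l c0|f1 f2 p1 [c1 s1 d1] p2 [c2 s2 d2]].
  have h0 : 0 <= ch c by apply: le_trans (ch_ge1 c).
  split.
  - by apply: pd_ext (pd_const h0) => s; rewrite ch_chi.
  - by apply: pd_ext (pd_mono l (sh_ge0 c0)) => s; rewrite sh_chi.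
  - have h1 : 0 <= c * ch c - sh c by rewrite subr_ge0 sh_le_ch.
    by apply: pd_ext (pd_mono l h1) => s; rewrite sh_chi ch_chi; ring.
split.
- by apply: pd_ext (pd_add (pd_mul c1 c2) (pd_mul s1 s2)) => s; rewrite chD.
- by apply: pd_ext (pd_add (pd_mul s1 c2) (pd_mul c1 s2)) => s; rewrite shD.
- apply: pd_ext (pd_add (pd_add (pd_mul d1 c2) (pd_mul c1 d2))
    (pd_mul (pd_add p1 p2) (pd_mul s1 s2))) => s.
  by rewrite shD chD; ring.
Qed.

Lemma pd_exp f : pd f -> pd (fun s => expR (f s)).
Proof.
by move=> /pd_ch_sh[c s _]; apply: pd_ext (pd_add c s) => x; rewrite expR_ch_sh.
Qed.

Lemma pd_exp_sub1 f : pd f -> pd (fun s => expR (f s) - 1).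
Proof.
elim=> [c l c0|f1 f2 p1 h1 p2 h2].
  have h : 0 <= ch c - 1 by rewrite subr_ge0 ch_ge1.
  apply: pd_ext (pd_add (pd_const h) (pd_mono l (sh_ge0 c0))) => s.
  by rewrite expR_ch_sh ch_chi sh_chi addrAC.
apply: pd_ext (pd_add (pd_add h1 h2) (pd_mul h1 h2)) => s.
by rewrite expRD; ring.
Qed.

(* The class of weights to which Ginibre's duplication argument applies. *)
Definition ginibre (W : {ffun V -> bool} -> R) :=
  forall t, pd (fun s => W s * W (cmul s t)).

Lemma pd_sub_cmul f t : pd f -> pd (fun s => f s - f (cmul s t)).
Proof.
elim=> [c l c0|f1 f2 _ h1 _ h2].
  have h : 0 <= c * (1 - chi l t).
    by rewrite mulr_ge0 //; case: (chi_pm l t) => ->; rewrite ?subrr // opprK addr_ge0.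
  by apply: pd_ext (pd_mono l h) => s; rewrite chi_cmul; ring.
by apply: pd_ext (pd_add h1 h2) => s; ring.
Qed.

Lemma pd_add_cmul f t : pd f -> pd (fun s => f s + f (cmul s t)).
Proof.
elim=> [c l c0|f1 f2 _ h1 _ h2].
  have h : 0 <= c * (1 + chi l t).
    by rewrite mulr_ge0 //; case: (chi_pm l t) => ->; rewrite ?subrr // addr_ge0.
  by apply: pd_ext (pd_mono l h) => s; rewrite chi_cmul; ring.
by apply: pd_ext (pd_add h1 h2) => s; ring.
Qed.

Lemma ginibre_exp f : pd f -> ginibre (fun s => expR (f s)).
Proof.
move=> pf t; apply: pd_ext (pd_exp (pd_add_cmul t pf)) => s.
by rewrite expRD.
Qed.

Lemma ginibre_prod (I : Type) (r : seq I) (P : pred I)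
    (W : I -> {ffun V -> bool} -> R) :
  (forall i, P i -> ginibre (W i)) -> ginibre (fun s => \prod_(i <- r | P i) W i s).
Proof.
move=> gW t; apply: pd_ext (pd_prod r (fun i Pi => gW i Pi t)) => s.
by rewrite big_split.
Qed.

Lemma gks2 W f g : ginibre W -> pd f -> pd g ->
  (\sum_s f s * W s) * (\sum_s g s * W s) <=
  (\sum_s f s * g s * W s) * (\sum_s W s).
Proof.
move=> gW pf pg; rewrite -subr_ge0 !mulr_suml -sumrB.
under eq_bigr => s _ do rewrite !mulr_sumr -sumrB (reindex_cmul s).
rewrite exchange_big /=; apply: sumr_ge0 => t _.
apply: sum_pd_ge0.
apply: pd_ext (pd_mul (pd_mul pf (pd_sub_cmul t pg)) (gW t)) => s; ring.
Qed.

Definition ev (E f : {ffun V -> bool} -> R) : R :=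
  (\sum_s f s * expR (E s)) / (\sum_s expR (E s)).

Lemma part_gt0 (E : {ffun V -> bool} -> R) : 0 < \sum_s expR (E s).
Proof.
rewrite (bigD1 [ffun=> true]) //= ltr_pwDl ?expR_gt0 //.
by apply: sumr_ge0 => s _; exact: expR_ge0.
Qed.

Lemma ev_sumE E f : \sum_s f s * expR (E s) = ev E f * \sum_s expR (E s).
Proof. by rewrite /ev divfK // gt_eqF // part_gt0. Qed.

Lemma ev_cst E c : ev E (fun=> c) = c.
Proof. by rewrite /ev -mulr_sumr mulfK // gt_eqF // part_gt0. Qed.

Lemma evD E f g : ev E (fun s => f s + g s) = ev E f + ev E g.
Proof.
rewrite /ev -mulrDl -big_split /=; congr (_ / _).
by apply: eq_bigr => s _; rewrite mulrDl.
Qed.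

Lemma evZ E c f : ev E (fun s => c * f s) = c * ev E f.
Proof.
rewrite /ev mulrA mulr_sumr; congr (_ / _).
by apply: eq_bigr => s _; rewrite mulrA.
Qed.

Lemma evN E f : ev E (fun s => - f s) = - ev E f.
Proof.
by rewrite -mulN1r -evZ; congr ev; apply/funext => s; rewrite mulN1r.
Qed.

Lemma ev_sum E (I : Type) (r : seq I) (P : pred I) (F : I -> {ffun V -> bool} -> R) :
  ev E (fun s => \sum_(i <- r | P i) F i s) = \sum_(i <- r | P i) ev E (F i).
Proof.
elim: r => [|i r IH].
  by rewrite big_nil -[RHS](ev_cst E); congr ev; apply/funext => s; rewrite big_nil.
rewrite big_cons -IH; case Pi: (P i); rewrite -?evD; congr ev; apply/funext => s;
by rewrite big_cons Pi.
Qed.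

Lemma ev_le E f g : (forall s, f s <= g s) -> ev E f <= ev E g.
Proof.
move=> fg; rewrite /ev ler_pM2r ?invr_gt0 ?part_gt0 //.
by apply: ler_sum => s _; rewrite ler_pM2r ?expR_gt0.
Qed.

Lemma ev_norm_le E f c : (forall s, `|f s| <= c) -> `|ev E f| <= c.
Proof.
move=> fc; rewrite ler_norml -(ev_cst E (- c)) -{2}(ev_cst E c).
by apply/andP; split; apply: ev_le => s; have := fc s; rewrite ler_norml => /andP[].
Qed.

Lemma ev_pd_ge0 E f : pd E -> pd f -> 0 <= ev E f.
Proof.
move=> pE pf; apply: divr_ge0; last exact/ltW/part_gt0.
exact: sum_pd_ge0 (pd_mul pf (pd_exp pE)).
Qed.

Lemma ev_gks2 E f g : pd E -> pd f -> pd g ->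
  ev E f * ev E g <= ev E (fun s => f s * g s).
Proof.
move=> pE pf pg; have := gks2 (ginibre_exp pE) pf pg; have Z0 := part_gt0 E.
rewrite !ev_sumE mulrACA mulrA -mulrA -[leRHS]mulrA.
by rewrite ler_pM2r // mulr_gt0.
Qed.

Lemma ev_shift E D f : ev (fun s => E s + D s) f =
  ev E (fun s => f s * expR (D s)) / ev E (fun s => expR (D s)).
Proof.
rewrite /ev; have -> : \sum_s expR (E s + D s) = \sum_s expR (D s) * expR (E s).
  by apply: eq_bigr => s _; rewrite addrC expRD.
have -> : \sum_s f s * expR (E s + D s) = \sum_s f s * expR (D s) * expR (E s).
  by apply: eq_bigr => s _; rewrite addrC expRD mulrA.
rewrite invfM invrK mulrACA mulVf ?mulr1 // gt_eqF //.
exact: part_gt0.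
Qed.

Lemma ev_gt0 E f : (forall s, 0 < f s) -> 0 < ev E f.
Proof.
move=> f0; apply: divr_gt0; last exact: part_gt0.
rewrite (bigD1 [ffun=> true]) //= ltr_pwDl ?mulr_gt0 ?expR_gt0 //.
by apply: sumr_ge0 => s _; rewrite mulr_ge0 ?expR_ge0 ?ltW.
Qed.

Lemma ev_mono E D f : pd E -> pd D -> pd f -> ev E f <= ev (fun s => E s + D s) f.
Proof.
move=> pE pD pf; rewrite ev_shift ler_pdivlMr ?ev_gt0 // => [|s]; last exact: expR_gt0.
exact: ev_gks2 pE pf (pd_exp pD).
Qed.

End Walsh.

(** * The FKG inequality and the random-cluster model *)

Section FKG.
Variables (R : realType) (T : finType).
Implicit Types (a : T) (S A B : {set T}) (f g : {set T} -> R).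

Definition fiber_sum a f S : R := f (S :\ a) + f (a |: S).

Fixpoint fiber_sums (r : seq T) f : {set T} -> R :=
  if r is a :: r' then fiber_sum a (fiber_sums r' f) else f.

Lemma fiber_sums_eq r f S S' : (forall x, x \notin r -> (x \in S) = (x \in S')) ->
  fiber_sums r f S = fiber_sums r f S'.
Proof.
elim: r S S' => [|a r IH] S S' SS' /=.
  by congr f; apply/setP => x; exact: SS'.
by congr (_ + _); apply: IH => x xr; rewrite !inE; case: eqP => //= /eqP xa;
   apply: SS'; rewrite inE negb_or xa.
Qed.

Lemma sum_fiber_sum a f : \sum_S fiber_sum a f S = 2 * \sum_S f S.
Proof.
pose tog S := if a \in S then S :\ a else a |: S.
have togK : involutive tog.
  move=> S; rewrite /tog; case: (boolP (a \in S)) => aS.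
    by rewrite !inE eqxx finset.setD1K.
  by rewrite !inE eqxx /= finset.setU1K.
have -> : \sum_S fiber_sum a f S = \sum_S (f S + f (tog S)).
  apply: eq_bigr => S _; rewrite /fiber_sum /tog; case: (boolP (a \in S)) => aS.
    by rewrite (_ : a |: S = S) 1?addrC //; apply/finset.setUidPr; rewrite finset.sub1set.
  by rewrite (_ : S :\ a = S) //; apply/finset.setDidPl; rewrite disjoint_sym disjoints1.
have e : \sum_S f (tog S) = \sum_S f S by rewrite [RHS](reindex_inj (inv_inj togK)).
by rewrite big_split /= e; ring.
Qed.

Lemma sum_fiber_sums r f : \sum_S fiber_sums r f S = 2 ^+ size r * \sum_S f S.
Proof.
elim: r => [|a r IH] /=; first by rewrite mul1r.
by rewrite sum_fiber_sum IH exprS mulrA.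
Qed.

Lemma four_functions_scalar (a0 a1 b0 b1 c0 c1 d0 d1 : R) :
  0 <= a0 -> 0 <= a1 -> 0 <= b0 -> 0 <= b1 ->
  0 <= c0 -> 0 <= c1 -> 0 <= d0 -> 0 <= d1 ->
  a0 * b0 <= c0 * d0 -> a0 * b1 <= c1 * d0 -> a1 * b0 <= c1 * d0 ->
  a1 * b1 <= c1 * d1 -> (a0 + a1) * (b0 + b1) <= (c0 + c1) * (d0 + d1).
Proof.
move=> a0p a1p b0p b1p c0p c1p d0p d1p h00 h01 h10 h11.
have u0 := mulr_ge0 a0p b1p; have v0 := mulr_ge0 a1p b0p.
have w0 := mulr_ge0 c0p d1p; have p0 := mulr_ge0 c1p d0p.
suff : a0 * b1 + a1 * b0 <= c1 * d0 + c0 * d1 by lra.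
have [p_eq0|p_gt0] := eqVneq (c1 * d0) 0; first by rewrite p_eq0 in h01 h10; lra.
have pp : 0 < c1 * d0 by rewrite lt_def p_gt0 p0.
rewrite -(ler_pM2r pp).
have h : (a0 * b1) * (a1 * b0) <= (c0 * d1) * (c1 * d0).
  have := ler_pM (mulr_ge0 a0p b0p) (mulr_ge0 a1p b1p) h00 h11.
  have -> : a0 * b0 * (a1 * b1) = a0 * b1 * (a1 * b0) by ring.
  by have -> : c0 * d0 * (c1 * d1) = c0 * d1 * (c1 * d0) by ring.
have := mulr_ge0 (_ : 0 <= c1 * d0 - a0 * b1) (_ : 0 <= c1 * d0 - a1 * b0).
rewrite !subr_ge0 => /(_ h01 h10).
move: h; set u := a0 * b1; set v := a1 * b0; set p := c1 * d0; set q := c0 * d1.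
nra.
Qed.

Lemma four_functions (f1 f2 f3 f4 : {set T} -> R) :
  (forall S, 0 <= f1 S) -> (forall S, 0 <= f2 S) ->
  (forall S, 0 <= f3 S) -> (forall S, 0 <= f4 S) ->
  (forall A B, f1 A * f2 B <= f3 (A :|: B) * f4 (A :&: B)) ->
  (\sum_S f1 S) * (\sum_S f2 S) <= (\sum_S f3 S) * (\sum_S f4 S).
Proof.
move=> p1 p2 p3 p4 H.
have pos r f : (forall S, 0 <= f S) -> forall S, 0 <= fiber_sums r f S.
  by move=> fp; elim: r => //= a r IH S; rewrite /fiber_sum addr_ge0.
have key r A B : fiber_sums r f1 A * fiber_sums r f2 B <=
    fiber_sums r f3 (A :|: B) * fiber_sums r f4 (A :&: B).
  elim: r A B => [|a r IH] A B //=; rewrite /fiber_sum.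
  apply: four_functions_scalar; try exact: pos.
  - by apply: le_trans (IH _ _) _; rewrite -finset.setDUl -finset.setDIl.
  - have -> : a |: (A :|: B) = (A :\ a) :|: (a |: B).
      by apply/setP => x; rewrite !inE; case: eqP => //=; rewrite orbT.
    have -> : (A :&: B) :\ a = (A :\ a) :&: (a |: B).
      by apply/setP => x; rewrite !inE; case: eqP.
    exact: IH.
  - have -> : a |: (A :|: B) = (a |: A) :|: (B :\ a).
      by apply/setP => x; rewrite !inE; case: eqP.
    have -> : (A :&: B) :\ a = (a |: A) :&: (B :\ a).
      by apply/setP => x; rewrite !inE; case: eqP.
    exact: IH.
  - by apply: le_trans (IH _ _) _; rewrite -finset.setUUr -finset.setUIr.
pose r := enum T.
have tot f : \sum_S f S = fiber_sums r f finset.set0.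
  have n0 : (2 ^+ size r : R) != 0 by rewrite expf_neq0 // pnatr_eq0.
  apply: (mulfI n0); rewrite -sum_fiber_sums.
  rewrite (eq_bigr (fun=> fiber_sums r f finset.set0)); last first.
    by move=> S _; apply: fiber_sums_eq => x; rewrite mem_enum.
  by rewrite sumr_const -cardsT -powersetT card_powerset cardsT -natrX cardT mulr_natl.
by rewrite !tot; apply: le_trans (key _ _ _) _; rewrite finset.setU0 finset.setI0.
Qed.

Lemma fkg (mu f g : {set T} -> R) :
  (forall S, 0 <= mu S) -> (forall S, 0 <= f S) -> (forall S, 0 <= g S) ->
  (forall A B, mu A * mu B <= mu (A :|: B) * mu (A :&: B)) ->
  (forall A B, A \subset B -> f A <= f B) ->
  (forall A B, A \subset B -> g A <= g B) ->
  (\sum_S mu S * f S) * (\sum_S mu S * g S) <=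
  (\sum_S mu S * (f S * g S)) * (\sum_S mu S).
Proof.
move=> mu0 f0 g0 lsm fi gi; apply: four_functions => //; try by move=> S; rewrite !mulr_ge0.
move=> A B; rewrite mulrACA [leRHS]mulrAC; apply: ler_pM; rewrite ?mulr_ge0 //.
by apply: ler_pM => //; [apply: fi; exact: finset.subsetUl|apply: gi; exact: finset.subsetUr].
Qed.

End FKG.

Section Bonds.
Variables (R : realType) (V T : finType) (sb : T -> seq V).
Implicit Types (s t : {ffun V -> bool}) (w : {set T}) (A B : seq V).

(* An edge [e] of a random-cluster configuration [w] constrains the spins to
   satisfy [chi (sb e) = 1]; [forced A w] says that these constraints entail
   [chi A = 1]. For [sb e = [:: x; y]] and [A = [:: x; y]] it means that [x] and
   [y] are connected in [w]; one-site bonds play the role of edges to a ghost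
   vertex. *)
Definition compatible w s := [forall e in w, chi R (sb e) s == 1].

Definition forced A w := [forall s, compatible w s ==> (chi R A s == 1)].

Definition ncompatible w : R := \sum_s (compatible w s)%:R.

Lemma compatibleP w s :
  reflect (forall e, e \in w -> chi R (sb e) s = 1) (compatible w s).
Proof. exact: eqfun_inP. Qed.

Lemma forcedP A w :
  reflect (forall s, compatible w s -> chi R A s = 1) (forced A w).
Proof. exact: eqfun_inP. Qed.

Lemma forced_chi A w s : forced A w -> compatible w s -> chi R A s = 1.
Proof. by move=> /forcedP; apply. Qed.

Lemma compatible_prod w s :
  (compatible w s)%:R = \prod_(e in w) ((1 + chi R (sb e) s) / 2).
Proof.
case: (boolP (compatible w s)) => [/compatibleP H|].
  by rewrite big1 // => e ew; rewrite H //; field.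
move=> /forallPn[e]; rewrite negb_imply => /andP[ew ne]; rewrite (bigD1 e) //=.
case: (chi_pm R (sb e) s) => [h|->]; first by rewrite h eqxx in ne.
by rewrite subrr mul0r mul0r.
Qed.

Lemma compatible_cmul w s t : compatible w s ->
  compatible w (cmul s t) = compatible w t.
Proof.
move=> /compatibleP cs; apply: eq_forallb_in => e ew.
by rewrite chi_cmul cs // mul1r.
Qed.

Lemma compatible_true w : compatible w [ffun=> true].
Proof.
by apply/compatibleP => e _; rewrite /chi big1 // => v _; rewrite ffunE.
Qed.

Lemma ncompatible_gt0 w : 0 < ncompatible w.
Proof.
rewrite /ncompatible (bigD1 [ffun=> true]) //= compatible_true ltr_pwDl //.
by apply: sumr_ge0 => s _; exact: ler0n.
Qed.

Lemma sum_compatible_chi A w :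
  \sum_s (compatible w s)%:R * chi R A s = ncompatible w * (forced A w)%:R.
Proof.
case: (boolP (forced A w)) => [/forcedP H|].
  rewrite mulr1; apply: eq_bigr => s _.
  by case: (boolP (compatible w s)) => [/H ->|]; rewrite ?mulr1 ?mul0r.
move=> /forallPn[t]; rewrite negb_imply => /andP[ct nt]; rewrite mulr0.
have t1 : chi R A t = -1 by case: (chi_pm R A t) nt => -> //; rewrite eqxx.
set X := LHS; suff : X = - X by lra.
rewrite {1}/X (reindex_cmul t) -sumrN; apply: eq_bigr => s _.
by rewrite compatible_cmul // chi_cmul t1 mulN1r mulrN.
Qed.

Lemma ncompatible_supermodular w1 w2 :
  ncompatible w1 * ncompatible w2 <=
  ncompatible (w1 :|: w2) * ncompatible (w1 :&: w2).
Proof.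
pose p w s : R := \prod_(e in w) ((1 + chi R (sb e) s) / 2).
have pp w : pd (p w).
  apply: pd_prod => e _; have h : 0 <= 2^-1 :> R by rewrite invr_ge0.
  apply: pd_ext (pd_scale h (pd_add (pd_const V ler01) (pd_chi R (sb e)))) => s.
  by rewrite mulrC.
have gp w : ginibre (p w).
  apply: ginibre_prod => e _ t; case: (chi_pm R (sb e) t) => et.
    have h : 0 <= 2^-1 :> R by rewrite invr_ge0.
    apply: pd_ext (pd_scale h (pd_add (pd_const V ler01) (pd_chi R (sb e)))) => s.
    rewrite chi_cmul et mulr1.
    by case: (chi_pm R (sb e) s) => ->; field.
  apply: pd_ext (pd_const V (lexx 0)) => s; rewrite chi_cmul et mulrN1.
  by case: (chi_pm R (sb e) s) => ->; rewrite ?subrr ?opprK !(mul0r,mulr0).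
have split w w' s : w' \subset w -> p w s = p (w :\: w') s * p w' s.
  move=> ww'; rewrite /p (bigID (mem w')) /= mulrC; congr (_ * _).
    by apply: eq_bigl => e; rewrite !inE andbC.
  by apply: eq_bigl => e; case: (boolP (e \in w')) => [/(fintype.subsetP ww') ->|]; rewrite ?andbF.
have := gks2 (gp (w1 :&: w2)) (pp (w1 :\: (w1 :&: w2))) (pp (w2 :\: (w1 :&: w2))).
have nE w : ncompatible w = \sum_s p w s.
  by apply: eq_bigr => s _; exact: compatible_prod.
rewrite !nE.
under eq_bigr => s _ do rewrite -split ?finset.subsetIl //.
under [X in _ * X <= _]eq_bigr => s _ do rewrite -split ?finset.subsetIr //.
suff -> : \sum_s p (w1 :\: (w1 :&: w2)) s * p (w2 :\: (w1 :&: w2)) s * p (w1 :&: w2) s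
   = \sum_s p (w1 :|: w2) s by [].
apply: eq_bigr => s _; rewrite -mulrA -split ?finset.subsetIr //.
rewrite (split (w1 :|: w2) w2) ?finset.subsetUr //; congr (p _ s * _).
by apply/setP => e; rewrite !inE; case: (e \in w1); case: (e \in w2).
Qed.

Lemma compatible_subset w w' s : w \subset w' -> compatible w' s -> compatible w s.
Proof. by move=> ww' /compatibleP c; apply/compatibleP => e /(fintype.subsetP ww') /c. Qed.

Lemma forced_subset A w w' : w \subset w' -> forced A w -> forced A w'.
Proof.
by move=> ww' /forcedP f; apply/forcedP => s /(compatible_subset ww') /f.
Qed.

(* Random-cluster weight with cluster weight 2. *)
Definition fk_weight (u : T -> R) w : R := (\prod_(e in w) u e) * ncompatible w.

Lemma fk_weight_ge0 u w : (forall e, 0 <= u e) -> 0 <= fk_weight u w.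
Proof. by move=> u0; rewrite mulr_ge0 ?prodr_ge0 // ltW // ncompatible_gt0. Qed.

Lemma fk_weight_supermodular u w1 w2 : (forall e, 0 <= u e) ->
  fk_weight u w1 * fk_weight u w2 <=
  fk_weight u (w1 :|: w2) * fk_weight u (w1 :&: w2).
Proof.
move=> u0; rewrite /fk_weight mulrACA [leRHS]mulrACA.
have -> : (\prod_(e in w1) u e) * (\prod_(e in w2) u e) =
    (\prod_(e in w1 :|: w2) u e) * (\prod_(e in w1 :&: w2) u e).
  rewrite !(big_mkcond (fun e => e \in _)) /= -!big_split /=.
  apply: eq_bigr => e _; rewrite !inE.
  by case: (e \in w1); case: (e \in w2); rewrite ?mulr1 ?mul1r.
rewrite ler_wpM2l ?mulr_ge0 ?prodr_ge0 //; exact: ncompatible_supermodular.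
Qed.

Lemma fk_forced_fkg u A B : (forall e, 0 <= u e) ->
  (\sum_w fk_weight u w * (forced A w)%:R) * (\sum_w fk_weight u w * (forced B w)%:R)
  <= (\sum_w fk_weight u w * (forced A w && forced B w)%:R) * (\sum_w fk_weight u w).
Proof.
move=> u0; under [X in _ <= X * _]eq_bigr => w _ do rewrite -mulnb natrM.
apply: fkg => //; try by move=> S; rewrite ?fk_weight_ge0.
- by move=> *; exact: fk_weight_supermodular.
- by move=> w w' ww'; rewrite ler_nat; case: (boolP (forced A w)) => // /(forced_subset ww') ->.
- by move=> w w' ww'; rewrite ler_nat; case: (boolP (forced B w)) => // /(forced_subset ww') ->.
Qed.

Lemma edwards_sokal (J : T -> R) (F : {ffun V -> bool} -> R) :
  \sum_s F s * expR (\sum_e J e * chi R (sb e) s) =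
  expR (- \sum_e J e) * \sum_(w : {set T}) (\prod_(e in w) (expR (2 * J e) - 1)) *
    \sum_s (compatible w s)%:R * F s.
Proof.
have H s : expR (\sum_e J e * chi R (sb e) s) = expR (- \sum_e J e) *
    \sum_(w : {set T}) (\prod_(e in w) (expR (2 * J e) - 1)) * (compatible w s)%:R.
  have -> : \sum_(w : {set T}) (\prod_(e in w) (expR (2 * J e) - 1)) * (compatible w s)%:R =
      \prod_e (1 + (expR (2 * J e) - 1) * ((1 + chi R (sb e) s) / 2)).
    under [RHS]eq_bigr => e _ do rewrite addrC.
    rewrite bigA_distr; apply: eq_big => [w|w _]; first by rewrite inE.
    rewrite compatible_prod -big_split /= [RHS](bigID (mem w)) /= [X in _ * X]big1 ?mulr1.
      by apply: eq_bigr => e ->.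
    by move=> e /negPf ->.
  rewrite -sumrN !expR_sum -big_split /=; apply: eq_bigr => e _.
  case: (chi_pm R (sb e) s) => ->.
    have -> : 1 + (expR (2 * J e) - 1) * ((1 + 1) / 2) = expR (2 * J e) by field.
    by rewrite -expRD; congr expR; ring.
  by rewrite subrr mul0r mulr0 addr0 mulr1 mulrN1.
under eq_bigr => s _ do rewrite H mulrCA mulr_sumr.
rewrite -mulr_sumr exchange_big /=; congr (_ * _); apply: eq_bigr => w _.
by rewrite mulr_sumr; apply: eq_bigr => s _; ring.
Qed.

End Bonds.

(** * The Simon-Lieb inequality *)

Section PairModel.
Variables (R : realType) (V : finType).
Implicit Types (s t : {ffun V -> bool}) (S : {set V}) (J : V -> V -> R) (h : V -> R).

Lemma chi1_eq1 v s : (chi R [:: v] s == 1) = s v.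
Proof.
rewrite chi1 /spin; case: (s v); rewrite ?eqxx //.
by apply/negP => /eqP; lra.
Qed.

Lemma chi2_eq1 v w s : (chi R [:: v; w] s == 1) = (s v == s w).
Proof.
have -> : chi R [:: v; w] s = chi R [:: v] (cmul s [ffun _ => s w]).
  by rewrite chi2 chi1 !ffunE spin_eqb.
by rewrite chi1_eq1 !ffunE.
Qed.

(* Each unordered pair is met twice, once per ordering, hence the factor 1/2. *)
Definition pairE J s : R := \sum_x \sum_y J x y / 2 * chi R [:: x; y] s.

Definition fieldE h s : R := \sum_x h x * chi R [:: x] s.

Definition subJ S J x y : R := if (x \in S) && (y \in S) then J x y else 0.

Lemma pairE_pair J s :
  pairE J s = \sum_(e : V * V) J e.1 e.2 / 2 * chi R [:: e.1; e.2] s.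
Proof. by rewrite /pairE pair_big. Qed.

Lemma pd_pairE J : (forall x y, 0 <= J x y) -> pd (pairE J).
Proof.
move=> J0; apply: pd_sum => x _; apply: pd_sum => y _.
by apply: pd_mono; rewrite divr_ge0.
Qed.

Lemma pd_fieldE h : (forall x, 0 <= h x) -> pd (fieldE h).
Proof. by move=> h0; apply: pd_sum => x _; exact: pd_mono. Qed.

Lemma subJ_ge0 S J : (forall x y, 0 <= J x y) -> forall x y, 0 <= subJ S J x y.
Proof. by move=> J0 x y; rewrite /subJ; case: ifP. Qed.

Let bd (e : V * V) := [:: e.1; e.2].

Lemma expR_pairE_cmul J s t :
  expR (pairE J (cmul s t)) * expR (pairE J s) =
  \sum_(w : {set V * V}) (compatible R bd w t)%:R *
    \prod_(e in w) (expR (J e.1 e.2 * chi R (bd e) s) - 1).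
Proof.
rewrite -expRD !pairE_pair -big_split /= expR_sum.
transitivity (\prod_(e : V * V) ((1 + chi R (bd e) t) / 2 *
   (expR (J e.1 e.2 * chi R (bd e) s) - 1) + 1)).
  apply: eq_bigr => e _; rewrite -/(bd e) chi_cmul.
  case: (chi_pm R (bd e) t) => ->.
    rewrite (_ : (1 + 1) / 2 = 1 :> R); last by field.
    by rewrite mul1r subrK; congr expR; field.
  by rewrite subrr !mul0r add0r -[RHS]expR0; congr expR; ring.
rewrite bigA_distr; apply: eq_big => [w|w _]; first by rewrite inE.
rewrite compatible_prod -big_split /= (bigID (mem w)) /= [X in _ * X]big1 ?mulr1.
  by apply: eq_bigr => e ->.
by move=> e /negPf ->.
Qed.

(* Lieb's improvement of Simon's inequality, for arbitrary ferromagnetic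
   boundary terms [g x].  Two copies of the system are coupled; [K] is the
   cluster of [o] in the expansion of the doubled interaction inside [S], and
   flipping [K] turns the difference of both sides into an average of
   [L ch L - sh L], a nonnegative combination of characters. *)
Lemma simon_lieb S J (g : V -> {ffun V -> bool} -> R)
    (E E' : {ffun V -> bool} -> R) (o : V) :
  o \in S -> (forall x y, 0 <= J x y) -> (forall x, pd (g x)) -> pd E' ->
  (forall t, (forall v, v \notin S -> t v) ->
     (forall x s, g x (cmul s t) = g x s) /\ (forall s, E' (cmul s t) = E' s)) ->
  (forall s, E s =
     pairE (subJ S J) s + (\sum_(x in S) chi R [:: x] s * g x s + E' s)) ->
  ev E (chi R [:: o]) <=
  \sum_(x in S) ev (pairE (subJ S J)) (chi R [:: o; x]) * ev E (g x).
Proof.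
move=> oS J0 pg pE' inv EE.
set E0 := pairE (subJ S J); set X := fun s => \sum_(x in S) chi R [:: x] s * g x s + E' s.
have Z0 := part_gt0 E0; have Z1 := part_gt0 E.
rewrite -(ler_pM2r (mulr_gt0 Z0 Z1)) [leRHS]mulr_suml.
under [leRHS]eq_bigr => x _ do rewrite mulrACA -!ev_sumE.
rewrite mulrCA -ev_sumE -subr_ge0.
pose D (w : {set V * V}) s := \prod_(e in w) (expR (subJ S J e.1 e.2 * chi R (bd e) s) - 1).
have -> : \sum_(x in S) (\sum_s chi R [:: o; x] s * expR (E0 s)) *
      (\sum_s g x s * expR (E s)) -
    (\sum_s expR (E0 s)) * (\sum_s chi R [:: o] s * expR (E s)) =
  \sum_(w : {set V * V}) ncompatible R bd w * \sum_s D w s * expR (X s) *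
    (\sum_(x in S) chi R [:: o; x] s * g x s * (forced R bd [:: o; x] w)%:R
     - chi R [:: o] s).
  transitivity (\sum_s \sum_t (expR (E0 (cmul s t)) * expR (E0 s)) * expR (X s) *
    (\sum_(x in S) chi R [:: o; x] (cmul s t) * g x s - chi R [:: o] s)).
    under eq_bigr => x _ do rewrite mulr_sumr.
    rewrite exchange_big /= mulr_sumr -sumrB; apply: eq_bigr => s _.
    under eq_bigr => x _ do rewrite mulr_suml (reindex_cmul s).
    rewrite (reindex_cmul s) mulr_suml exchange_big /= -sumrB; apply: eq_bigr => t _.
    rewrite EE -/E0 -/(X s) expRD mulrBr mulr_sumr; congr (_ - _); last by ring.
    by apply: eq_bigr => x _; ring.
  under eq_bigr => s _ do under eq_bigr => t _ do
    rewrite expR_pairE_cmul !mulr_suml.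
  under eq_bigr => s _ do rewrite exchange_big /=.
  rewrite exchange_big /=; apply: eq_bigr => w _.
  rewrite mulr_sumr; apply: eq_bigr => s _.
  rewrite mulrCA mulrBr mulr_sumr.
  have -> : ncompatible R bd w * chi R [:: o] s =
      \sum_t (compatible R bd w t)%:R * chi R [:: o] s.
    by rewrite /ncompatible mulr_suml.
  have e1 : \sum_(x in S) ncompatible R bd w *
     (chi R [:: o; x] s * g x s * (forced R bd [:: o; x] w)%:R) =
     \sum_t (compatible R bd w t)%:R * \sum_(x in S) chi R [:: o; x] (cmul s t) * g x s.
    under [RHS]eq_bigr => t _ do rewrite mulr_sumr.
    rewrite exchange_big /=; apply: eq_bigr => x _.
    rewrite mulrCA -(sum_compatible_chi) mulr_sumr; apply: eq_bigr => t _.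
    by rewrite chi_cmul; ring.
  rewrite e1 -sumrB mulr_sumr; apply: eq_bigr => t _.
  by rewrite -/(D w s); ring.
apply: sumr_ge0 => w _; apply: mulr_ge0; first exact/ltW/ncompatible_gt0.
have [wS|] := boolP [forall e in w, (e.1 \in S) && (e.2 \in S)]; last first.
  move=> /forallPn[e]; rewrite negb_imply => /andP[ew /negPf eS].
  rewrite big1 // => s _; rewrite /D (bigD1 e) //= /subJ eS mul0r expR0 subrr.
  by rewrite !mul0r.
pose K := [set x in S | forced R bd [:: o; x] w].
pose t0 : {ffun V -> bool} := [ffun v => v \notin K].
have t0S v : v \notin S -> t0 v by rewrite ffunE inE; case: (v \in S).
have [gt0 E't0] := inv _ t0S.
pose L s := \sum_(x in K) chi R [:: x] s * g x s.
pose Y s := \sum_(x in S | x \notin K) chi R [:: x] s * g x s + E' s.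
have XE s : X s = L s + Y s.
  rewrite /X /L /Y addrA; congr (_ + _); rewrite (bigID (mem K)) /=; congr (_ + _).
  by apply: eq_bigl => x; rewrite inE andbA andbb.
have oK : o \in K by rewrite inE oS; apply/forcedP => s _; apply/eqP; rewrite chi2_eq1.
have Kt0 x : x \in K -> chi R [:: x] t0 = -1.
  by move=> xK; rewrite chi1 ffunE xK.
have Kct0 x : x \notin K -> chi R [:: x] t0 = 1.
  by move=> xK; rewrite chi1 ffunE xK.
have Lt0 s : L (cmul s t0) = - L s.
  rewrite /L -sumrN; apply: eq_bigr => x xK.
  by rewrite chi_cmul Kt0 // gt0; ring.
have Yt0 s : Y (cmul s t0) = Y s.
  rewrite /Y E't0; congr (_ + _); apply: eq_bigr => x /andP[_ xK].
  by rewrite chi_cmul Kct0 // gt0 mulr1.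
have Dt0 s : D w (cmul s t0) = D w s.
  apply: eq_bigr => e ew; rewrite chi_cmul.
  suff -> : chi R (bd e) t0 = 1 by rewrite mulr1.
  apply/eqP; rewrite chi2_eq1 !ffunE !inE.
  have /andP[-> ->] := forall_inP wS _ ew; apply/eqP; congr (~~ _).
  have e12 s' : compatible R bd w s' -> s' e.1 = s' e.2.
    by move=> /compatibleP/(_ _ ew)/eqP; rewrite chi2_eq1 => /eqP.
  apply/forcedP/forcedP => H s' cs'; have /eqP := H s' cs'; rewrite chi2_eq1 => /eqP so;
  by apply/eqP; rewrite chi2_eq1 so e12.
have -> : \sum_s D w s * expR (X s) *
    (\sum_(x in S) chi R [:: o; x] s * g x s * (forced R bd [:: o; x] w)%:R
     - chi R [:: o] s) =
  \sum_s D w s * expR (Y s) * (chi R [:: o] s * (expR (L s) * (L s - 1))).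
  apply: eq_bigr => s _; rewrite XE expRD.
  suff -> : \sum_(x in S) chi R [:: o; x] s * g x s * (forced R bd [:: o; x] w)%:R
     = chi R [:: o] s * L s by ring.
  rewrite /L mulr_sumr (bigID (mem K)) /= [X in _ + X]big1 ?addr0.
    apply: eq_big => x; first by rewrite inE andbA andbb.
    by rewrite inE => /andP[_ /andP[_ ->]]; rewrite chi2 !chi1 mulr1 mulrA.
  by move=> x /andP[xS]; rewrite inE xS => /negPf /= ->; rewrite mulr0.
set Q := \sum_s _.
have QE : Q = \sum_s D w s * expR (Y s) *
    (chi R [:: o] s * (L s * ch (L s) - sh (L s))).
  have Q2 : Q = \sum_s D w s * expR (Y s) *
      (chi R [:: o] s * (expR (- L s) * (L s + 1))).
    rewrite /Q (reindex_cmul t0); apply: eq_bigr => s _.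
    rewrite cmulC Dt0 Yt0 Lt0 chi_cmul Kt0 //. ring.
  have : Q + Q = \sum_s 2 * (D w s * expR (Y s) *
    (chi R [:: o] s * (L s * ch (L s) - sh (L s)))).
    rewrite {1}/Q Q2 -big_split /=; apply: eq_bigr => s _.
    by rewrite /ch /sh; field.
  by rewrite -mulr_sumr; lra.
rewrite QE; apply: sum_pd_ge0.
have pL : pd L by apply: pd_sum => x _; apply: pd_mul (pg x); exact: pd_chi.
have [_ _ pLL] := pd_ch_sh pL.
apply: pd_mul; last by apply: pd_mul pLL; exact: pd_chi.
apply: pd_mul.
  apply: pd_prod => e _; apply: pd_exp_sub1; apply: pd_mono; exact: subJ_ge0.
apply: pd_exp; apply: pd_add pE'.
by apply: pd_sum => x _; apply: pd_mul (pg x); exact: pd_chi.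
Qed.

End PairModel.

Lemma sum_set_split (R : realType) (T : finType) (T1 : {set T}) (P : pred {set T})
    (a : T -> R) : (forall w, P w = P (w :\: T1)) ->
  \sum_(w : {set T} | P w) \prod_(e in w) a e =
  (\prod_(e in T1) (1 + a e)) *
  \sum_(w : {set T} | (w \subset ~: T1) && P w) \prod_(e in w) a e.
Proof.
move=> PT; rewrite (partition_big (fun w => w :\: T1)
  (fun w => (w \subset ~: T1) && P w)) /=; last first.
  by move=> w; rewrite -PT => ->; rewrite finset.setDE finset.subsetIr.
rewrite mulr_sumr; apply: eq_bigr => w2 /andP[w2T Pw2].
have -> : \prod_(e in T1) (1 + a e) = \sum_(w : {set T} | w \subset T1) \prod_(e in w) a e.
  rewrite big_mkcond /=.
  transitivity (\prod_e ((if e \in T1 then a e else 0) + 1)).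
    by apply: eq_bigr => e _; case: ifP; rewrite ?add0r // addrC.
  rewrite bigA_distr [RHS]big_mkcond /=; apply: eq_big => [w|w _]; first by rewrite inE.
  rewrite (bigID (mem w)) /= [X in _ * X]big1 ?mulr1; last by move=> e /negPf ->.
  case: (boolP (w \subset T1)) => [/fintype.subsetP wT|].
    by apply: eq_bigr => e ew; rewrite ew wT.
  by move=> /subsetPn[e ew /negPf eT]; rewrite (bigD1 e) //= ew eT mul0r.
rewrite mulr_suml.
have w2d e : e \in T1 -> e \in w2 = false.
  by move=> eT; apply/negP => /(fintype.subsetP w2T); rewrite inE eT.
rewrite (reindex_onto (fun w1 : {set T} => w1 :|: w2) (fun w => w :&: T1)) /=; last first.
  move=> w /andP[_ /eqP <-]; apply/setP => e; rewrite !inE.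
  by case: (e \in T1); case: (e \in w).
apply: eq_big => [w|w /andP[_ /eqP wT]].
  apply/andP/fintype.subsetP => [[_ /eqP <-] e|wT]; first by rewrite inE => /andP[].
  have wd : (w :|: w2) :\: T1 = w2.
    apply/setP => e; rewrite !inE; case: (boolP (e \in T1)) => eT; first by rewrite w2d.
    by case: (boolP (e \in w)) => [/wT|//]; rewrite (negPf eT).
  rewrite PT wd Pw2 eqxx; split=> //; apply/eqP/setP => e; rewrite !inE.
  case: (boolP (e \in T1)) => eT; first by rewrite w2d // orbF andbT.
  by rewrite andbF; symmetry; apply/negbTE/negP => /wT; rewrite (negPf eT).
have wT' e : e \in w -> e \in T1 by rewrite -wT inE => /andP[].
rewrite (bigID (mem w)) /=; congr (_ * _); apply: eq_bigl => e; rewrite !inE.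
  by case: (e \in w); rewrite ?andbT ?andbF.
case: (boolP (e \in w)) => [/wT' /w2d ->|]; rewrite ?andbF //.
by rewrite /= andbT.
Qed.

(* Fibres of a homomorphism are translates of its kernel. *)
Lemma sum_hom_fibers (R : realType) (V W : finType)
    (p : {ffun W -> bool} -> {ffun V -> bool}) :
  (forall s t, p (cmul s t) = cmul (p s) (p t)) ->
  exists2 k : R, 0 < k &
  forall F : {ffun V -> bool} -> R,
    \sum_s F (p s) = k * \sum_(r in [set p s | s in setT]) F r.
Proof.
move=> hom; exists (\sum_(s | p s == [ffun=> true]) 1).
  rewrite (bigD1 [ffun=> true]) /=; last first.
    have e : p [ffun=> true] = cmul (p [ffun=> true]) (p [ffun=> true]).
      by rewrite -hom; congr p; apply/ffunP => v; rewrite !ffunE.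
    by rewrite e; apply/eqP/ffunP => v; rewrite !ffunE eqxx.
  by rewrite ltr_pwDl // sumr_ge0.
move=> F; rewrite (partition_big p (mem [set p s | s in setT])) /=; last first.
  by move=> s _; apply: finset.imset_f; rewrite inE.
rewrite mulr_sumr; apply: eq_bigr => r /finset.imsetP[s0 _ rs0].
rewrite mulr_suml (reindex_inj (inv_inj (cmulKl s0))) /=.
apply: eq_big => [s|s /eqP ->]; last by rewrite mul1r.
rewrite hom rs0; apply/eqP/eqP => [h|->].
  by apply/ffunP => v; move: h => /ffunP/(_ v); rewrite !ffunE; case: (p s0 v); case: (p s v).
by apply/ffunP => v; rewrite !ffunE; case: (p s0 v).
Qed.

Section FKModel.
Variables (R : realType) (V : finType) (J : V -> V -> R) (h : V -> R).
Hypothesis (J0 : forall x y, 0 <= J x y) (Jsym : forall x y, J x y = J y x).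
Hypothesis (h0 : forall x, 0 <= h x).
Implicit Types (s t : {ffun V -> bool}) (S : {set V}) (A B : seq V) (o x y v : V).

Let T : finType := ((V * V) + V)%type.
Implicit Types (w : {set T}) (P : {set T} -> bool).

Definition bond (e : T) : seq V :=
  match e with inl p => [:: p.1; p.2] | inr v => [:: v] end.
Definition bondJ (e : T) : R :=
  match e with inl p => J p.1 p.2 / 2 | inr v => h v end.
Definition bondu (e : T) : R := expR (2 * bondJ e) - 1.

Definition modelE s : R := pairE J s + fieldE h s.

Notation frc A w := (forced R bond A w).
Notation cpt w s := (compatible R bond w s).

Lemma modelE_bonds s : modelE s = \sum_e bondJ e * chi R (bond e) s.
Proof. by rewrite big_sumType /= /modelE pairE_pair. Qed.

Lemma pd_modelE : pd modelE.
Proof. by apply: pd_add; [exact: pd_pairE|exact: pd_fieldE]. Qed.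

Lemma bondu_ge0 e : 0 <= bondu e.
Proof.
rewrite subr_ge0 -[X in X <= _]expR0 ler_expR; apply: mulr_ge0 => //.
by case: e => [[x y]|v] /=; [exact: divr_ge0|exact: h0].
Qed.

Let fkw := fk_weight bond bondu.

Lemma fkw_tot_gt0 : 0 < \sum_w fkw w.
Proof.
rewrite (bigD1 finset.set0) //= ltr_pwDl //.
  by rewrite /fkw /fk_weight big_set0 mul1r ncompatible_gt0.
by apply: sumr_ge0 => w _; apply: fk_weight_ge0; exact: bondu_ge0.
Qed.

Definition fk P : R := (\sum_w fkw w * (P w)%:R) / \sum_w fkw w.

Lemma fk_le P (Q : {set T} -> bool) : (forall w, P w -> Q w) -> fk P <= fk Q.
Proof.
move=> PQ; rewrite ler_pM2r ?invr_gt0 ?fkw_tot_gt0 //; apply: ler_sum => w _.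
apply: ler_wpM2l; first by apply: fk_weight_ge0; exact: bondu_ge0.
by rewrite ler_nat; case: (boolP (P w)) => // /PQ ->.
Qed.

Lemma fk_addP P (Q Q' : {set T} -> bool) : (forall w, (P w : nat) = (Q w + Q' w)%N) -> fk P = fk Q + fk Q'.
Proof.
move=> H; rewrite /fk -mulrDl -big_split /=; congr (_ / _); apply: eq_bigr => w _.
by rewrite H natrD mulrDr.
Qed.

Lemma fkT : fk xpredT = 1.
Proof.
rewrite /fk; under eq_bigr do rewrite mulr1.
by rewrite divff // gt_eqF // fkw_tot_gt0.
Qed.

Lemma fkC P : fk (fun w => ~~ P w) = 1 - fk P.
Proof.
apply/eqP; rewrite eq_sym subr_eq -fkT; apply/eqP; apply: fk_addP => w.
by case: (P w).
Qed.

Lemma ev_chi_fk A : ev modelE (chi R A) = fk (fun w => frc A w).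
Proof.
have H (F : {ffun V -> bool} -> R) : \sum_s F s * expR (modelE s) =
    expR (- \sum_e bondJ e) * \sum_(w : {set T}) (\prod_(e in w) bondu e) *
      \sum_s (cpt w s)%:R * F s.
  by under eq_bigr => s _ do rewrite modelE_bonds; rewrite edwards_sokal.
rewrite /ev H; have -> : \sum_s expR (modelE s) = \sum_s 1 * expR (modelE s).
  by under [RHS]eq_bigr do rewrite mul1r.
rewrite H invfM mulrACA divff ?gt_eqF ?expR_gt0 // mul1r /fk; congr (_ / _).
  by apply: eq_bigr => w _; rewrite sum_compatible_chi mulrA.
by apply: eq_bigr => w _; congr (_ * _); apply: eq_bigr => s _; rewrite mulr1.
Qed.

Lemma fk_fkg A B : fk (fun w => frc A w) * fk (fun w => frc B w) <=
  fk (fun w => frc A w && frc B w).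
Proof.
have := fk_forced_fkg bond A B bondu_ge0; have Z0 := fkw_tot_gt0.
rewrite /fk -/fkw => H; rewrite mulf_div ler_pdivrMr ?mulr_gt0 //.
by rewrite [leRHS]mulrA divfK ?gt_eqF.
Qed.

Lemma fk_two_point o x :
  fk (fun w => frc [:: o; x] w && ~~ frc [:: o] w) <=
  ev modelE (chi R [:: o; x]) - ev modelE (chi R [:: o]) * ev modelE (chi R [:: x]).
Proof.
rewrite !ev_chi_fk.
have -> : fk (fun w => frc [:: o; x] w) = fk (fun w => frc [:: o; x] w && ~~ frc [:: o] w)
    + fk (fun w => frc [:: o; x] w && frc [:: o] w).
  by apply: fk_addP => w; case: (frc _ w); case: (frc _ w).
rewrite -addrA lerDl subr_ge0; apply: le_trans (fk_fkg _ _) _; apply: fk_le => w.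
move=> /andP[fo fx]; rewrite fo andbT; apply/forcedP => s cs.
by rewrite chi2 -!chi1 (forced_chi fo) // (forced_chi fx) // mulr1.
Qed.

Lemma fk_three_point o x y :
  fk (fun w => [&& frc [:: o; x] w, frc [:: y] w & ~~ frc [:: o] w]) +
  fk (fun w => [&& frc [:: o; y] w, frc [:: x] w & ~~ frc [:: o] w]) <=
  ev modelE (chi R [:: o; x; y]) - ev modelE (chi R [:: o]) * ev modelE (chi R [:: x; y]).
Proof.
rewrite !ev_chi_fk lerBrDr; apply: le_trans (lerD (lexx _) (fk_fkg [:: o] [:: x; y])) _.
have sub2 a b w : frc [:: a] w -> frc [:: b; a] w -> frc [:: b] w.
  move=> fa fb; apply/forcedP => s cs; have := forced_chi fb cs.
  by rewrite chi2 -!chi1 (forced_chi fa) // mulr1.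
rewrite -(fk_addP (P := fun w => [&& frc [:: o; x] w, frc [:: y] w & ~~ frc [:: o] w] ||
    [&& frc [:: o; y] w, frc [:: x] w & ~~ frc [:: o] w])); last first.
  move=> w; case: (boolP (frc [:: o] w)) => [|fo]; rewrite ?andbF // !andbT.
  have := @sub2 x o w; have := @sub2 y o w; rewrite (negPf fo).
  case: (frc [:: o; x] w); case: (frc [:: o; y] w); case: (frc [:: x] w);
  case: (frc [:: y] w) => //= h1 h2; try by have := h1 isT isT.
rewrite -(fk_addP (P := fun w => ([&& frc [:: o; x] w, frc [:: y] w & ~~ frc [:: o] w] ||
    [&& frc [:: o; y] w, frc [:: x] w & ~~ frc [:: o] w]) ||
    (frc [:: o] w && frc [:: x; y] w))); last first.
  move=> w; case: (frc [:: o] w); rewrite ?andbF ?orbF ?andbT //=.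
  by rewrite ?orbF ?addn0.
have cons3 s : chi R [:: o; x; y] s = spin R (s o) * spin R (s x) * spin R (s y).
  by rewrite /chi !big_cons big_nil mulr1 mulrA.
apply: fk_le => w /orP[/orP[]|].
- move=> /and3P[f1 f2 _]; apply/forcedP => s cs; have := forced_chi f1 cs.
  by have := forced_chi f2 cs; rewrite cons3 chi1 chi2 => -> ->; rewrite mulr1.
- move=> /and3P[f1 f2 _]; apply/forcedP => s cs; have := forced_chi f1 cs.
  by have := forced_chi f2 cs; rewrite cons3 chi1 chi2 mulrAC => -> ->; rewrite mulr1.
- move=> /andP[f1 f2]; apply/forcedP => s cs; have := forced_chi f1 cs.
  by have := forced_chi f2 cs; rewrite cons3 chi1 chi2 -mulrA => -> ->; rewrite mulr1.
Qed.

Definition free_set w : {set V} := [set v | ~~ frc [:: v] w].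

Definition inner S : {set T} :=
  [set e : T | if e is inl p then (p.1 \in S) && (p.2 \in S) else false].

Lemma frc1P v w : reflect (forall s, cpt w s -> s v) (frc [:: v] w).
Proof.
apply: (iffP (forcedP _ _ _ _)) => H s cs; apply/eqP; last first.
  by rewrite chi1_eq1 H.
by have /eqP := H s cs; rewrite chi1_eq1 => ->.
Qed.

Lemma cptP w s : cpt w s <->
  (forall x y, inl (x, y) \in w -> s x = s y) /\ (forall v, inr v \in w -> s v).
Proof.
split=> [/compatibleP H|[H1 H2]].
  split=> [x y /H/eqP|v /H/eqP]; first by rewrite /= chi2_eq1 => /eqP.
  by rewrite /= chi1_eq1.
apply/compatibleP => -[[x y]|v] ew; apply/eqP => /=.
  by rewrite chi2_eq1 (H1 _ _ ew).
by rewrite chi1_eq1 H2.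
Qed.

Lemma free_set_cpt w s : cpt w s -> forall v, v \notin free_set w -> s v.
Proof. by move=> cs v; rewrite inE negbK => /frc1P/(_ _ cs). Qed.

Lemma free_set_edge w x y : inl (x, y) \in w -> (x \in free_set w) = (y \in free_set w).
Proof.
move=> xyw; rewrite !inE; congr (~~ _); apply/frc1P/frc1P => H s cs;
by have := H s cs; have [/(_ _ _ xyw) ->] := (cptP w s).1 cs.
Qed.

Lemma free_set_field w v : inr v \in w -> v \notin free_set w.
Proof. by move=> vw; rewrite inE negbK; apply/frc1P => s /cptP[_ /(_ _ vw)]. Qed.

Lemma free_set_inner S w : (free_set w == S) = (free_set (w :\: inner S) == S).
Proof.
apply/eqP/eqP => FS.
  apply/setP => v; case: (boolP (v \in S)) => vS.
    rewrite -FS !inE in vS *; apply: contraNN vS; apply: forced_subset.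
    exact: finset.subsetDl.
  apply/negbTE; rewrite inE negbK; apply/frc1P => s /cptP[H1 H2].
  pose s' : {ffun V -> bool} := [ffun u => if u \in S then true else s u].
  suff /free_set_cpt/(_ v) : cpt w s' by rewrite FS vS ffunE (negPf vS); apply.
  apply/cptP; split=> [x y xyw|u uw]; rewrite !ffunE.
    have := free_set_edge xyw; rewrite FS => <-; case: ifP => // xS.
    by apply: H1; rewrite !inE xS.
  by case: ifP => // uS; apply: H2; rewrite !inE.
apply/setP => v; case: (boolP (v \in S)) => vS; last first.
  apply/negbTE; rewrite inE negbK; apply/(@forced_subset _ _ _ _ _ (w :\: inner S)).
    exact: finset.subsetDl.
  by move: vS; rewrite -{1}FS inE negbK.
rewrite inE; apply/frc1P => H.
pose s : {ffun V -> bool} := [ffun u => u \notin S].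
suff /H : cpt w s by rewrite ffunE vS.
apply/cptP; split=> [x y xyw|u uw]; rewrite !ffunE.
  case: (boolP (inl (x, y) \in inner S)); first by rewrite inE => /andP[/= -> ->].
  move=> ni; congr (~~ _); rewrite -FS; apply: free_set_edge.
  by rewrite inE ni.
by rewrite -FS; apply: free_set_field; rewrite !inE.
Qed.

Lemma fk_conditional S A : {subset A <= S} ->
  \sum_(w : {set T} | free_set w == S) fkw w * (frc A w)%:R =
  ev (pairE (subJ S J)) (chi R A) * \sum_(w : {set T} | free_set w == S) fkw w.
Proof.
move=> AS.
have H (F : {ffun V -> bool} -> R) :
  \sum_(w : {set T} | free_set w == S) (\prod_(e in w) bondu e) * (\sum_s (cpt w s)%:R * F s) =
  (expR (\sum_(e in inner S) bondJ e) *
   \sum_(w : {set T} | (w \subset ~: inner S) && (free_set w == S)) \prod_(e in w) bondu e) *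
  \sum_(s : {ffun V -> bool} | [forall v, (v \notin S) ==> s v])
    F s * expR (pairE (subJ S J) s).
  transitivity (\sum_(s : {ffun V -> bool} | [forall v, (v \notin S) ==> s v])
     \sum_(w : {set T} | free_set w == S) F s * \prod_(e in w) (bondu e * (chi R (bond e) s == 1)%:R)).
    under eq_bigr => w _ do rewrite mulr_sumr.
    rewrite exchange_big /= [RHS]big_mkcond /=; apply: eq_bigr => s _.
    case: ifP => [sS|sS].
      apply: eq_bigr => w _; rewrite big_split /=.
      suff <- : (cpt w s)%:R = \prod_(e in w) (chi R (bond e) s == 1)%:R :> R by ring.
      case: (boolP (cpt w s)) => [/compatibleP cs|].
        by rewrite big1 // => e ew; rewrite cs // eqxx.
      move=> /forallPn[e]; rewrite negb_imply => /andP[ew /negPf ne].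
      by rewrite (bigD1 e) //= ne mul0r.
    rewrite big1 // => w /eqP wS; case: (boolP (cpt w s)) => [cs|]; last by rewrite mul0r mulr0.
    case/negP: sS; apply/forallP => v; apply/implyP => vS.
    by apply: (free_set_cpt cs); rewrite wS.
  rewrite mulr_sumr; apply: eq_bigr => s /forallP sS.
  rewrite -mulr_sumr (@sum_set_split _ _ (inner S) (fun w => free_set w == S) _ (free_set_inner S)).
  have -> : \prod_(e in inner S) (1 + bondu e * (chi R (bond e) s == 1)%:R) =
      expR (\sum_(e in inner S) bondJ e) * expR (pairE (subJ S J) s).
    have -> : pairE (subJ S J) s = \sum_(e in inner S) bondJ e * chi R (bond e) s.
      rewrite [RHS]big_mkcond big_sumType /= [X in _ = _ + X]big1 ?addr0; last first.
        by move=> v _; rewrite inE.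
      rewrite pairE_pair; apply: eq_bigr => -[x y] _; rewrite inE /= /subJ.
      by case: ifP => // _; rewrite !mul0r.
    rewrite -expRD -big_split /= expR_sum; apply: eq_bigr => e _.
    case: (chi_pm R (bond e) s) => ->.
      by rewrite eqxx !mulr1 /bondu addrC subrK; congr expR; ring.
    have -> : (-1 == 1 :> R) = false by apply/negP => /eqP; lra.
    by rewrite mulr0 addr0 mulrN1 subrr expR0.
  set X := expR (\sum_(e in _) _); set Y := expR (pairE _ _).
  suff -> : \sum_(w : {set T} | (w \subset ~: inner S) && (free_set w == S))
      \prod_(e in w) (bondu e * (chi R (bond e) s == 1)%:R) =
    \sum_(w : {set T} | (w \subset ~: inner S) && (free_set w == S)) \prod_(e in w) bondu e.
    by ring.
  apply: eq_bigr => w /andP[/fintype.subsetP wi /eqP wS]; apply: eq_bigr => e ew.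
  suff -> : chi R (bond e) s == 1 by rewrite mulr1.
  case: e ew => [[x y]|v] ew /=; rewrite ?chi2_eq1 ?chi1_eq1.
    have := wi _ ew; rewrite !inE /= => ni; have := free_set_edge ew; rewrite wS => xy.
    move: ni; rewrite xy andbb => yS; have xS : x \notin S by rewrite xy.
    by rewrite (implyP (sS x) xS) (implyP (sS y) yS).
  by apply: (implyP (sS v)); rewrite -wS; exact: free_set_field.
have fE F : (\sum_(w : {set T} | free_set w == S) fkw w * F w) = \sum_(w : {set T} | free_set w == S) fkw w * F w by [].
have -> : \sum_(w : {set T} | free_set w == S) fkw w * (frc A w)%:R =
   \sum_(w : {set T} | free_set w == S) (\prod_(e in w) bondu e) * (\sum_s (cpt w s)%:R * chi R A s).
  by apply: eq_bigr => w _; rewrite sum_compatible_chi mulrA.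
have -> : \sum_(w : {set T} | free_set w == S) fkw w =
   \sum_(w : {set T} | free_set w == S) (\prod_(e in w) bondu e) * (\sum_s (cpt w s)%:R * 1).
  by apply: eq_bigr => w _; congr (_ * _); apply: eq_bigr => s _; rewrite mulr1.
rewrite !H mulrCA; congr (_ * _).
pose p s : {ffun V -> bool} := [ffun v => if v \in S then s v else true].
have [|k k0 Hk] := @sum_hom_fibers R V V p.
  by move=> s t; apply/ffunP => v; rewrite !ffunE; case: ifP.
have K F : (forall s, F (p s) = F s) ->
    \sum_s F s = k * \sum_(s : {ffun V -> bool} | [forall v, (v \notin S) ==> s v]) F s.
  move=> Fp; rewrite -(eq_bigr _ (fun s _ => Fp s)) Hk; congr (_ * _).
  apply: eq_bigl => s; apply/finset.imsetP/forallP => [[t _ ->] v|H'].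
    by rewrite ffunE; case: (v \in S).
  exists s; rewrite ?inE //; apply/ffunP => v; rewrite ffunE; case: ifP => // vS.
  by apply: (implyP (H' v)); rewrite vS.
have pE s : pairE (subJ S J) (p s) = pairE (subJ S J) s.
  rewrite /pairE; apply: eq_bigr => x _; apply: eq_bigr => y _; rewrite /subJ.
  case: ifP => [/andP[xS yS]|_]; last by rewrite !mul0r.
  by rewrite !chi2 !ffunE xS yS.
have pA s : chi R A (p s) = chi R A s.
  by apply: eq_big_seq => v /AS vS; rewrite ffunE vS.
rewrite /ev !K => [|s|s]; rewrite ?pE ?pA //.
under [X in _ = _ * X]eq_bigr do rewrite mul1r.
rewrite invfM mulrACA divff ?gt_eqF // mul1r divfK // gt_eqF //.
rewrite -(pmulr_rgt0 _ k0) -K ?part_gt0 // => s; by rewrite pE.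
Qed.

End FKModel.

(** * Sharpness *)

Section MagnetizationInequality.
Variables (R : realType) (V : finType) (J : V -> V -> R) (h : V -> R).
Hypothesis (J0 : forall x y, 0 <= J x y) (Jsym : forall x y, J x y = J y x).
Hypothesis (h0 : forall x, 0 <= h x).
Implicit Types (s : {ffun V -> bool}) (S : {set V}) (o x y : V).

Let E := modelE J h.
Let fkw := fk_weight (@bond V) (bondu J h).
Notation frc A w := (forced R (@bond V) A w).

Lemma simon_lieb_model S o M : o \in S -> (forall y, ev E (chi R [:: y]) <= M) ->
  ev E (chi R [:: o]) <= \sum_(x in S) ev (pairE (subJ S J)) (chi R [:: o; x]) *
    (h x + M * \sum_(y | y \notin S) J x y).
Proof.
move=> oS hM.
pose g x s := h x + \sum_(y | y \notin S) J x y * chi R [:: y] s.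
pose E' s := pairE (subJ (~: S) J) s + \sum_(x | x \notin S) h x * chi R [:: x] s.
have pg x : pd (g x).
  by apply: pd_add; [exact: pd_const|apply: pd_sum => y _; exact: pd_mono].
have pE' : pd E'.
  by apply: pd_add; [apply: pd_pairE; exact: subJ_ge0|apply: pd_sum => y _; exact: pd_mono].
apply: le_trans (@simon_lieb _ _ S J g E E' o oS J0 pg pE' _ _) _.
- move=> t tS; have tS' v : v \notin S -> chi R [:: v] t = 1.
    by move=> vS; apply/eqP; rewrite chi1_eq1 tS.
  split=> [x s|s].
    by rewrite /g; congr (_ + _); apply: eq_bigr => y yS; rewrite chi_cmul tS' // mulr1.
  rewrite /E'; congr (_ + _); last first.
    by apply: eq_bigr => y yS; rewrite chi_cmul tS' // mulr1.
  rewrite /pairE; apply: eq_bigr => x _; apply: eq_bigr => y _; rewrite /subJ !inE.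
  case: ifP => [/andP[xS yS]|_]; last by rewrite !mul0r.
  by rewrite chi_cmul [chi R _ t]chi2 -!chi1 !tS' // !mulr1.
- move=> s; rewrite /E /modelE /E' /fieldE.
  rewrite (bigID (mem S)) /=.
  suff -> : pairE J s = pairE (subJ S J) s + pairE (subJ (~: S) J) s +
     \sum_(x in S) \sum_(y | y \notin S) J x y * chi R [:: x; y] s.
    have -> : \sum_(x in S) chi R [:: x] s * g x s =
       \sum_(x in S) h x * chi R [:: x] s +
       \sum_(x in S) \sum_(y | y \notin S) J x y * chi R [:: x; y] s.
      rewrite -big_split /=; apply: eq_bigr => x _; rewrite /g mulrDr mulrC; congr (_ + _).
      by rewrite mulr_sumr; apply: eq_bigr => y _; rewrite chi2 !chi1; ring.
    by ring.
  pose q x y := J x y / 2 * chi R [:: x; y] s.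
  have qsym x y : q x y = q y x by rewrite /q Jsym !chi2 [X in _ * X]mulrC.
  have pS A : pairE (subJ A J) s = \sum_(x in A) \sum_(y in A) q x y.
    rewrite /pairE [RHS]big_mkcond; apply: eq_bigr => x _; rewrite /subJ.
    case: (x \in A) => /=; last by rewrite big1 // => y _; rewrite !mul0r.
    by rewrite [RHS]big_mkcond; apply: eq_bigr => y _; case: ifP; rewrite // !mul0r.
  rewrite !pS.
  have -> : pairE J s = \sum_x \sum_y q x y by [].
  have -> : \sum_(x in S) \sum_(y | y \notin S) J x y * chi R [:: x; y] s =
     \sum_(x in S) \sum_(y | y \notin S) q x y + \sum_(x | x \notin S) \sum_(y in S) q x y.
    rewrite [X in _ + X]exchange_big /= -big_split /=; apply: eq_bigr => x _.
    by rewrite -big_split /=; apply: eq_bigr => y _; rewrite (qsym y x) /q; field.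
  rewrite (bigID (mem S)) /=.
  have -> : \sum_(x in ~: S) \sum_(y in ~: S) q x y = \sum_(x | x \notin S) \sum_(y | y \notin S) q x y.
    by apply: eq_big => [x|x _]; [rewrite inE|apply: eq_bigl => y; rewrite inE].
  under eq_bigr => x _ do rewrite (bigID (mem S)) /=.
  under [X in _ + X = _]eq_bigr => x _ do rewrite (bigID (mem S)) /=.
  by rewrite !big_split /=; ring.
apply: ler_sum => x xS; apply: ler_wpM2l.
  by apply: ev_pd_ge0; [apply: pd_pairE; exact: subJ_ge0|exact: pd_chi].
rewrite /g evD ev_cst lerD2l ev_sum mulr_sumr; apply: ler_sum => y _.
by rewrite evZ mulrC ler_wpM2r.
Qed.

Lemma magnetization_inequality M o : (forall y, ev E (chi R [:: y]) <= M) ->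
  ev E (chi R [:: o]) * (1 - ev E (chi R [:: o])) <=
  \sum_x h x * (ev E (chi R [:: o; x]) - ev E (chi R [:: o]) * ev E (chi R [:: x])) +
  M * \sum_x \sum_y J x y / 2 *
    (ev E (chi R [:: o; x; y]) - ev E (chi R [:: o]) * ev E (chi R [:: x; y])).
Proof.
move=> hM.
have M0 : 0 <= M.
  by apply: le_trans (hM o); apply: ev_pd_ge0; [exact: pd_modelE|exact: pd_chi].
set m := ev E (chi R [:: o]).
have Z0 : 0 < \sum_w fkw w by exact: fkw_tot_gt0.
have w0 w : 0 <= fkw w by apply: fk_weight_ge0; exact: bondu_ge0.
have key : m * \sum_(w | o \in free_set R w) fkw w <=
  \sum_(w | o \in free_set R w) fkw w * \sum_(x in free_set R w)
     (h x + M * \sum_(y | y \notin free_set R w) J x y) * (frc [:: o; x] w)%:R.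
  rewrite (partition_big (@free_set R V) (fun S => o \in S)) //=.
  rewrite [leRHS](partition_big (@free_set R V) (fun S => o \in S)) //= mulr_sumr.
  apply: ler_sum => S oS.
  have PS w : (o \in free_set R w) && (free_set R w == S) = (free_set R w == S).
    by case: eqP => [->|_]; rewrite ?oS ?andbF.
  rewrite !(eq_bigl _ _ PS).
  have -> : \sum_(w | free_set R w == S) fkw w * \sum_(x in free_set R w)
     (h x + M * \sum_(y | y \notin free_set R w) J x y) * (frc [:: o; x] w)%:R =
     (\sum_(x in S) ev (pairE (subJ S J)) (chi R [:: o; x]) *
    (h x + M * \sum_(y | y \notin S) J x y)) * \sum_(w | free_set R w == S) fkw w.
    rewrite mulr_suml.
    transitivity (\sum_(x in S) (h x + M * \sum_(y | y \notin S) J x y) *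
       \sum_(w | free_set R w == S) fkw w * (frc [:: o; x] w)%:R).
      under [RHS]eq_bigr => x _ do rewrite mulr_sumr.
      rewrite [RHS]exchange_big /=; apply: eq_bigr => w /eqP ->.
      by rewrite mulr_sumr; apply: eq_bigr => x _; ring.
    apply: eq_bigr => x xS; rewrite fk_conditional //; first by rewrite /fkw; ring.
    by move=> v; rewrite !inE => /orP[]/eqP ->.
  apply: ler_wpM2r; first exact: sumr_ge0.
  exact: simon_lieb_model.
have fkE (P : {set (V * V + V)%type} -> bool) :
   \sum_w fkw w * (P w)%:R = fk J h P * \sum_w fkw w.
  by rewrite /fk divfK // gt_eqF.
have mE : m * (1 - m) * \sum_w fkw w = m * \sum_(w | o \in free_set R w) fkw w.
  rewrite /m ev_chi_fk // -fkC // -mulrA -fkE [in RHS]big_mkcond; congr (_ * _).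
  by apply: eq_bigr => w _; rewrite inE; case: forced; rewrite ?mulr0 ?mulr1.
rewrite -(ler_pM2r Z0) mE; apply: le_trans key _.
apply: (@le_trans _ _ (\sum_w fkw w * (\sum_x h x * (frc [:: o; x] w && ~~ frc [:: o] w)%:R +
   M * \sum_x \sum_y J x y * [&& frc [:: o; x] w, frc [:: y] w & ~~ frc [:: o] w]%:R))).
  rewrite big_mkcond; apply: ler_sum => w _; case: ifP => [|_]; last first.
    apply: mulr_ge0 => //; apply: addr_ge0.
      by apply: sumr_ge0 => x _; rewrite mulr_ge0.
    by apply: mulr_ge0 => //; apply: sumr_ge0 => x _; apply: sumr_ge0 => y _; rewrite mulr_ge0.
  rewrite inE => /negPf ->; apply: ler_wpM2l => //.
  rewrite mulr_sumr -big_split /= big_mkcond; apply: ler_sum => x _; rewrite andbT.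
  have X0 : 0 <= h x * (frc [:: o; x] w)%:R + M * \sum_y J x y * [&& frc [:: o; x] w, frc [:: y] w & true]%:R.
    rewrite addr_ge0 ?mulr_ge0 //; by apply: sumr_ge0 => y _; rewrite mulr_ge0.
  case: ifP => // _; rewrite mulrDl lerD2l -mulrA; apply: ler_wpM2l => //.
  rewrite big_mkcond mulr_suml; apply: ler_sum => y _; rewrite inE negbK andbT.
  by case: (frc [:: y] w); case: (frc [:: o; x] w); rewrite /= ?mulr1 ?mulr0 ?mul0r.
have -> : \sum_w fkw w * (\sum_x h x * (frc [:: o; x] w && ~~ frc [:: o] w)%:R +
   M * \sum_x \sum_y J x y * [&& frc [:: o; x] w, frc [:: y] w & ~~ frc [:: o] w]%:R) =
   (\sum_x h x * fk J h (fun w => frc [:: o; x] w && ~~ frc [:: o] w) +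
    M * \sum_x \sum_y J x y * fk J h (fun w => [&& frc [:: o; x] w, frc [:: y] w & ~~ frc [:: o] w])) * \sum_w fkw w.
  rewrite mulrDl -mulrA !mulr_suml.
  under eq_bigr => w _ do rewrite mulrDr.
  rewrite big_split /=; congr (_ + _).
    under eq_bigr => w _ do rewrite mulr_sumr.
    rewrite exchange_big /=; apply: eq_bigr => x _.
    by rewrite -mulrA -fkE mulr_sumr; apply: eq_bigr => w _; ring.
  rewrite mulr_sumr.
  under eq_bigr => w _ do rewrite mulrCA mulr_sumr mulr_sumr.
  rewrite exchange_big /=; apply: eq_bigr => x _.
  rewrite mulr_suml mulr_sumr.
  under eq_bigr => w _ do rewrite !mulr_sumr.
  rewrite exchange_big /=; apply: eq_bigr => y _.
  by rewrite -mulrA -fkE !mulr_sumr; apply: eq_bigr => w _; ring.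
rewrite ler_pM2r //; apply: lerD.
  by apply: ler_sum => x _; rewrite ler_wpM2l // fk_two_point.
apply: ler_wpM2l => //.
set f := fun x y => fk J h (fun w => [&& frc [:: o; x] w, frc [:: y] w & ~~ frc [:: o] w]).
have -> : \sum_x \sum_y J x y * f x y = \sum_x \sum_y J x y / 2 * (f x y + f y x).
  have -> : \sum_x \sum_y J x y / 2 * (f x y + f y x) =
     \sum_x \sum_y J x y / 2 * f x y + \sum_x \sum_y J x y / 2 * f y x.
    rewrite -big_split /=; apply: eq_bigr => x _; rewrite -big_split /=.
    by apply: eq_bigr => y _; rewrite mulrDr.
  rewrite [X in _ = _ + X]exchange_big /= -big_split /=; apply: eq_bigr => x _.
  rewrite -big_split /=; apply: eq_bigr => y _.
  by rewrite (Jsym y x); field.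
apply: ler_sum => x _; apply: ler_sum => y _; apply: ler_wpM2l; first by rewrite divr_ge0.
exact: fk_three_point.
Qed.

End MagnetizationInequality.

Section Derivatives.
Variables (R : realType) (V : finType).
Implicit Types (s : {ffun V -> bool}) (f A B C : {ffun V -> bool} -> R).

Lemma is_derive_sum_seq (I : Type) (r : seq I) (f : I -> R -> R) (df : I -> R) (x : R) :
  (forall i, is_derive x (1 : R) (f i) (df i)) ->
  is_derive x (1 : R) (fun y => \sum_(i <- r) f i y) (\sum_(i <- r) df i).
Proof.
move=> fdf; elim: r => [|i r IH].
  rewrite big_nil; have -> : (fun y => \sum_(i <- [::]) f i y) = cst 0.
    by apply/funext => y; rewrite big_nil.
  exact: is_derive_cst.
rewrite big_cons; have -> : (fun y => \sum_(j <- i :: r) f j y) =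
    f i + (fun y => \sum_(j <- r) f j y).
  by apply/funext => y; rewrite big_cons.
exact: is_deriveD.
Qed.

Lemma is_derive_ev A B C f (x : R) :
  let E y s := A s + (y * B s + expR y * C s) in
  let G s := B s + expR x * C s in
  is_derive x (1 : R) (fun y => ev (E y) f)
    (ev (E x) (fun s => f s * G s) - ev (E x) f * ev (E x) G).
Proof.
move=> E G.
have dE g : is_derive x (1 : R) (fun y => \sum_s g s * expR (E y s))
    (\sum_s g s * G s * expR (E x s)).
  apply: is_derive_sum_seq => s; rewrite /E; apply: is_derive_eq.
  by rewrite /GRing.scale /= /G; ring.
have Z0 : \sum_s expR (E x s) != 0 by rewrite gt_eqF // part_gt0.
have dZ : is_derive x (1 : R) (fun y => \sum_s expR (E y s))
    (\sum_s G s * expR (E x s)).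
  have := dE (fun=> 1).
  have -> : (fun y => \sum_s 1 * expR (E y s)) = (fun y => \sum_s expR (E y s)).
    by apply/funext => y; apply: eq_bigr => s _; rewrite mul1r.
  have -> // : \sum_s 1 * G s * expR (E x s) = \sum_s G s * expR (E x s).
  by apply: eq_bigr => s _; rewrite mul1r.
apply: (is_derive_eq (is_deriveM (dE f) (is_deriveV Z0 dZ))).
rewrite /ev /GRing.scale /=; field.
exact: Z0.
Qed.

End Derivatives.

Section ExpLower.
Variables (R : realType) (V : finType).

Lemma sh_ge_id (x : R) : 0 <= x -> x <= sh x.
Proof.
move=> x0; rewrite -subr_ge0.
pose F y : R := sh y - y.
have dF (y : R) : is_derive y (1 : R) F (ch y - 1).
  rewrite /F /ch /sh; apply: is_derive_eq; rewrite /GRing.scale /=.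
  by field.
have F0 : F 0 = 0 by rewrite /F /sh oppr0 subrr mul0r addr0.
rewrite -/(F x) -F0; apply: (le_of_derive_ge0 x0 dF) => y _.
by rewrite subr_ge0 ch_ge1.
Qed.

Lemma pd_exp_sub_id (f : {ffun V -> bool} -> R) : pd f ->
  pd (fun s => expR (f s) - f s).
Proof.
move=> pf; suff H : pd (fun s => expR (f s) - 1 - f s).
  by apply: pd_ext (pd_add (pd_const V ler01) H) => s; ring.
elim: pf => [c l c0|f1 f2 p1 h1 p2 h2].
  have a0 : 0 <= ch c - 1 by rewrite subr_ge0 ch_ge1.
  have b0 : 0 <= sh c - c by rewrite subr_ge0 sh_ge_id.
  apply: pd_ext (pd_add (pd_const V a0) (pd_mono l b0)) => s.
  by rewrite expR_ch_sh ch_chi sh_chi; ring.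
apply: pd_ext (pd_add (pd_add h1 h2) (pd_mul (pd_exp_sub1 p1) (pd_exp_sub1 p2))) => s.
by rewrite expRD; ring.
Qed.

End ExpLower.

Section Transitive.
Variables (R : realType) (V : finType) (J : V -> V -> R).
Hypothesis (J0 : forall x y, 0 <= J x y) (Jsym : forall x y, J x y = J y x).
Hypothesis Jtrans : forall x y, exists2 p : V -> V, injective p &
  p x = y /\ forall a b, J (p a) (p b) = J a b.
Variable o : V.
Implicit Types (s : {ffun V -> bool}) (b h M H L bmax : R).

Let E b h := modelE (fun x y => b * J x y) (fun=> h).
Definition mag b h : R := ev (E b h) (chi R [:: o]).

Lemma pairEZ b s : pairE (fun x y => b * J x y) s = b * pairE J s.
Proof.
rewrite /pairE mulr_sumr; apply: eq_bigr => x _; rewrite mulr_sumr.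
by apply: eq_bigr => y _; rewrite !mulrA.
Qed.

Lemma modelE_const b h s : E b h s = b * pairE J s + h * \sum_x chi R [:: x] s.
Proof. by rewrite /E /modelE pairEZ; congr (_ + _); rewrite mulr_sumr. Qed.

Lemma mag_trans b h x : ev (E b h) (chi R [:: x]) = mag b h.
Proof.
have [p ip [po Jp]] := Jtrans o x.
pose q s : {ffun V -> bool} := [ffun v => s (p v)].
have iq : injective q.
  move=> s t /ffunP st; apply/ffunP => v; have [p' pK p'K] := injF_bij ip.
  by have := st (p' v); rewrite !ffunE p'K.
have Eq s : E b h (q s) = E b h s.
  rewrite !modelE_const; congr (_ * _ + _ * _).
    rewrite /pairE [RHS](reindex_inj ip); apply: eq_bigr => a _.
    rewrite [RHS](reindex_inj ip); apply: eq_bigr => c _.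
    by rewrite Jp !chi2 !ffunE.
  by rewrite [RHS](reindex_inj ip); apply: eq_bigr => a _; rewrite !chi1 ffunE.
rewrite /mag /ev [in RHS](reindex_inj iq); congr (_ / _).
by apply: eq_bigr => s _; rewrite Eq !chi1 ffunE po.
Qed.

Lemma pd_sum_spins : pd (fun s => \sum_x chi R [:: x] s).
Proof. by apply: pd_sum => x _; exact: pd_chi. Qed.

Lemma mag_ge0 b h : 0 <= b -> 0 <= h -> 0 <= mag b h.
Proof.
move=> b0 hh0; apply: ev_pd_ge0; last exact: pd_chi.
by apply: pd_modelE => // x y; rewrite mulr_ge0.
Qed.

Lemma mag_inequality b h : 0 <= b -> 0 <= h ->
  mag b h * (1 - mag b h) <=
  h * (ev (E b h) (fun s => chi R [:: o] s * \sum_x chi R [:: x] s) -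
       mag b h * ev (E b h) (fun s => \sum_x chi R [:: x] s)) +
  b * mag b h * (ev (E b h) (fun s => chi R [:: o] s * pairE J s) -
       mag b h * ev (E b h) (pairE J)).
Proof.
move=> b0 hh0.
have bJ0 x y : 0 <= b * J x y by rewrite mulr_ge0.
have bJsym x y : b * J x y = b * J y x by rewrite Jsym.
have := @magnetization_inequality R V _ _ bJ0 bJsym (fun=> hh0) (mag b h) o _.
rewrite -/(E b h) => /(_ (fun y => eq_ind_r (fun z => z <= _) (lexx _) (mag_trans b h y))).
rewrite -/(mag b h) => /le_trans; apply; rewrite le_eqVlt; apply/orP; left; apply/eqP; congr (_ + _).
  rewrite -mulr_sumr; congr (_ * _); rewrite sumrB ev_sum mulr_sumr; congr (_ - _).
  rewrite -ev_sum; congr ev; apply/funext => s; rewrite mulr_sumr.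
  by apply: eq_bigr => x _; rewrite chi2 !chi1.
rewrite -mulrA [b * _]mulrCA; congr (_ * _).
have evp F : ev (E b h) (fun s => F s * pairE J s) =
    \sum_x \sum_y J x y / 2 * ev (E b h) (fun s => F s * chi R [:: x; y] s).
  transitivity (ev (E b h) (fun s => \sum_x \sum_y J x y / 2 * (F s * chi R [:: x; y] s))).
    congr ev; apply/funext => s; rewrite mulr_sumr; apply: eq_bigr => x _.
    by rewrite mulr_sumr; apply: eq_bigr => y _; ring.
  rewrite ev_sum; apply: eq_bigr => x _; rewrite ev_sum; apply: eq_bigr => y _.
  by rewrite evZ.
have -> : ev (E b h) (pairE J) = ev (E b h) (fun s => 1 * pairE J s).
  by congr ev; apply/funext => s; rewrite mul1r.
rewrite !evp mulr_sumr -sumrB mulr_sumr; apply: eq_bigr => x _.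
rewrite mulr_sumr -sumrB mulr_sumr; apply: eq_bigr => y _.
have -> : (fun s => chi R [:: o] s * chi R [:: x; y] s) = chi R [:: o; x; y].
  by apply/funext => s; rewrite -chi_cat.
have -> : (fun s => 1 * chi R [:: x; y] s) = chi R [:: x; y].
  by apply/funext => s; rewrite mul1r.
by ring.
Qed.

Lemma mag_mono b b' h h' : 0 <= b -> 0 <= h -> b <= b' -> h <= h' -> mag b h <= mag b' h'.
Proof.
move=> b0 hh0 bb' hh'.
pose D s := (b' - b) * pairE J s + (h' - h) * \sum_x chi R [:: x] s.
have -> : mag b' h' = ev (fun s => E b h s + D s) (chi R [:: o]).
  by rewrite /mag; congr ev; apply/funext => s; rewrite /D !modelE_const; ring.
apply: ev_mono; last exact: pd_chi.
  by apply: pd_modelE => // x y; rewrite mulr_ge0.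
apply: pd_add; apply: pd_scale; rewrite ?subr_ge0 //.
  exact: pd_pairE.
exact: pd_sum_spins.
Qed.

(* The differential inequality, integrated along a curve on which [h] grows
   exponentially while [b] moves slowly enough. *)
Lemma mag_step b h bmax L M : 0 <= b -> 0 <= h -> 0 <= L -> 0 <= bmax ->
  b + bmax * M * L <= bmax -> mag bmax (h * expR L) <= M ->
  mag b h <= M * expR (- (1 - M) * L).
Proof.
move=> b0 hh0 L0 bm0 bL magM.
have M0 : 0 <= M by apply: le_trans magM; apply: mag_ge0; rewrite // mulr_ge0 // expR_ge0.
set d := bmax * M.
have d0 : 0 <= d by rewrite mulr_ge0.
pose bs (t : R) := b + d * t; pose hs (t : R) := h * expR t.
pose g (t : R) := mag (bs t) (hs t) * expR (- (1 - M) * t).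
pose S s := \sum_x chi R [:: x] s.
pose G t s := d * pairE J s + expR t * (h * S s).
pose cov t := ev (E (bs t) (hs t)) (fun s => chi R [:: o] s * G t s) -
   mag (bs t) (hs t) * ev (E (bs t) (hs t)) (G t).
have dmag (t : R) : is_derive t (1 : R) (fun u => mag (bs u) (hs u)) (cov t).
  have := @is_derive_ev R V (fun s => b * pairE J s) (fun s => d * pairE J s)
    (fun s => h * S s) (chi R [:: o]) t.
  have EE u : (fun s => b * pairE J s + (u * (d * pairE J s) + expR u * (h * S s))) =
      E (bs u) (hs u).
    by apply/funext => s; rewrite modelE_const /bs /hs -/(S s); ring.
  rewrite /= EE; have -> : (fun y : R => ev (fun s => b * pairE J s +
     (y * (d * pairE J s) + expR y * (h * S s))) (chi R [:: o])) =
     (fun u => mag (bs u) (hs u)); last by [].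
  by apply/funext => u; rewrite EE.
have dg (t : R) : is_derive t (1 : R) g
    (expR (- (1 - M) * t) * (cov t - (1 - M) * mag (bs t) (hs t))).
  apply: is_derive_eq; rewrite /GRing.scale /=; ring.
have hs0 t : 0 <= hs t by rewrite mulr_ge0 // expR_ge0.
have g0L : g 0 <= g L.
  apply: (le_of_derive_ge0 L0 dg) => t /andP[t0 tL].
  apply: mulr_ge0; first exact: expR_ge0.
  have bs0 : 0 <= bs t by rewrite addr_ge0 // mulr_ge0.
  have bsb : bs t <= bmax by apply: le_trans bL; rewrite lerD2l ler_wpM2l.
  have mM : mag (bs t) (hs t) <= M.
    apply: le_trans magM; apply: mag_mono => //.
    by rewrite ler_wpM2l // ler_expR.
  have mg0 : 0 <= mag (bs t) (hs t) by exact: mag_ge0.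
  have pE : pd (E (bs t) (hs t)) by apply: pd_modelE => // x y; rewrite mulr_ge0.
  have covE : cov t = hs t * (ev (E (bs t) (hs t)) (fun s => chi R [:: o] s * S s) -
       mag (bs t) (hs t) * ev (E (bs t) (hs t)) S) +
     d * (ev (E (bs t) (hs t)) (fun s => chi R [:: o] s * pairE J s) -
       mag (bs t) (hs t) * ev (E (bs t) (hs t)) (pairE J)).
    rewrite /cov.
    have -> : (fun s => chi R [:: o] s * G t s) = (fun s =>
      d * (chi R [:: o] s * pairE J s) + hs t * (chi R [:: o] s * S s)).
      by apply/funext => s; rewrite /G /hs; ring.
    have -> : G t = (fun s => d * pairE J s + hs t * S s).
      by apply/funext => s; rewrite /G /hs; ring.
    by rewrite !evD !evZ; ring.
  have := mag_inequality bs0 (hs0 t); rewrite covE -/S.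
  set c1 := hs t * _; set c2 := (ev _ _ - _) => H.
  have c20 : 0 <= c2.
    by rewrite subr_ge0; apply: ev_gks2 => //; [exact: pd_chi|exact: pd_pairE].
  have : bs t * mag (bs t) (hs t) * c2 <= d * c2.
    by apply: ler_wpM2r => //; apply: ler_pM.
  have : (1 - M) * mag (bs t) (hs t) <= mag (bs t) (hs t) * (1 - mag (bs t) (hs t)).
    by rewrite mulrC ler_wpM2l // lerD2l lerN2.
  move: H; set X := mag _ _; lra.
move: g0L; rewrite /g /bs /hs !mulr0 !expR0 mulr1 addr0 mulr1 => /le_trans; apply.
apply: ler_wpM2r; first exact: expR_ge0.
apply: le_trans magM; apply: mag_mono => //.
- by rewrite addr_ge0 // mulr_ge0.
- by apply: mulr_ge0; [exact: hh0|exact: expR_ge0].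
Qed.

(* With [u] the sum of the bounds used so far, the bound obtained after [k]
   steps is [M * expR (2 * u - 2 * k)]. *)
Lemma mag_iterate bmax H M k : 0 <= bmax -> 0 <= H -> 0 <= M <= 1 / 4 ->
  mag bmax H <= M ->
  exists2 u : R, 0 <= u <= 2 * M - 2 * (M * expR (2 * u - 2 * k%:R)) &
  forall b, 0 <= b <= bmax * (1 - 2 * u) ->
    mag b (H * expR (- (2 * k%:R))) <= M * expR (2 * u - 2 * k%:R).
Proof.
move=> bm0 H0 /andP[M0 M2] magM; elim: k => [|k [u /andP[u0 uM] IH]].
  exists 0; first by rewrite !mulr0 subrr expR0; lra.
  move=> b /andP[b0 bb]; rewrite !mulr0 subrr oppr0 expR0 !mulr1.
  by apply: le_trans magM; apply: mag_mono => //; lra.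
set M' := M * expR (2 * u - 2 * k%:R) in uM IH *.
have M'0 : 0 <= M' by rewrite mulr_ge0 // expR_ge0.
have E2 : M * expR (2 * (u + M') - 2 * k.+1%:R) = M' * expR (- (1 - M') * 2).
  by rewrite /M' -mulrA -expRD -/M'; congr (_ * expR _); rewrite -natr1; ring.
have M'2 : M' <= 1 / 2 by lra.
have M2' : M' * expR (- (1 - M') * 2) <= M' / 2.
  apply: ler_wpM2l => //; rewrite mulNr expRN lef_pV2 ?posrE ?expR_gt0 //.
  by apply: le_trans (expR_ge1Dx _); lra.
exists (u + M'); first by rewrite E2; apply/andP; split; lra.
move=> b /andP[b0 bb]; rewrite E2.
have u1 : 0 <= bmax * (1 - 2 * u) by apply: mulr_ge0 => //; lra.
apply: (@mag_step _ _ (bmax * (1 - 2 * u))) => //.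
- by apply: mulr_ge0; [exact: H0|exact: expR_ge0].
- have : 0 <= bmax * M' * u by apply: (mulr_ge0 (mulr_ge0 bm0 M'0) u0).
  lra.
- rewrite -mulrA -expRD.
  have -> : - (2 * k.+1%:R) + 2 = - (2 * k%:R) :> R by rewrite -natr1; ring.
  by apply: IH; rewrite u1 lexx.
Qed.

Lemma susceptibility_le_mag b h : 0 <= b -> 0 <= h ->
  h * ev (E b 0) (fun s => chi R [:: o] s * \sum_x chi R [:: x] s) <=
  mag b h * expR (h * #|V|%:R).
Proof.
move=> b0 hh0; pose S s := \sum_x chi R [:: x] s.
have pE : pd (E b 0) by apply: pd_modelE => // x y; rewrite mulr_ge0.
have -> : mag b h = ev (fun s => E b 0 s + h * S s) (chi R [:: o]).
  by rewrite /mag; congr ev; apply/funext => s; rewrite !modelE_const /S; ring.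
rewrite ev_shift.
have Z0 : 0 < ev (E b 0) (fun s => expR (h * S s)) by apply: ev_gt0 => s; exact: expR_gt0.
have Z1 : ev (E b 0) (fun s => expR (h * S s)) <= expR (h * #|V|%:R).
  rewrite -[leRHS](ev_cst (E b 0)); apply: ev_le => s; rewrite ler_expR ler_wpM2l //.
  rewrite -sum1_card natr_sum; apply: ler_sum => x _.
  by rewrite -(norm_chi R [:: x] s) ler_norm.
have pS := pd_scale hh0 pd_sum_spins.
have N1 : h * ev (E b 0) (fun s => chi R [:: o] s * S s) <=
    ev (E b 0) (fun s => chi R [:: o] s * expR (h * S s)).
  rewrite -evZ -subr_ge0 -evN -evD; apply: ev_pd_ge0 => //.
  by apply: pd_ext (pd_mul (pd_chi R [:: o]) (pd_exp_sub_id pS)) => s; rewrite /S; ring.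
apply: le_trans N1 _; rewrite -mulrA ler_peMr //.
  apply: ev_pd_ge0 => //; apply: pd_mul (pd_exp pS); exact: pd_chi.
by rewrite mulrC ler_pdivlMr // mul1r.
Qed.

Lemma susceptibility_bound b bmax H M : 0 <= b -> 0 <= bmax -> 0 < H -> 0 <= M <= 1 / 4 ->
  b <= bmax * (1 - 4 * M) -> mag bmax H <= M ->
  \sum_x ev (pairE (fun x y => b * J x y)) (chi R [:: o; x]) <= expR 3 / H.
Proof.
move=> b0 bm0 H0 M012 bb magM; have /andP[M0 M12] := M012.
pose k := Num.bound (H * #|V|%:R).
have kV : H * #|V|%:R <= k%:R by apply: ltW; apply: archi_boundP; rewrite mulr_ge0 // ltW.
have [u /andP[u0 uM] Hu] := mag_iterate k bm0 (ltW H0) M012 magM.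
set h := H * expR (- (2 * k%:R)).
have h0 : 0 < h by rewrite mulr_gt0 // expR_gt0.
have hV : h * #|V|%:R <= 1.
  rewrite /h mulrAC expRN ler_pdivrMr ?expR_gt0 // mul1r.
  by apply: le_trans kV _; apply: le_trans (expR_ge1Dx _); have := ler0n R k; lra.
have X0 : 0 <= M * expR (2 * u - 2 * k%:R) by rewrite mulr_ge0 // expR_ge0.
have b1 : 0 <= b <= bmax * (1 - 2 * u).
  by rewrite b0 /= (le_trans bb) // ler_wpM2l //; lra.
have /(le_trans (susceptibility_le_mag b0 (ltW h0))) H1 :
    mag b h * expR (h * #|V|%:R) <= M * expR (2 * u - 2 * k%:R) * expR 1.
  apply: ler_pM; rewrite ?expR_ge0 ?ler_expR ?Hu //.
  by apply: mag_ge0 => //; exact: ltW.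
have -> : \sum_x ev (pairE (fun x y => b * J x y)) (chi R [:: o; x]) =
    ev (E b 0) (fun s => chi R [:: o] s * \sum_x chi R [:: x] s).
  rewrite -ev_sum; congr ev; apply/funext => s.
    by rewrite modelE_const mul0r addr0 pairEZ.
  by rewrite mulr_sumr; apply: eq_bigr => x _; rewrite chi2 !chi1.
rewrite ler_pdivlMr // mulrC -(ler_pM2r (expR_gt0 (- (2 * k%:R)))) mulrAC -/h.
apply: le_trans H1 _; rewrite -mulrA -!expRD.
have e3 : expR (2 * u - 2 * k%:R + 1) <= expR (3 + - (2 * k%:R)) :> R by rewrite ler_expR; lra.
apply: le_trans e3; rewrite ler_piMl ?expR_ge0 //; lra.
Qed.

End Transitive.

(** * Gaussian domination *)

Section Gaussian.
Variables (R : realType) (V : finType) (J : V -> V -> R).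
Hypothesis (J0 : forall x y, 0 <= J x y) (Jsym : forall x y, J x y = J y x).
Implicit Types (s : {ffun V -> bool}) (h : V -> R).

Lemma ch_le_gauss (x : R) : 0 <= x -> ch x <= expR (x ^+ 2 / 2).
Proof.
move=> x0; pose F y : R := - (ch y * expR (- (y * y) / 2)).
have dF (y : R) : is_derive y (1 : R) F (expR (- (y * y) / 2) * (y * ch y - sh y)).
  rewrite /F /ch /sh; apply: is_derive_eq; rewrite /GRing.scale /=.
  by field.
have : F 0 <= F x.
  apply: (le_of_derive_ge0 x0 dF) => y /andP[y0 _].
  by apply: mulr_ge0; rewrite ?expR_ge0 // subr_ge0 sh_le_ch.
rewrite /F /ch mulr0 oppr0 mul0r expR0 mulr1 -mulr2n divff ?pnatr_eq0 //.
rewrite lerN2 -/(ch x) mulNr expRN ler_pdivrMr ?expR_gt0 // mul1r.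
by rewrite expr2.
Qed.

Lemma fieldE_abs h :
  pd (fun s => expR (fieldE (fun x => `|h x|) s) - expR (fieldE h s)) /\
  pd (fun s => expR (fieldE (fun x => `|h x|) s) + expR (fieldE h s)).
Proof.
rewrite /fieldE; elim: (index_enum V) => [|x r [IH1 IH2]].
  split; [apply: pd_ext (pd_const V (lexx 0))|apply: pd_ext (pd_const V (ler0n R 2))] => s;
  by rewrite !big_nil expR0 ?subrr.
pose D s := expR (`|h x| * chi R [:: x] s) - expR (h x * chi R [:: x] s).
pose S s := expR (`|h x| * chi R [:: x] s) + expR (h x * chi R [:: x] s).
have pD : pd D.
  have c0 : 0 <= sh `|h x| - sh (h x).
    have [h0|h0] := leP 0 (h x); first by rewrite ger0_norm // subrr.
    by rewrite ltr0_norm // shN; have := sh_ge0 (ltW (_ : 0 < - h x)); rewrite oppr_gt0 shN => /(_ h0); lra.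
  apply: pd_ext (pd_mono [:: x] c0) => s; rewrite /D !expR_ch_sh !ch_chi !sh_chi.
  have -> : ch `|h x| = ch (h x).
    by have [h0|h0] := leP 0 (h x); [rewrite ger0_norm|rewrite ltr0_norm // chN].
  by ring.
have pS : pd S.
  have c0 : 0 <= sh `|h x| + sh (h x).
    have [h0|h0] := leP 0 (h x); last by rewrite ltr0_norm // shN addNr.
    by rewrite ger0_norm // addr_ge0 // sh_ge0.
  have a0 : 0 <= ch `|h x| + ch (h x).
    by have := ch_ge1 `|h x|; have := ch_ge1 (h x); lra.
  apply: pd_ext (pd_add (pd_const V a0) (pd_mono [:: x] c0)) => s.
  by rewrite /S !expR_ch_sh !ch_chi !sh_chi; ring.
have half0 : 0 <= 1 / 2 :> R by rewrite divr_ge0.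
split.
  apply: pd_ext (pd_scale half0 (pd_add (pd_mul pD IH2) (pd_mul pS IH1))) => s.
  by rewrite /D /S !big_cons !expRD; field.
apply: pd_ext (pd_scale half0 (pd_add (pd_mul pD IH1) (pd_mul pS IH2))) => s.
by rewrite /D /S !big_cons !expRD; field.
Qed.

Variable X : R.
Hypothesis JX : forall x, \sum_y ev (pairE J) (chi R [:: x; y]) <= X.

Let pJ : pd (pairE J) := pd_pairE J0.

Lemma two_point_sym x y : ev (pairE J) (chi R [:: x; y]) = ev (pairE J) (chi R [:: y; x]).
Proof. by congr ev; apply/funext => s; rewrite !chi2 mulrC. Qed.

Lemma two_point_form h :
  \sum_x \sum_y h x * h y * ev (pairE J) (chi R [:: x; y]) <= X * \sum_x h x ^+ 2.
Proof.
pose c x y := ev (pairE J) (chi R [:: x; y]).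
have c0 x y : 0 <= c x y by apply: ev_pd_ge0 => //; exact: pd_chi.
apply: (@le_trans _ _ (\sum_x \sum_y (h x ^+ 2 / 2 * c x y + h y ^+ 2 / 2 * c x y))).
  apply: ler_sum => x _; apply: ler_sum => y _; rewrite -/(c x y) -mulrDl.
  apply: ler_wpM2r => //; have := sqr_ge0 (h x - h y).
  by rewrite sqrrB; lra.
have -> : \sum_x \sum_y (h x ^+ 2 / 2 * c x y + h y ^+ 2 / 2 * c x y) =
   \sum_x h x ^+ 2 * \sum_y c x y.
  under eq_bigr => x _ do rewrite big_split /=.
  rewrite big_split /= [X in _ + X]exchange_big /= -big_split /=.
  apply: eq_bigr => x _; rewrite mulr_sumr -big_split /=; apply: eq_bigr => y _.
  by rewrite {2}/c (two_point_sym y x) -/(c x y); field.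
rewrite mulr_sumr; apply: ler_sum => x _; rewrite mulrC ler_wpM2r ?sqr_ge0 //.
exact: JX.
Qed.

Lemma ev_fieldE_sqr h : ev (pairE J) (fun s => fieldE h s ^+ 2) <= X * \sum_x h x ^+ 2.
Proof.
apply: le_trans (two_point_form h); rewrite le_eqVlt; apply/orP; left; apply/eqP.
transitivity (ev (pairE J) (fun s => \sum_x \sum_y h x * h y * chi R [:: x; y] s)).
  congr ev; apply/funext => s; rewrite expr2 /fieldE mulr_suml; apply: eq_bigr => x _.
  by rewrite mulr_sumr; apply: eq_bigr => y _; rewrite chi2 !chi1; ring.
rewrite ev_sum; apply: eq_bigr => x _; rewrite ev_sum; apply: eq_bigr => y _.
by rewrite evZ.
Qed.

(* The field is switched on one site at a time; the Simon-Lieb inequality on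
   the whole graph bounds the magnetization created so far. *)
Lemma gaussian_bound_ge0 h : (forall x, 0 <= h x) ->
  ev (pairE J) (fun s => expR (fieldE h s)) <= expR ((1 / 2 + X) * \sum_x h x ^+ 2).
Proof.
move=> h0; pose c x y := ev (pairE J) (chi R [:: x; y]).
have c0 x y : 0 <= c x y by apply: ev_pd_ge0 => //; exact: pd_chi.
have H r : uniq r ->
   ev (pairE J) (fun s => expR (\sum_(x <- r) h x * chi R [:: x] s)) <=
   expR (\sum_(x <- r) (h x ^+ 2 / 2 + h x * \sum_y h y * c x y)).
  elim: r => [_|x r IH /= /andP[xr ur]].
    rewrite big_nil expR0 le_eqVlt; apply/orP; left; apply/eqP.
    by rewrite -[RHS](ev_cst (pairE J)); congr ev; apply/funext => s; rewrite big_nil expR0.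
  pose A s := \sum_(x <- r) h x * chi R [:: x] s.
  have pA : pd A by apply: pd_sum => y _; exact: pd_mono.
  pose m := ev (fun s => pairE J s + A s) (chi R [:: x]).
  have -> : ev (pairE J) (fun s => expR (\sum_(y <- x :: r) h y * chi R [:: y] s)) =
     ev (pairE J) (fun s => expR (A s)) * (ch (h x) + m * sh (h x)).
    have Z0 : ev (pairE J) (fun s => expR (A s)) != 0.
      by rewrite gt_eqF // ev_gt0 // => s; exact: expR_gt0.
    transitivity (ch (h x) * ev (pairE J) (fun s => expR (A s)) +
       sh (h x) * ev (pairE J) (fun s => chi R [:: x] s * expR (A s))).
      rewrite -!evZ -evD; congr ev; apply/funext => s.
      by rewrite big_cons expRD expR_ch_sh ch_chi sh_chi -/(A s); ring.
    by rewrite /m ev_shift; field; exact: Z0.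
  rewrite big_cons [X in _ <= expR X]addrC expRD; apply: ler_pM.
  - by apply: ltW; apply: ev_gt0 => s; exact: expR_gt0.
  - have m0 : 0 <= m by apply: ev_pd_ge0; [exact: pd_add|exact: pd_chi].
    exact: addr_ge0 (le_trans ler01 (ch_ge1 _)) (mulr_ge0 m0 (sh_ge0 (h0 x))).
  - exact: IH.
  - have m0 : 0 <= m by apply: ev_pd_ge0; [exact: pd_add|exact: pd_chi].
    have mle : m <= \sum_y h y * c x y.
      pose h' y := if y \in r then h y else 0.
      have h'0 y : 0 <= h' y by rewrite /h'; case: ifP.
      have AE : A = fieldE h'.
        apply/funext => s; rewrite /A /fieldE big_uniq // big_mkcond.
        by apply: eq_bigr => y _; rewrite /h'; case: ifP; rewrite ?mul0r.
      have := @simon_lieb_model R V J h' J0 Jsym h'0 (finset.setTfor V) x 1 (finset.in_setT x) _.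
      have -> : modelE J h' = (fun s => pairE J s + A s) by rewrite AE.
      move=> /(_ _)/le_trans; apply.
        by move=> y; apply: le_trans (ler_norm _) _; apply: ev_norm_le => s; rewrite norm_chi.
      rewrite (eq_bigl xpredT) => [|y]; last by rewrite inE.
      apply: ler_sum => y _; rewrite big1 => [|z]; last by rewrite inE.
      have -> : pairE (subJ (finset.setTfor V) J) = pairE J.
        by congr pairE; apply/funext => u; apply/funext => v; rewrite /subJ !inE.
      rewrite mulr0 addr0 mulrC; apply: ler_wpM2r; first exact: c0.
      by rewrite /h'; case: ifP.
    rewrite expRD; apply: (@le_trans _ _ (ch (h x) * (1 + h x * m))).
      have -> : ch (h x) * (1 + h x * m) = ch (h x) + m * (h x * ch (h x)) by ring.
      by rewrite lerD2l; apply: ler_wpM2l => //; exact: sh_le_ch.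
    apply: ler_pM.
    + exact: le_trans ler01 (ch_ge1 _).
    + exact: addr_ge0 ler01 (mulr_ge0 (h0 x) m0).
    + exact: ch_le_gauss.
    + apply: le_trans (expR_ge1Dx _) _; by rewrite ler_expR ler_wpM2l.
apply: le_trans (H _ (index_enum_uniq V)) _; rewrite ler_expR big_split /= mulrDl.
apply: lerD; first by rewrite mulr_sumr; apply: ler_sum => x _; lra.
apply: le_trans (two_point_form h); apply: ler_sum => x _.
by rewrite mulr_sumr; apply: ler_sum => y _; rewrite mulrA.
Qed.

Lemma gaussian_bound h :
  ev (pairE J) (fun s => expR (fieldE h s)) <= expR ((1 / 2 + X) * \sum_x h x ^+ 2).
Proof.
have [p1 _] := fieldE_abs h.
apply: (@le_trans _ _ (ev (pairE J) (fun s => expR (fieldE (fun x => `|h x|) s)))).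
  by rewrite -subr_ge0 -evN -evD; apply: ev_pd_ge0.
apply: le_trans (gaussian_bound_ge0 _) _ => [x|]; first exact: normr_ge0.
by under eq_bigr => x _ do rewrite real_normK ?num_real //.
Qed.

End Gaussian.

Section Embedding.
Variables (R : realType) (V W : finType) (i : V -> W).
Hypothesis ii : injective i.

Definition pullback (s : {ffun W -> bool}) : {ffun V -> bool} := [ffun v => s (i v)].

Lemma chi_pullback l s : chi R l (pullback s) = chi R (map i l) s.
Proof. by rewrite /chi big_map; apply: eq_bigr => v _; rewrite ffunE. Qed.

Lemma pd_pullback (f : {ffun V -> bool} -> R) : pd f -> pd (fun s => f (pullback s)).
Proof.
elim=> [c l c0|f1 f2 _ p1 _ p2]; last exact: pd_add.
by apply: pd_ext (pd_mono (map i l) c0) => s; rewrite chi_pullback.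
Qed.

Lemma ev_pullback (E f : {ffun V -> bool} -> R) :
  ev E f = ev (fun s => E (pullback s)) (fun s => f (pullback s)).
Proof.
have [|k k0 Hk] := @sum_hom_fibers R V W pullback.
  by move=> s t; apply/ffunP => v; rewrite !ffunE.
have K F : \sum_s F (pullback s) = k * \sum_s F s.
  rewrite Hk; congr (_ * _); apply: eq_bigl => r; apply/finset.imsetP.
  exists [ffun w => if [pick v | i v == w] is Some v then r v else true]; first by rewrite inE.
  apply/ffunP => v; rewrite !ffunE; case: pickP => [v' /eqP/ii -> //|/(_ v)].
  by rewrite eqxx.
rewrite /ev (K (fun s => f s * expR (E s))) (K (fun s => expR (E s))).
by rewrite invfM mulrACA divff ?gt_eqF // mul1r.
Qed.

Lemma ev_embed (J : V -> V -> R) (J' : W -> W -> R) (f : {ffun V -> bool} -> R) :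
  (forall x y, 0 <= J x y) -> (forall x y, 0 <= J' x y) ->
  (forall x y, J x y <= J' (i x) (i y)) -> pd f ->
  ev (pairE J) f <= ev (pairE J') (fun s => f (pullback s)).
Proof.
move=> J0 J'0 JJ' pf; rewrite ev_pullback.
pose K x y := \sum_a \sum_b J a b * ((i a == x) && (i b == y))%:R.
have KE s : pairE J (pullback s) = pairE K s.
  rewrite /pairE; transitivity (\sum_a \sum_b \sum_x \sum_y
     J a b * ((i a == x) && (i b == y))%:R / 2 * chi R [:: x; y] s).
    apply: eq_bigr => a _; apply: eq_bigr => b _.
    rewrite (bigD1 (i a)) //= [X in _ + X]big1 ?addr0; last first.
      by move=> x; rewrite eq_sym => /negPf xa; rewrite big1 // => y _; rewrite xa mulr0 !mul0r.
    rewrite (bigD1 (i b)) //= [X in _ + X]big1 ?addr0; last first.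
      by move=> x; rewrite eq_sym => /negPf xa; rewrite xa andbF mulr0 !mul0r.
    by rewrite !eqxx mulr1 chi_pullback.
  under eq_bigr => a _ do rewrite exchange_big /=.
  rewrite exchange_big /=; apply: eq_bigr => x _.
  under eq_bigr => a _ do rewrite exchange_big /=.
  rewrite exchange_big /=; apply: eq_bigr => y _.
  rewrite /K !mulr_suml; apply: eq_bigr => a _.
  by rewrite !mulr_suml.
have K0 x y : 0 <= K x y.
  by apply: sumr_ge0 => a _; apply: sumr_ge0 => b _; rewrite mulr_ge0.
have KJ' x y : K x y <= J' x y.
  have z0 (F : V -> R) x' : (forall a, i a != x' -> F a = 0) ->
      \sum_a F a = 0 \/ exists2 a, i a = x' & \sum_a F a = F a.
    move=> F0; case: (pickP (fun a => i a == x')) => [a /eqP ia|no]; last first.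
      by left; rewrite big1 // => a _; rewrite F0 // no.
    right; exists a => //; rewrite (bigD1 a) //= big1 ?addr0 // => b ba.
    by apply: F0; rewrite -ia (inj_eq ii).
  rewrite /K; case: (z0 (fun a => \sum_b J a b * ((i a == x) && (i b == y))%:R) x).
  - by move=> a /negPf ->; rewrite big1 // => b _; rewrite mulr0.
  - by move=> ->.
  - move=> [a ia ->]; case: (z0 (fun b => J a b * ((i a == x) && (i b == y))%:R) y).
    + by move=> b /negPf ->; rewrite andbF mulr0.
    + by move=> ->.
    + by move=> [b ib ->]; rewrite ia ib !eqxx mulr1 -ia -ib.
have -> : pairE J' = (fun s => pairE J (pullback s) + pairE (fun x y => J' x y - K x y) s).
  apply/funext => s; rewrite KE /pairE -big_split /=; apply: eq_bigr => x _.
  by rewrite -big_split /=; apply: eq_bigr => y _; rewrite -!mulrDl addrC subrK.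
apply: ev_mono.
- by apply: pd_ext (pd_pairE K0) => s; rewrite KE.
- by apply: pd_pairE => x y; rewrite subr_ge0.
- exact: pd_pullback.
Qed.

End Embedding.

Section Ring.
Variables (R : realType) (c : nat -> R).
Hypothesis (c0 : forall k, 0 <= c k).

Definition ndist (x y : nat) := ((x - y) + (y - x))%N.

Definition intervalJ n (x y : 'I_n) : R := c (ndist x y).

Definition ringJ n (x y : 'I_n) : R := c (minn (ndist x y) (n - ndist x y)).

Lemma ringJ_ge0 n (x y : 'I_n) : 0 <= ringJ x y. Proof. exact: c0. Qed.

Lemma ringJ_sym n (x y : 'I_n) : ringJ x y = ringJ y x.
Proof. by rewrite /ringJ /ndist [(x - y + _)%N]addnC. Qed.

Lemma ringJ_transitive n (x y : 'I_n) : exists2 p : 'I_n -> 'I_n, injective p &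
  p x = y /\ forall a b, ringJ (p a) (p b) = ringJ a b.
Proof.
pose k := if (x <= y)%N then (y - x)%N else (y + n - x)%N.
have xn := ltn_ord x; have yn := ltn_ord y.
have kn : (k <= n)%N by rewrite /k; case: ifP; lia.
pose q a := if (a + k < n)%N then (a + k)%N else (a + k - n)%N.
have qn (a : 'I_n) : (q a < n)%N by rewrite /q; have := ltn_ord a; case: ifP; lia.
exists (fun a => Ordinal (qn a)).
  move=> a b /(congr1 val) /=; rewrite /q => H; apply: val_inj => /=.
  by have := ltn_ord a; have := ltn_ord b; move: H; case: ifP; case: ifP; lia.
split.
  by apply: val_inj => /=; rewrite /q /k; case: ifP; case: ifP; lia.
move=> a b; rewrite /ringJ /=; congr c; rewrite /q /ndist.
by have := ltn_ord a; have := ltn_ord b; case: ifP; case: ifP; lia.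
Qed.

Lemma interval_susceptibility m n (mn : (m + m <= n)%N) b X : 0 <= b ->
  (forall x, \sum_y ev (pairE (fun x y : 'I_n => b * ringJ x y)) (chi R [:: x; y]) <= X) ->
  forall x, \sum_y ev (pairE (fun x y : 'I_m => b * intervalJ x y)) (chi R [:: x; y]) <= X.
Proof.
move=> b0 hX x; have mn' : (m <= n)%N by lia.
have ij : injective (widen_ord mn') by move=> u v /(congr1 val) /= /val_inj.
apply: le_trans (hX (widen_ord mn' x)).
apply: (@le_trans _ _ (\sum_(y : 'I_m) ev (pairE (fun x y : 'I_n => b * ringJ x y))
   (chi R [:: widen_ord mn' x; widen_ord mn' y]))).
  apply: ler_sum => y _.
  apply: le_trans (@ev_embed _ _ _ _ ij _ (fun x y : 'I_n => b * ringJ x y) _ _ _ _ (pd_chi R _)) _.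
  - by move=> u v; rewrite mulr_ge0 // c0.
  - by move=> u v; rewrite mulr_ge0 // c0.
  - move=> u v; rewrite /ringJ /intervalJ /=.
    have -> // : minn (ndist u v) (n - ndist u v) = ndist u v.
    by rewrite /ndist; have := ltn_ord u; have := ltn_ord v; lia.
  - rewrite le_eqVlt; apply/orP; left; apply/eqP; congr ev; apply/funext => s.
    by rewrite chi_pullback.
pose F y := ev (pairE (fun x y : 'I_n => b * ringJ x y)) (chi R [:: widen_ord mn' x; y]).
have F0 y : 0 <= F y.
  by apply: ev_pd_ge0; [apply: pd_pairE => u v; rewrite mulr_ge0 // c0|exact: pd_chi].
rewrite -/(F _) [leRHS](bigID (mem [set widen_ord mn' y | y in 'I_m])) /=.
rewrite big_imset /=; last by move=> u v _ _; exact: ij.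
by rewrite lerDl; apply: sumr_ge0 => y _; exact: F0.
Qed.

End Ring.

Local Open Scope classical_set_scope.

(** * Generalized limits *)

Section GeneralizedLimit.
Variable R : realType.
Implicit Types u v : nat -> R.

Definition bounded_seq u := exists K, forall n, `|u n| <= K.

Record generalized_limit (l : (nat -> R) -> R) : Prop := GeneralizedLimit {
  gl_add : forall u v, bounded_seq u -> bounded_seq v ->
    l (fun n => u n + v n) = l u + l v;
  gl_scale : forall c u, bounded_seq u -> l (fun n => c * u n) = c * l u;
  gl_le : forall u v, bounded_seq u -> bounded_seq v ->
    (exists N, forall n, (N <= n)%N -> u n <= v n) -> l u <= l v;
  gl_cst : forall c, l (fun=> c) = c }.

Lemma bounded_cst (c : R) : bounded_seq (fun=> c).
Proof. by exists `|c|. Qed.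

Lemma bounded_add u v : bounded_seq u -> bounded_seq v -> bounded_seq (fun n => u n + v n).
Proof.
move=> [K uK] [L vL]; exists (K + L) => n.
by apply: le_trans (ler_normD _ _) _; exact: lerD.
Qed.

Lemma bounded_scale c u : bounded_seq u -> bounded_seq (fun n => c * u n).
Proof. by move=> [K uK]; exists (`|c| * K) => n; rewrite normrM ler_wpM2l. Qed.

Lemma bounded_sum (I : Type) (r : seq I) (P : pred I) (F : I -> nat -> R) :
  (forall i, bounded_seq (F i)) -> bounded_seq (fun n => \sum_(i <- r | P i) F i n).
Proof.
move=> FB; elim: r => [|i r IH].
  by exists 0 => n; rewrite big_nil normr0.
have [K HK] := bounded_add (FB i) IH; have [L HL] := IH.
exists (`|K| + `|L|) => n; rewrite big_cons; case: ifP => _.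
  by apply: le_trans (HK n) _; apply: le_trans (ler_norm K) _; rewrite lerDl.
by apply: le_trans (HL n) _; apply: le_trans (ler_norm L) _; rewrite lerDr.
Qed.

Lemma generalized_limit_exists : exists l, generalized_limit l.
Proof.
have [U [UU ooU]] := @ultraFilterLemma nat \oo _.
have ux u : bounded_seq u -> cvg (u @ U).
  move=> [K uK].
  have := @segment_compact R (- K) K; rewrite compact_ultra => /(_ (u @ U)) cK.
  have [||p [_ up]] := cK _; last by apply/cvg_ex; exists p.
    split=> [|G GF UG]; first exact: fmap_proper_filter.
    apply/seteqP; split=> // B GB.
    have [//|nB] := in_ultra_setVsetC (u @^-1` B) UU.
    have : G (~` B) by apply: UG.
    by move=> /(filterI GB); rewrite setICr => /filter_ex [].
  apply: ooU; exists 0%N => // n _ /=.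
  by rewrite in_itv /= -ler_norml.
exists (fun u => lim (u @ U)); split.
- move=> u v ub vb; apply/cvg_lim => //; apply: cvgD; exact: ux.
- move=> c u ub; apply/cvg_lim => //; apply: cvgMr; exact: ux.
- move=> u v ub vb [N H]; apply: ler_lim; [exact: ux|exact: ux|].
  apply: ooU; exists N => // n /= Nn; exact: H.
- by move=> c; apply/cvg_lim => //; exact: cvg_cst.
Qed.

Variable l : (nat -> R) -> R.
Hypothesis gl : generalized_limit l.

Lemma gl_sub u v : bounded_seq u -> bounded_seq v ->
  l (fun n => u n - v n) = l u - l v.
Proof.
move=> ub vb; rewrite -[- l v]mulN1r -(gl_scale gl) // -(gl_add gl) //.
  by congr l; apply/funext => n; rewrite mulN1r.
exact: bounded_scale.
Qed.

Lemma gl_sum (I : Type) (r : seq I) (P : pred I) (F : I -> nat -> R) :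
  (forall i, bounded_seq (F i)) ->
  l (fun n => \sum_(i <- r | P i) F i n) = \sum_(i <- r | P i) l (F i).
Proof.
move=> FB; elim: r => [|i r IH].
  by rewrite big_nil -[RHS](gl_cst gl); congr l; apply/funext => n; rewrite big_nil.
rewrite big_cons; case Pi : (P i); rewrite -IH.
  rewrite -(gl_add gl) //; last exact: bounded_sum.
  by congr l; apply/funext => n; rewrite big_cons Pi.
by congr l; apply/funext => n; rewrite big_cons Pi.
Qed.

Lemma gl_le_cst u c : bounded_seq u -> (exists N, forall n, (N <= n)%N -> u n <= c) ->
  l u <= c.
Proof. by move=> ub H; rewrite -(gl_cst gl c); apply: (gl_le gl) => //; exact: bounded_cst. Qed.

Lemma gl_ge_cst u c : bounded_seq u -> (exists N, forall n, (N <= n)%N -> c <= u n) ->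
  c <= l u.
Proof. by move=> ub H; rewrite -[leLHS](gl_cst gl c); apply: (gl_le gl) => //; exact: bounded_cst. Qed.

Lemma gl_dist u v c : bounded_seq u -> bounded_seq v ->
  (exists N, forall n, (N <= n)%N -> `|u n - v n| <= c) -> `|l u - l v| <= c.
Proof.
move=> ub vb [N H]; rewrite -gl_sub // ler_norml.
have b : bounded_seq (fun n => u n - v n).
  have [K HK] := bounded_add ub (bounded_scale (-1) vb).
  by exists K => n; rewrite -[- v n]mulN1r.
apply/andP; split.
  by apply: gl_ge_cst => //; exists N => n /H; rewrite ler_norml => /andP[].
by apply: gl_le_cst => //; exists N => n /H; rewrite ler_norml => /andP[].
Qed.

Lemma gl_cvg u c : u @ \oo --> c -> bounded_seq u -> l u = c.
Proof.
move=> uc ub; apply/eqP; rewrite -subr_eq0 -normr_le0; apply/ler_addgt0Pr => e e0.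
rewrite add0r -{1}(gl_cst gl c); apply: gl_dist => //; first exact: bounded_cst.
move: uc => /cvgrPdist_le/(_ e e0)[N _ HN].
by exists N => n Nn; rewrite distrC; exact: HN.
Qed.

End GeneralizedLimit.

(** * Measures from finitely additive functions on clopen sets *)

Section ConfigTopology.
Variable I : choiceType.
Implicit Types (x y : config I) (A U : set (config I)).

Lemma config_compact : compact [set: config I].
Proof.
have := @tychonoff I (fun=> bool) (fun=> setT) (fun=> bool_compact).
by congr (compact _); apply/seteqP; split.
Qed.

Lemma nbhs_coordinate x (i : I) : nbhs x [set y : config I | y i = x i].
Proof.
have ci : {for x, continuous (fun y : config I => y i)}.
  exact: (@proj_continuous I (fun=> bool) i x).
apply: (ci [set b | b = x i]); apply: open_nbhs_nbhs; split=> //; exact: discrete_open.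
Qed.

Lemma nbhs_window x (r : seq I) : nbhs x [set y : config I | forall i, i \in r -> y i = x i].
Proof.
elim: r => [|i r IH]; first by apply: filterS filterT.
apply: filterS (filterI (nbhs_coordinate x i) IH) => y [yi yr] j.
by rewrite inE => /predU1P[->|/yr].
Qed.

Definition local_on (r : seq I) A :=
  forall x y, (forall i, i \in r -> x i = y i) -> A x -> A y.

Lemma local_onC r A : local_on r A -> local_on r (~` A).
Proof. by move=> lA x y xy nAx Ay; apply: nAx; apply: lA Ay => i ir; rewrite xy. Qed.

Lemma local_open r A : local_on r A -> open A.
Proof.
move=> lA; rewrite openE => x Ax; apply: filterS (nbhs_window x r) => y yx.
by apply: lA Ax => i /yx.
Qed.

Lemma local_clopen r A : local_on r A -> clopen A.
Proof.
move=> lA; split; first exact: local_open lA.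
by rewrite -[A]setCK closedC; exact: local_open (local_onC lA).
Qed.

End ConfigTopology.

Definition window (n : nat) : seq int :=
  [seq Posz k | k <- iota 0 n] ++ [seq - Posz k | k <- iota 0 n].

Lemma mem_window n (i : int) : (i \in window n) = (`|i| < n)%N.
Proof.
rewrite mem_cat; apply/orP/idP => [[]/mapP[k]|].
- by rewrite mem_iota => ? ->; lia.
- by rewrite mem_iota => ? ->; lia.
move=> h; case: (leP 0 i) => i0; [left|right]; apply/mapP; exists `|i|%N;
by rewrite ?mem_iota; lia.
Qed.

Definition clopenT : Type := config int.
Definition clopen_display : measure_display.
Proof. exact: default_measure_display. Qed.

HB.instance Definition _ := Topological.copy clopenT (config int).
HB.instance Definition _ := Pointed.copy clopenT (forall _ : int, bool).

Lemma open_local_cover (U : set (config int)) : open U ->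
  exists F : nat -> set (config int),
    (forall n, local_on (window n) (F n)) /\ U = \bigcup_n F n.
Proof.
move=> oU; pose W n (x : config int) := [set y : config int | forall i, i \in window n -> y i = x i].
have WU x : U x -> exists n, W n x `<=` U.
  move=> Ux; have cC : compact (~` U).
    by apply: (subclosed_compact _ (@config_compact int)) => //; rewrite closedC.
  have cC2 : compact (~` U : set clopenT) by [].
  move: cC2; rewrite (@compact_cover clopenT) => {}cC.
  have [||D _ cD] := cC nat setT (fun n => ~` W n x).
  - by move=> n _; apply: (@local_open _ (window n)); apply: local_onC => y z yz yx i iw; rewrite -yz ?yx.
  - move=> y nUy; apply: contrapT => H; apply: nUy; suff -> : y = x by [].
    apply/funext => i; apply: contrapT => yi; apply: H.
    by exists `|i|.+1 => //= Wy; apply: yi; apply: Wy; rewrite mem_window.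
  exists (\max_(n <- enum_fset D) n)%N => y Wy; apply: contrapT => nUy.
  have [n /= nD] := cD y nUy; apply => i; rewrite mem_window => iw.
  apply: Wy; rewrite mem_window; apply: leq_trans iw _.
  exact: (@leq_bigmax_seq _ _ xpredT (fun n => n)).
exists (fun n => [set x | W n x `<=` U]); split.
  move=> n x y xy Wx z Wz; apply: Wx => i iw; by rewrite Wz // xy.
apply/seteqP; split=> [x /WU[n Wn]|x [n _ /(_ x)]]; first by exists n.
by apply => i.
Qed.

Definition finitely_additive (R : realType) (T : Type) (P : set T -> R) :=
  [/\ forall A, 0 <= P A, P setT = 1 &
      forall A B, A `&` B = set0 -> P (A `|` B) = P A + P B].

Lemma clopen0 : clopen (set0 : set clopenT).
Proof. by split; [exact: open0|exact: closed0]. Qed.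

Lemma clopenU_closed : setU_closed (@clopen clopenT).
Proof. by move=> A B [oA cA] [oB cB]; split; [exact: openU|exact: closedU]. Qed.

Lemma clopenC_closed : setC_closed (@clopen clopenT).
Proof. by move=> A [oA cA]; split; [rewrite openC|rewrite closedC]. Qed.

HB.instance Definition _ := isAlgebraOfSets.Build clopen_display clopenT
  clopen0 clopenU_closed clopenC_closed.

Section Extension.
Variables (R : realType) (P : set (config int) -> R).
Hypothesis faP : finitely_additive P.

Lemma fa_set0 : P set0 = 0.
Proof.
have [_ _ add] := faP; have := add set0 set0 (setI0 _); rewrite setU0 => h.
by apply: (addrI (P set0)); rewrite addr0.
Qed.

Lemma fa_le A B : A `<=` B -> P A <= P B.
Proof.
have [p0 _ add] := faP; move=> AB.
by rewrite -(setDUK AB) add ?lerDl // setDE setIC -setIA setICl setI0.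
Qed.

Lemma fa_leU A B : P (A `|` B) <= P A + P B.
Proof.
have [p0 _ add] := faP.
rewrite -(setDUK (@subsetUl _ A B)) add; last first.
  by rewrite setDE setIC -setIA setICl setI0.
by rewrite lerD2l fa_le // => x [[//|//]].
Qed.

Lemma fa_le_bigU (F : nat -> set (config int)) n :
  P (\big[setU/set0]_(k < n) F k) <= \sum_(k < n) P (F k).
Proof.
elim: n => [|n IH]; first by rewrite !big_ord0 fa_set0.
by rewrite !big_ord_recr /=; apply: le_trans (fa_leU _ _) _; rewrite lerD2r.
Qed.

Definition clopen_content of finitely_additive P := fun A : set clopenT => (P A)%:E.

Local Notation content := (clopen_content faP).

Lemma clopen_content_ge0 A : (0 <= content A)%E.
Proof. by rewrite lee_fin; have [] := faP. Qed.

Lemma clopen_content_additive : measure_function.semi_additive content.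
Proof.
move=> F n mF tF _; elim: n => [|n IH]; first by rewrite !big_ord0 /clopen_content fa_set0.
rewrite !big_ord_recr /= -IH /clopen_content -EFinD; congr (_%:E).
have [_ _ add] := faP; apply: add.
rewrite -subset0 => x [+ Fn]; rewrite -bigcup_mkord => -[k /= kn Fk].
by have kn' := tF k n I I (ex_intro _ x (conj Fk Fn)); rewrite kn' ltnn in kn.
Qed.

HB.instance Definition _ := isContent.Build _ _ _ content
  clopen_content_ge0 clopen_content_additive.

Lemma clopen_content_sigma_subadditive :
  measurable_subset_sigma_subadditive content.
Proof.
move=> A F mF [oA cA] AF.
have cc : cover_compact (A : set clopenT).
  by rewrite -compact_cover; apply: (subclosed_compact cA (@config_compact int)).
have [||D _ cD] := cc nat setT F.
- by move=> n _; have [] := mF n.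
- by move=> x /AF[n _ Fn]; exists n.
pose N := (\max_(n <- enum_fset D) n).+1%N.
have AN : A `<=` \big[setU/set0]_(k < N) F k.
  move=> x /cD[n /= nD Fn]; rewrite -bigcup_mkord; exists n => //=.
  by rewrite ltnS; apply: (@leq_bigmax_seq _ _ xpredT (fun n => n)).
apply: (@le_trans _ _ (\sum_(0 <= k < N) content (F k))%E).
  rewrite big_mkord sumEFin lee_fin; apply: le_trans (fa_le AN) _; exact: fa_le_bigU.
by apply: nneseries_lim_ge => n _ _; exact: clopen_content_ge0.
Qed.

HB.instance Definition _ := Content_SigmaSubAdditive_isMeasure.Build _ _ _
  content clopen_content_sigma_subadditive.

Lemma open_clopen_sigma (A : set (config int)) : open A -> <<s (@clopen clopenT) >> A.
Proof.
move=> /open_local_cover[F [lF ->]].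
apply: (@bigcupT_measurable _ (g_sigma_algebraType (@clopen clopenT))) => n.
by apply: sub_sigma_algebra; exact: local_clopen (lF n).
Qed.

Lemma config_sigma_clopen (A : set configZ) : measurable A ->
  (@measurable _ (g_sigma_algebraType (@measurable clopen_display clopenT))) A.
Proof.
apply: smallest_sub; first exact: smallest_sigma_algebra.
exact: open_clopen_sigma.
Qed.

Definition clopen_measure : set configZ -> \bar R := measure_extension content.

Local Notation mu := clopen_measure.

Lemma clopen_measure0 : mu set0 = 0%E.
Proof. exact: (measure0 (measure_extension content)). Qed.

Lemma clopen_measure_ge0 A : (0 <= mu A)%E.
Proof. exact: (measure_ge0 (measure_extension content)). Qed.

Lemma clopen_measure_sigma_additive : semi_sigma_additive mu.
Proof.
move=> F mF tF mUF; apply: (measure_semi_sigma_additive (s := measure_extension content)) => //.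
- by move=> n; exact: config_sigma_clopen.
- exact: config_sigma_clopen.
Qed.

HB.instance Definition _ := isMeasure.Build _ _ _ mu
  clopen_measure0 clopen_measure_ge0 clopen_measure_sigma_additive.

Lemma clopen_measureE (A : set (config int)) : clopen A -> mu A = (P A)%:E.
Proof. by move=> cA; rewrite /clopen_measure /measure_extension measurable_mu_extE. Qed.

Lemma clopen_measure_setT : mu setT = 1%E.
Proof.
rewrite clopen_measureE; first by have [_ -> _] := faP.
by split; [exact: openT|exact: closedT].
Qed.

HB.instance Definition _ := Measure_isProbability.Build _ _ _ mu clopen_measure_setT.

Lemma clopen_extension : exists mu : probability configZ R,
  forall A : set (config int), clopen A -> mu A = (P A)%:E.
Proof. by exists mu => A; exact: clopen_measureE. Qed.

End Extension.

Section Mean.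
Variables (R : realType).

Definition bounded_fct (T : Type) (F : T -> R) := exists K, forall x, `|F x| <= K.

Record is_mean (T : Type) (M : (T -> R) -> R) : Prop := IsMean {
  mean_add : forall F G, bounded_fct F -> bounded_fct G ->
    M (fun x => F x + G x) = M F + M G;
  mean_scale : forall c F, bounded_fct F -> M (fun x => c * F x) = c * M F;
  mean_le : forall F G, bounded_fct F -> bounded_fct G ->
    (forall x, F x <= G x) -> M F <= M G;
  mean_cst : forall c, M (fun=> c) = c }.

Lemma bounded01 (T : Type) (F : T -> R) : (forall x, 0 <= F x <= 1) -> bounded_fct F.
Proof. by move=> F01; exists 1 => x; have /andP[F0 F1] := F01 x; rewrite ger0_norm. Qed.

Lemma bounded_indic (T : Type) (A : set T) : bounded_fct (\1_A : T -> R).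
Proof. by apply: bounded01 => x; rewrite indicE; case: (_ \in _); rewrite ?lexx ?ler01. Qed.

Lemma bounded_fctM (T : Type) (F G : T -> R) : bounded_fct F -> bounded_fct G ->
  bounded_fct (fun x => F x * G x).
Proof.
move=> [K FK] [L GL]; exists (K * L) => x; rewrite normrM.
by apply: ler_pM; rewrite ?normr_ge0.
Qed.

Lemma bounded_fctD (T : Type) (F G : T -> R) : bounded_fct F -> bounded_fct G ->
  bounded_fct (fun x => F x + G x).
Proof.
move=> [K FK] [L GL]; exists (K + L) => x.
by apply: le_trans (ler_normD _ _) _; apply: lerD.
Qed.

Lemma bounded_fct_cst (T : Type) (c : R) : bounded_fct (fun _ : T => c).
Proof. by exists `|c|. Qed.

Lemma mean_finitely_additive (T : Type) (M : (T -> R) -> R) : is_mean M ->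
  finitely_additive (fun A => M (\1_A)).
Proof.
move=> mM; split.
- move=> A; rewrite -(mean_cst mM 0); apply: (mean_le mM).
  + exact: bounded_fct_cst.
  + exact: bounded_indic.
  + by move=> x; rewrite indicE.
- rewrite -[RHS](mean_cst mM 1); congr M; apply/funext => x.
  by rewrite indicE in_setT.
- move=> A B AB; rewrite -(mean_add mM); [|exact: bounded_indic..].
  congr M; apply/funext => x; rewrite !indicE in_setU.
  case: (boolP (x \in A)) => xA; case: (boolP (x \in B)) => xB; rewrite ?addr0 ?add0r //.
  move: xA xB; rewrite !inE => xA xB.
  by have : set0 x by rewrite -AB.
Qed.

Definition update (I : eqType) (x : config I) (i : I) (b : bool) : config I :=
  fun j => if j == i then b else x j.

Definition local_fct (I : eqType) (r : seq I) (F : config I -> R) :=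
  forall x y, (forall i, i \in r -> x i = y i) -> F x = F y.

Lemma local_update (I : eqType) (i : I) (r : seq I) F b : local_fct (i :: r) F ->
  local_fct r (fun x => F (update x i b)).
Proof.
move=> lF x y xy; apply: lF => j; rewrite inE /update.
by case: eqP => //= _ /xy.
Qed.

Lemma updateE (I : eqType) (x : config I) i : update x i (x i) = x.
Proof. by apply/funext => j; rewrite /update; case: eqP => [->|]. Qed.

Lemma open_measurable_config (A : set configZ) : open (A : set (config int)) -> measurable A.
Proof. exact: sub_sigma_algebra. Qed.

Lemma local_fct_measurable (r : seq int) (F : configZ -> R) : local_fct r F ->
  measurable_fun setT F.
Proof.
move=> lF _ B mB; rewrite setTI; apply: open_measurable_config.
by apply: (@local_open _ r) => x y xy; rewrite /= (lF _ _ xy).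
Qed.

Lemma clopen_coordinate (i : int) b : clopen [set x : config int | x i = b].
Proof.
by apply: (@local_clopen _ [:: i]) => x y xy /= <-; rewrite xy ?inE.
Qed.

Section Integral.
Variables (M : (config int -> R) -> R) (mu : probability configZ R).
Hypothesis mM : is_mean M.
Hypothesis muM : forall A : set (config int), clopen A -> mu A = (M (\1_A))%:E.

Lemma clopen_measurable (A : set configZ) : clopen (A : set (config int)) -> measurable A.
Proof. by move=> [oA _]; exact: open_measurable_config. Qed.

Lemma clopenI2 (A B : set (config int)) : clopen A -> clopen B -> clopen (A `&` B).
Proof. by move=> [oA cA] [oB cB]; split; [exact: openI|exact: closedI]. Qed.

Lemma bounded_local (r : seq int) (F : config int -> R) : local_fct r F -> bounded_fct F.
Proof.
elim: r F => [|i r IH] F lF.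
  by exists `|F (fun=> true)| => x; rewrite (lF x (fun=> true)).
have [K HK] := IH _ (local_update true lF); have [K' HK'] := IH _ (local_update false lF).
exists (Num.max K K') => x; rewrite le_max -{1 2}(updateE x i).
by case: (x i); rewrite ?HK ?HK' ?orbT.
Qed.

Lemma integral_local (r : seq int) (F : config int -> R) (A : set (config int)) :
  clopen A -> local_fct r F -> (forall x, 0 <= F x) ->
  (\int[mu]_(x in A) (F x)%:E)%E = (M (fun x => F x * \1_A x))%:E.
Proof.
elim: r F A => [|i r IH] F A cA lF F0.
  have FE x : F x = F (fun=> true) by exact: lF.
  rewrite (eq_integral (fun=> (F (fun=> true))%:E)) => [|x _]; last by rewrite FE.
  rewrite integral_cst; last exact: clopen_measurable.
  rewrite [X in (_ * X)%E](muM cA) -EFinM -(mean_scale mM); last exact: bounded_indic.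
  by congr (M _)%:E; apply/funext => x; rewrite FE.
pose C b := A `&` [set x : config int | x i = b].
have cC b : clopen (C b) by apply: clopenI2 => //; exact: clopen_coordinate.
have AE : A = C true `|` C false.
  by rewrite -setIUr -[LHS]setIT; congr (_ `&` _); apply/seteqP; split=> // x _ /=; case: (x i); [left|right].
have mC b : measurable (C b : set configZ) by exact: clopen_measurable.
have mF : measurable_fun setT (fun x : configZ => (F x)%:E).
  by apply/measurable_EFinP; exact: (local_fct_measurable lF).
rewrite [in LHS]AE ge0_integral_setU //; last 3 first.
- exact: measurable_funTS.
- by move=> x _; rewrite lee_fin.
- apply/disj_setPS => x [[_ /= h1] [_ /= h2]]; by rewrite h1 in h2.
have IC b : (\int[mu]_(x in C b) (F x)%:E)%E = (M (fun x => F (update x i b) * \1_(C b) x))%:E.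
  rewrite -IH //; last exact: local_update.
  by apply: eq_integral => x; rewrite inE => -[_ /= <-]; rewrite updateE.
rewrite !IC -EFinD -(mean_add mM).
- congr (M _)%:E; apply/funext => x; rewrite !indicE AE in_setU.
  have inC b : (x \in C b) = (x \in A) && (x i == b).
    apply/idP/andP; first by rewrite !inE => -[Ax /= ->].
    by rewrite !inE => -[Ax /eqP].
  have -> : F x = F (update x i (x i)) by rewrite updateE.
  by rewrite !inC; case: (x i); rewrite /= ?andbF ?andbT ?mulr0 ?addr0 ?add0r ?orbF.
- apply: bounded_fctM (bounded_indic _); exact: bounded_local (local_update _ lF).
- apply: bounded_fctM (bounded_indic _); exact: bounded_local (local_update _ lF).
Qed.

Definition restrict_window n (x : config int) : config int :=
  fun i => if i \in window n then x i else true.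

Lemma local_restrict n (F : config int -> R) :
  local_fct (window n) (fun x => F (restrict_window n x)).
Proof.
move=> x y xy; congr F; apply/funext => i; rewrite /restrict_window.
by case: ifP => // /xy.
Qed.

Definition uniformly_local (F : config int -> R) := forall e, 0 < e -> exists n,
  forall x y, (forall i, i \in window n -> x i = y i) -> `|F x - F y| <= e.

Lemma uniformly_local_measurable (F : configZ -> R) : uniformly_local F -> measurable_fun setT F.
Proof.
move=> uF; pose Fn n : configZ -> R := fun x => F (restrict_window n x).
apply: (@measurable_fun_cvg _ _ _ _ Fn) => //.
  by move=> n; apply: (@local_fct_measurable (window n)); exact: local_restrict.
move=> x _; apply/cvgrPdist_le => e e0; have [N HN] := uF e e0.
exists N => // n /= Nn; apply: HN => i; rewrite !mem_window => iN.
by rewrite /restrict_window mem_window (leq_trans iN Nn).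
Qed.

Lemma integral_uniformly_local (F : config int -> R) (A : set (config int)) :
  clopen A -> uniformly_local F -> (forall x, 0 <= F x <= 1) ->
  (\int[mu]_(x in A) (F x)%:E)%E = (M (fun x => F x * \1_A x))%:E.
Proof.
move=> cA uF F01.
have mA : measurable (A : set configZ) by exact: clopen_measurable.
have F0 x : 0 <= F x by have /andP[] := F01 x.
have mF : measurable_fun setT (fun x : configZ => (F x)%:E).
  by apply/measurable_EFinP; exact: uniformly_local_measurable.
have bF : bounded_fct (fun x => F x * \1_A x).
  exact: bounded_fctM (bounded01 F01) (bounded_indic _).
have bi : bounded_fct (\1_A : config int -> R) by exact: bounded_indic.
have iA1 x : 0 <= (\1_A x : R) <= 1.
  by rewrite indicE; case: (_ \in _); rewrite ?lexx ?ler01.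
have MA : M (\1_A) <= 1.
  rewrite -[leRHS](mean_cst mM 1); apply: (mean_le mM) => //; exact: bounded_fct_cst.
set m := M _.
suff H e : 0 < e -> ((m - 2 * e)%:E <= \int[mu]_(x in A) (F x)%:E <= (m + 2 * e)%:E)%E.
  have I0 : (0 <= \int[mu]_(x in A) (F x)%:E)%E by apply: integral_ge0 => x _; rewrite lee_fin.
  move: H I0; case: (\int[mu]_(x in A) (F x)%:E)%E => [v| |] H I0.
  - congr (_%:E); apply/eqP; rewrite eq_le; apply/andP; split.
      apply/ler_addgt0Pr => e e0; have /H : 0 < e / 2 by rewrite divr_gt0.
      by rewrite !lee_fin => /andP[_]; rewrite mulrC divfK.
    apply/ler_addgt0Pr => e e0; have /H : 0 < e / 2 by rewrite divr_gt0.
    by rewrite !lee_fin => /andP[+ _]; rewrite mulrC divfK // lerBlDr.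
  - by have /andP[_] := H 1 ltr01; rewrite leye_eq.
  - by [].
move=> e0; have [n Hn] := uF e e0.
have Fn x : `|F x - F (restrict_window n x)| <= e.
  by apply: Hn => i iw; rewrite /restrict_window iw.
pose lo x := Num.max (F (restrict_window n x) - e) 0.
pose hi x := F (restrict_window n x) + e.
have llo : local_fct (window n) lo.
  by move=> x y xy; rewrite /lo (local_restrict _ xy).
have lhi : local_fct (window n) hi.
  by move=> x y xy; rewrite /hi (local_restrict _ xy).
have lo0 x : 0 <= lo x by rewrite /lo le_max lexx orbT.
have hi0 x : 0 <= hi x by rewrite /hi addr_ge0 // ltW.
have loF x : lo x <= F x.
  rewrite /lo ge_max F0 andbT; have := Fn x; rewrite ler_norml => /andP[h _]; lra.
have Fhi x : F x <= hi x.
  by rewrite /hi; have := Fn x; rewrite ler_norml => /andP[_ h]; lra.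
have Flo x : F x - 2 * e <= lo x.
  rewrite /lo le_max; apply/orP; left; have := Fn x; rewrite ler_norml => /andP[_ h]; lra.
have hiF x : hi x <= F x + 2 * e.
  by rewrite /hi; have := Fn x; rewrite ler_norml => /andP[h _]; lra.
have shift c : M (fun x => F x * \1_A x + c * \1_A x) = m + c * M (\1_A).
  by rewrite (mean_add mM) // ?(mean_scale mM) //; apply: bounded_fctM bi; exact: bounded_fct_cst.
have bshift c : bounded_fct (fun x => F x * \1_A x + c * \1_A x).
  by apply: bounded_fctD => //; apply: bounded_fctM bi; exact: bounded_fct_cst.
have mlo : measurable_fun setT (fun x : configZ => (lo x)%:E).
  by apply/measurable_EFinP; exact: local_fct_measurable llo.
have mhi : measurable_fun setT (fun x : configZ => (hi x)%:E).
  by apply/measurable_EFinP; exact: local_fct_measurable lhi.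
have MA0 : 0 <= M (\1_A).
  rewrite -(mean_cst mM 0); apply: (mean_le mM) => //; first exact: bounded_fct_cst.
apply/andP; split.
- apply: (@le_trans _ _ (\int[mu]_(x in A) (lo x)%:E)%E).
    rewrite (integral_local cA llo lo0) lee_fin.
    apply: (@le_trans _ _ (M (fun x => F x * \1_A x + - (2 * e) * \1_A x))).
      rewrite shift lerD2l mulNr lerN2 -[leRHS]mulr1 ler_wpM2l //.
      by rewrite mulr_ge0 // ltW.
    apply: (mean_le mM) => //.
      by apply: bounded_fctM bi; exact: bounded_local llo.
    by move=> x; rewrite -mulrDl; apply: ler_wpM2r => //; have /andP[] := iA1 x.
  apply: ge0_le_integral => //; try (by move=> x _; rewrite lee_fin); exact: measurable_funTS.
- apply: (@le_trans _ _ (\int[mu]_(x in A) (hi x)%:E)%E).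
    apply: ge0_le_integral => //; try (by move=> x _; rewrite lee_fin); exact: measurable_funTS.
  rewrite (integral_local cA lhi hi0) lee_fin.
  apply: (@le_trans _ _ (M (fun x => F x * \1_A x + (2 * e) * \1_A x))).
    apply: (mean_le mM) => //.
      by apply: bounded_fctM bi; exact: bounded_local lhi.
    by move=> x; rewrite -mulrDl; apply: ler_wpM2r => //; have /andP[] := iA1 x.
  rewrite shift lerD2l -[leRHS]mulr1 ler_wpM2l //.
  by rewrite mulr_ge0 // ltW.
Qed.

End Integral.

End Mean.

(** * Gibbs measures as limits of ring models *)

Section Outside.
Variables (R : realType) (mu : probability configZ R) (L : {fset int}).
Implicit Types (A B : set (config int)) (r : seq int).

Lemma outside_local r A : (forall i, i \in r -> i \notin L) -> local_on r A ->
  outside_sigma_algebra L A.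
Proof.
pose T := g_sigma_algebraType [set A | exists (i : int) (b : bool),
        i \notin L /\ A = [set x : config int | x i = b]].
rewrite -/(measurable (A : set T)).
elim: r A => [|i r IH] A rL lA.
  have [[x Ax]|A0] := pselect (A !=set0).
    suff -> : A = setT by exact: (@measurableT _ T).
    by apply/seteqP; split=> // y _; apply: lA Ax.
  suff -> : A = set0 by exact: (@measurable0 _ T).
  by apply/seteqP; split=> // y Ay; apply: A0; exists y.
pose C b := [set x : config int | A (update x i b)].
have mC b : measurable (C b : set T).
  apply: IH => [j jr|x y xy]; first by apply: rL; rewrite inE jr orbT.
  by apply: lA => j; rewrite inE /update; case: eqP => //= _ /xy.
have mi b : measurable ([set x : config int | x i = b] : set T).
  by apply: sub_sigma_algebra; exists i, b; split=> //; apply: rL; rewrite inE eqxx.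
have -> : A = (C true `&` [set x : config int | x i = true]) `|`
              (C false `&` [set x : config int | x i = false]).
  apply/seteqP; split=> [x Ax|x [[Cx /= xi]|[Cx /= xi]]].
  - by case E : (x i); [left|right]; split; rewrite // /C /= -E updateE.
  - by rewrite -(updateE x i) xi.
  - by rewrite -(updateE x i) xi.
by apply: (@measurableU _ T); apply: (@measurableI _ T).
Qed.

Lemma outside_measurable A : outside_sigma_algebra L A -> measurable (A : set configZ).
Proof.
move: A; apply: smallest_sub; first exact: sigma_algebra_measurable.
by move=> _ [i [b [_ ->]]]; apply: clopen_measurable; exact: clopen_coordinate.
Qed.

(* The events depending on finitely many coordinates outside [L] form a
   pi-system generating the outside sigma-algebra. *)
Lemma cond_probability_local (E : set (config int)) (g : config int -> R) :
  measurable (E : set configZ) -> uniformly_local g -> (forall x, 0 <= g x <= 1) ->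
  (forall x y, (forall i, i \notin L -> x i = y i) -> g x = g y) ->
  (forall r A, (forall i, i \in r -> i \notin L) -> local_on r A ->
    mu (E `&` A) = (\int[mu]_(x in A) (g x)%:E)%E) ->
  is_cond_probability mu (outside_sigma_algebra L) E g.
Proof.
move=> mE ug g01 gL gen.
have g0 x : 0 <= g x by have /andP[] := g01 x.
have mg : measurable_fun setT (fun x : configZ => (g x)%:E).
  by apply/measurable_EFinP; exact: uniformly_local_measurable.
split.
  pose T := g_sigma_algebraType [set A | exists (i : int) (b : bool),
        i \notin L /\ A = [set x : config int | x i = b]].
  have mgT : measurable_fun setT (g : T -> R).
    pose clr (x : config int) : config int := fun i => if i \in L then true else x i.
    pose Fn n : T -> R := fun x => g (restrict_window n (clr x)).
    apply: (@measurable_fun_cvg _ _ _ _ Fn) => //.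
      move=> n _ B mB; rewrite setTI.
      apply: (@outside_local [seq i <- window n | i \notin L]).
        by move=> i; rewrite mem_filter => /andP[].
      move=> x y xy; rewrite /Fn /=; suff -> : restrict_window n (clr x) = restrict_window n (clr y) by [].
      apply/funext => i; rewrite /restrict_window; case: ifP => // iw; rewrite /clr.
      by case: ifP => // iL; apply: xy; rewrite mem_filter iL iw.
    move=> x _; have -> : g x = g (clr x).
      by apply: gL => i; rewrite /clr => /negPf ->.
    apply/cvgrPdist_le => e e0; have [N HN] := ug e e0.
    exists N => // n /= Nn; apply: HN => i; rewrite !mem_window => iN.
    by rewrite /restrict_window mem_window (leq_trans iN Nn).
  by move=> B mB; have := mgT measurableT B mB; rewrite setTI.
pose G : set (set (config int)) := [set A | exists r, (forall i, i \in r -> i \notin L) /\ local_on r A].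
have GF : outside_sigma_algebra L `<=` <<s G >>.
  apply: smallest_sub; first exact: smallest_sigma_algebra.
  move=> _ [i [b [iL ->]]]; apply: sub_sigma_algebra; exists [:: i]; split.
    by move=> j; rewrite inE => /eqP ->.
  by move=> x y xy /= <-; rewrite xy // inE.
have FG : <<s G >> `<=` outside_sigma_algebra L.
  apply: smallest_sub; first exact: smallest_sigma_algebra.
  by move=> A [r [rL lA]]; exact: outside_local rL lA.
move=> A /GF; move: A.
apply: (@dynkin_induction _ (g_sigma_algebraType G)) => //.
- move=> A B [r [rL lA]] [r' [rL' lB]]; exists (r ++ r'); split.
    by move=> i; rewrite mem_cat => /orP[/rL|/rL'].
  move=> x y xy [Ax Bx]; split; [apply: lA Ax|apply: lB Bx] => i ir; apply: xy;
  by rewrite mem_cat ir ?orbT.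
- by apply: (gen [::]).
- by move=> A [r [rL lA]]; exact: gen rL lA.
- move=> A /FG/outside_measurable mA IH.
  have mA' : measurable (~` A : set configZ) by exact: measurableC.
  have -> : mu (E `&` ~` A) = (mu E - mu (E `&` A))%E.
    rewrite -setDE; apply: measureD => //.
    by apply: le_lt_trans (probability_le1 _ mE) _; exact: ltry.
  have fx : mu (E `&` A) \is a fin_num by apply: fin_num_measure; exact: measurableI.
  have -> : mu E = (\int[mu]_(x in setT) (g x)%:E)%E.
    by rewrite -(gen [::] setT) ?setIT.
  rewrite -{1}(setvU A) setUC ge0_integral_setU //; last 3 first.
  - exact: measurable_funTS.
  - by move=> x _; rewrite lee_fin.
  - by apply/disj_setPS => x [].
  by rewrite -IH addeAC subee // add0e.
- move=> F mF tF IH.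
  have mF' n : measurable (F n : set configZ) by have /FG/outside_measurable := mF n.
  rewrite setI_bigcupr ge0_integral_bigcup //.
  + rewrite -(eq_eseriesr (fun k _ => IH k)); symmetry; apply/cvg_lim => //.
    apply: (measure_semi_sigma_additive (s := mu)).
    * by move=> n; exact: measurableI.
    * by apply/trivIsetP => i j _ _ ij; rewrite setIACA (_ : F i `&` F j = set0) ?setI0 //; move/trivIsetP : tF; apply.
    * by apply: bigcup_measurable => n _; exact: measurableI.
  + exact: measurable_funTS.
  + by move=> x _; rewrite lee_fin.
Qed.

End Outside.

Lemma ler_sum_uniq_sub (R : realType) (T : eqType) (s1 s2 : seq T) (f : T -> R) :
  uniq s1 -> uniq s2 -> {subset s1 <= s2} -> (forall t, 0 <= f t) ->
  \sum_(t <- s1) f t <= \sum_(t <- s2) f t.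
Proof.
move=> u1 u2 s12 f0.
have p1 : perm_eq s1 [seq t <- s2 | t \in s1].
  apply: uniq_perm => //; first by rewrite filter_uniq.
  by move=> t; rewrite mem_filter; case: (boolP (t \in s1)) => //= /s12.
rewrite (perm_big _ p1) big_filter big_mkcond /=; apply: ler_sum => t _.
by case: ifP.
Qed.

Section Tails.
Variables (R : realType) (J T : nat -> R).
Hypothesis (J0 : forall k, 0 <= J k).
Hypothesis JT : forall a m, \sum_(a <= k < m) J k <= T a.

Lemma sum_injective_le_tail (X : eqType) (s : seq X) (P : pred X) (f : X -> nat) a : uniq s ->
  (forall x y, x \in s -> y \in s -> P x -> P y -> f x = f y -> x = y) ->
  (forall x, x \in s -> P x -> (a <= f x)%N) ->
  \sum_(x <- s | P x) J (f x) <= T a.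
Proof.
move=> us fi fa; rewrite -big_filter; set s' := seq.filter P s.
have us' : uniq (map f s').
  rewrite map_inj_in_uniq ?filter_uniq // => x y; rewrite !mem_filter => /andP[Px xs] /andP[Py ys].
  exact: fi.
rewrite -(big_map f predT); set q := map f s' in us' *.
pose m := (\max_(k <- q) k).+1%N.
apply: le_trans (JT a m); rewrite /index_iota; apply: ler_sum_uniq_sub => //.
  exact: iota_uniq.
move=> k kq; rewrite mem_index_iota; apply/andP; split.
  by have /mapP[x] := kq; rewrite mem_filter => /andP[Px xs] ->; exact: fa.
by rewrite ltnS; apply: (@leq_bigmax_seq _ _ xpredT (fun n => n)).
Qed.

End Tails.

Section Rsum.
Variables (R : realType) (T : choiceType).

Lemma fine_esum_bounds (D : set T) (f : T -> R) (F : seq T) tau : uniq F ->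
  (forall t, 0 <= f t) -> (forall t, t \in F -> D t) ->
  (forall X : seq T, uniq X -> (forall t, t \in X -> D t /\ t \notin F) ->
     \sum_(t <- X) f t <= tau) ->
  \sum_(t <- F) f t <= fine (\esum_(t in D) (f t)%:E) <= \sum_(t <- F) f t + tau.
Proof.
move=> uF f0 FD Htau.
have lo : ((\sum_(t <- F) f t)%:E <= \esum_(t in D) (f t)%:E)%E.
  apply: ereal_sup_ubound; exists [set` F].
    by split; [exact: finite_seq|exact: FD].
  by rewrite -fsbig_seq // sumEFin.
have up : (\esum_(t in D) (f t)%:E <= (\sum_(t <- F) f t + tau)%:E)%E.
  apply: ub_ereal_sup => _ [A [finA AD] <-].
  rewrite fsbig_finite // sumEFin lee_fin.
  rewrite (bigID (fun t => t \in F)) /=; apply: lerD; last first.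
    rewrite -big_filter; apply: Htau; first by rewrite filter_uniq.
    move=> t; rewrite mem_filter => /andP[tF]; rewrite in_fset_set // inE => At.
    by split; first exact: AD.
  rewrite -big_filter; apply: ler_sum_uniq_sub => //; first by rewrite filter_uniq.
  by move=> t; rewrite mem_filter => /andP[].
have fin : (\esum_(t in D) (f t)%:E)%E \is a fin_num.
  rewrite ge0_fin_numE; first by apply: le_lt_trans up _; exact: ltry.
  by apply: esum_ge0 => t _; rewrite lee_fin.
by rewrite -!lee_fin fineK // lo up.
Qed.

Lemma rsum_approx (D : set T) (a : T -> R) (F : seq T) tau : uniq F ->
  (forall t, t \in F -> D t) ->
  (forall X : seq T, uniq X -> (forall t, t \in X -> D t /\ t \notin F) ->
     \sum_(t <- X) `|a t| <= tau) ->
  `|rsum D a - \sum_(t <- F) a t| <= tau.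
Proof.
move=> uF FD Htau; rewrite /rsum.
pose p t := Num.max (a t) 0; pose q t := Num.max (- a t) 0.
have p0 t : 0 <= p t by rewrite le_max lexx orbT.
have q0 t : 0 <= q t by rewrite le_max lexx orbT.
have pq t : a t = p t - q t.
  by rewrite /p /q !maxElt; case: ltP => ?; case: ltP => ?; lra.
have pa t : p t <= `|a t| by rewrite ge_max ler_norm normr_ge0.
have qa t : q t <= `|a t| by rewrite ge_max normr_ge0 andbT -normrN ler_norm.
have -> : (\esum_(t in D) (EFin \o a)^\+ t)%E = (\esum_(t in D) (p t)%:E)%E.
  by congr esum; apply/funext => t; rewrite funeposE /p /= EFin_max.
have -> : (\esum_(t in D) (EFin \o a)^\- t)%E = (\esum_(t in D) (q t)%:E)%E.
  by congr esum; apply/funext => t; rewrite funenegE /q /= EFin_max.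
have /andP[l1 u1] : \sum_(t <- F) p t <= fine (\esum_(t in D) (p t)%:E) <= \sum_(t <- F) p t + tau.
  apply: fine_esum_bounds => // X uX XD; apply: le_trans (Htau X uX XD).
  by apply: ler_sum => t _.
have /andP[l2 u2] : \sum_(t <- F) q t <= fine (\esum_(t in D) (q t)%:E) <= \sum_(t <- F) q t + tau.
  apply: fine_esum_bounds => // X uX XD; apply: le_trans (Htau X uX XD).
  by apply: ler_sum => t _.
have -> : \sum_(t <- F) a t = \sum_(t <- F) p t - \sum_(t <- F) q t.
  by rewrite -sumrB; apply: eq_bigr => t _; exact: pq.
by rewrite ler_norml; apply/andP; split; lra.
Qed.

End Rsum.

Section Interaction.
Variables (R : realType) (J T : nat -> R) (L : {fset int}) (r : nat).
Hypothesis (J0 : forall k, 0 <= J k).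
Hypothesis JT : forall a m, \sum_(a <= k < m) J k <= T a.
Hypothesis Lr : forall i, i \in L -> (`|i| <= r)%N.
Implicit Types (x : config int) (n : nat).

Let N n := n.*2.+1.

Definition pos n (v : 'I_(N n)) : int := (v : nat)%:Z - n%:Z.

Lemma pos_inj n : injective (@pos n).
Proof. by move=> u v; rewrite /pos => h; apply: ord_inj; lia. Qed.

Lemma pos_bound n (v : 'I_(N n)) : (`|pos v| <= n)%N.
Proof. by rewrite /pos; have := ltn_ord v; rewrite /N; lia. Qed.

Lemma pos_surj n (i : int) : (`|i| <= n)%N -> exists v : 'I_(N n), pos v = i.
Proof.
move=> h; have lt : (`|(i + n%:Z)%R|%N < N n)%N by rewrite /N; lia.
by exists (Ordinal lt); rewrite /pos /=; lia.
Qed.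

Definition touching n : pred ('I_(N n) * 'I_(N n)) :=
  fun e => ((e.1 : nat) < e.2)%N && ((pos e.1 \in L) || (pos e.2 \in L)).

Lemma sum_L_le (a : int -> R) b : (forall i, i \in L -> a i <= b) ->
  \sum_(i <- L) a i <= #|` L|%:R * b.
Proof.
move=> ab; rewrite big_seq_fsetE /=; apply: le_trans (ler_sum _ (fun i _ => ab _ (valP i))) _.
by rewrite sumr_const -cardfE mulr_natl.
Qed.

Lemma interaction_approx n x : (r <= n)%N ->
  `|interaction J L x - \sum_(e | touching (n := n) e)
      J (e.2 - e.1)%N * spin R (x (pos e.1)) * spin R (x (pos e.2))| <=
  #|` L|%:R * (2 * T (n - r)).
Proof.
move=> rn; set a := fun p : int * int => J `|p.1 - p.2|%N * spin R (x p.1) * spin R (x p.2).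
pose E := ('I_(N n) * 'I_(N n))%type.
pose pp (e : E) := (pos e.1, pos e.2).
have ppi : injective pp by move=> [u v] [u' v'] [/pos_inj -> /pos_inj ->].
pose F := [seq pp e | e <- enum (touching (n := n))].
have -> : \sum_(e | touching (n := n) e) J (e.2 - e.1)%N * spin R (x (pos e.1)) * spin R (x (pos e.2))
   = \sum_(p <- F) a p.
  rewrite big_map big_enum /=; apply: eq_bigr => e /andP[lt _].
  by rewrite /a /pp /=; congr (J _ * _ * _); rewrite /pos; lia.
apply: rsum_approx.
- by rewrite map_inj_uniq ?enum_uniq.
- by move=> p /mapP[e]; rewrite mem_enum => /andP[lt to] ->; rewrite /pp /= to andbT /pos; lia.
move=> X uX XD.
have aE p : `|a p| = J `|p.1 - p.2|%N.
  by rewrite /a !normrM !norm_spin !mulr1 ger0_norm.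
have XP p : p \in X -> [/\ p.1 < p.2, (p.1 \in L) || (p.2 \in L) &
    (n < `|p.1|)%N \/ (n < `|p.2|)%N].
  move=> /XD[/andP[lt to] nF]; split=> //; apply: contrapT => /not_orP[].
  move=> /negP; rewrite -leqNgt => /pos_surj[u hu] /negP; rewrite -leqNgt => /pos_surj[v hv].
  move/negP: nF; apply; apply/mapP; exists (u, v); last by rewrite /pp /= hu hv -surjective_pairing.
  rewrite mem_enum unfold_in /= hu hv to andbT.
  by move: lt; rewrite -hu -hv /pos; lia.
under eq_bigr do rewrite aE.
apply: (@le_trans _ _ (\sum_(i <- L) (\sum_(p <- X | p.1 == i) J `|p.1 - p.2|%N +
    \sum_(p <- X | p.2 == i) J `|p.1 - p.2|%N))).
  rewrite big_split /= (exchange_big_dep xpredT) //= [X in _ + X](exchange_big_dep xpredT) //=.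
  rewrite -big_split /= big_seq [leRHS]big_seq; apply: ler_sum => p pX.
  have S0 j : 0 <= \sum_(i <- L | j == i) J `|p.1 - p.2|%N by apply: sumr_ge0.
  have SJ j : j \in L -> J `|p.1 - p.2|%N <= \sum_(i <- L | j == i) J `|p.1 - p.2|%N.
    move=> jL; rewrite (big_rem j) ?eqxx //= lerDl; exact: sumr_ge0.
  by have [_ /orP[/SJ h|/SJ h] _] := XP p pX; apply: le_trans h _; rewrite ?lerDl ?lerDr.
apply: sum_L_le => i iL; rewrite mulr2n mulrDl mul1r; have ir := Lr iL.
apply: lerD; apply: (sum_injective_le_tail J0 JT) => //.
- move=> p q pX qX /eqP pi /eqP qi h; have [l1 _ _] := XP p pX; have [l2 _ _] := XP q qX.
  by rewrite [p]surjective_pairing [q]surjective_pairing; congr (_, _); lia.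
- by move=> p pX /eqP pi; have [l1 _ o] := XP p pX; case: o; lia.
- move=> p q pX qX /eqP pi /eqP qi h; have [l1 _ _] := XP p pX; have [l2 _ _] := XP q qX.
  by rewrite [p]surjective_pairing [q]surjective_pairing; congr (_, _); lia.
- by move=> p pX /eqP pi; have [l1 _ o] := XP p pX; case: o; lia.
Qed.

(* Ring and line couplings agree except on pairs more than half the ring apart. *)
Lemma ring_interaction_approx n x : (r <= n)%N ->
  `|\sum_(e | touching (n := n) e) (ringJ J e.1 e.2) * spin R (x (pos e.1)) * spin R (x (pos e.2)) -
    \sum_(e | touching (n := n) e)
      J (e.2 - e.1)%N * spin R (x (pos e.1)) * spin R (x (pos e.2))| <=
  #|` L|%:R * (2 * (T (n - r) + T (n - r))).
Proof.
move=> rn; rewrite -sumrB; apply: le_trans (ler_norm_sum _ _ _) _.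
pose far (e : 'I_(N n) * 'I_(N n)) := (n < e.2 - e.1)%N.
pose w (e : 'I_(N n) * 'I_(N n)) := J (e.2 - e.1)%N + J (N n - (e.2 - e.1))%N.
have w0 e : 0 <= w e by rewrite addr_ge0.
apply: (@le_trans _ _ (\sum_(e | touching (n := n) e && far e) w e)).
  rewrite [leRHS]big_mkcondr /=; apply: ler_sum => e /andP[lt _].
  have -> : ringJ J e.1 e.2 = J (minn (e.2 - e.1) (N n - (e.2 - e.1))).
    by rewrite /ringJ; congr (J _); rewrite /ndist; lia.
  rewrite -!mulrBl !normrM !norm_spin !mulr1 /far.
  case: ifP => [f|/negbT f]; last first.
    rewrite (_ : minn _ _ = (e.2 - e.1)%N) ?subrr ?normr0 //.
    by have := ltn_ord e.2; move: f; rewrite /N; lia.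
  rewrite /w; have d1 := J0 (e.2 - e.1); have d2 := J0 (N n - (e.2 - e.1)).
  by rewrite /minn; case: ifP => _; rewrite ler_norml; apply/andP; split; lra.
have key : \sum_(e | touching (n := n) e && far e) w e <=
    \sum_(i <- L) (\sum_(e : 'I_(N n) * 'I_(N n) | [&& pos e.1 == i, (e.1 < e.2)%N & far e]) w e +
      \sum_(e : 'I_(N n) * 'I_(N n) | [&& pos e.2 == i, (e.1 < e.2)%N & far e]) w e).
  rewrite [leRHS]big_split /= (exchange_big_dep xpredT) //= [X in _ + X](exchange_big_dep xpredT) //=.
  rewrite -[leRHS]big_split /= big_mkcond /=; apply: ler_sum => e _.
  have S0 j : 0 <= \sum_(i <- L | [&& j == i, (e.1 < e.2)%N & far e]) w e by apply: sumr_ge0.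
  case: ifP => [/andP[/andP[lt to] f]|_]; last by rewrite addr_ge0.
  have SJ j : j \in L -> w e <= \sum_(i <- L | [&& j == i, (e.1 < e.2)%N & far e]) w e.
    move=> jL; rewrite (big_rem j) //= eqxx lt f /= lerDl; exact: sumr_ge0.
  by case/orP: to => /SJ h; apply: le_trans h _; rewrite ?lerDl ?lerDr.
apply: le_trans key _; apply: sum_L_le => i iL; rewrite mulr2n mulrDl mul1r; have ir := Lr iL.
have B (P : pred ('I_(N n) * 'I_(N n))) :
    (forall e e', P e -> P e' -> (e.2 - e.1 = e'.2 - e'.1)%N -> e = e') ->
    (forall e, P e -> (n < e.2 - e.1)%N /\ (e.2 - e.1 <= n + r)%N) ->
    \sum_(e | P e) w e <= T (n - r) + T (n - r).
  move=> Pi Pb; rewrite big_split /=; apply: lerD;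
  apply: (sum_injective_le_tail J0 JT); rewrite ?index_enum_uniq //.
  - by move=> e e' _ _ Pe Pe'; exact: Pi.
  - by move=> e _ /Pb[]; lia.
  - move=> e e' _ _ Pe Pe' h; apply: Pi => //.
    by have := Pb e Pe; have := Pb e' Pe'; move: h; rewrite /N; lia.
  - by move=> e _ /Pb[]; rewrite /N; lia.
apply: lerD; apply: B.
- move=> [u v] [u' v'] /and3P[/eqP /= pu lt _] /and3P[/eqP /= pu' lt' _] h.
  have uu : u = u' by apply: (@pos_inj n); rewrite pu pu'.
  by subst u'; congr (_, _); apply: val_inj; rewrite /=; lia.
- move=> [u v] /and3P[/eqP /= pu lt f]; split=> //=.
  by have := ltn_ord v; move: pu; rewrite /pos /N; lia.
- move=> [u v] [u' v'] /and3P[/eqP /= pu lt _] /and3P[/eqP /= pu' lt' _] h.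
  have uu : v = v' by apply: (@pos_inj n); rewrite pu pu'.
  by subst v'; congr (_, _); apply: val_inj; rewrite /=; lia.
- move=> [u v] /and3P[/eqP /= pu lt f]; split=> //=.
  by have := ltn_ord v; move: pu; rewrite /pos /N; lia.
Qed.

End Interaction.

Lemma softmax_close (R : realType) (K : finType) (a th : K -> R) (C d : R) (k : K) :
  (forall i, `|th i| <= d) ->
  `|expR (a k + C + th k) / (\sum_i expR (a i + C + th i)) -
    expR (a k) / (\sum_i expR (a i))| <= expR (2 * d) - 1.
Proof.
move=> thd; set p := _ / _; set q := expR (a k) / _.
have pos_sum (f : K -> R) : 0 < \sum_i expR (f i).
  by rewrite (bigD1 k) //= ltr_pwDl ?expR_gt0 // sumr_ge0 // => i _; exact: expR_ge0.
have le1 (f : K -> R) : expR (f k) / \sum_i expR (f i) <= 1.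
  rewrite ler_pdivrMr // mul1r (bigD1 k) //= lerDl sumr_ge0 // => i _; exact: expR_ge0.
have p1 : p <= 1 by exact: (le1 (fun i => a i + C + th i)).
have q1 : q <= 1 by exact: le1.
have p0 : 0 <= p by rewrite divr_ge0 ?expR_ge0 // ltW.
have q0 : 0 <= q by rewrite divr_ge0 ?expR_ge0 // ltW.
have up i : expR (a i + C + th i) <= expR (a i) * expR (C + d).
  by rewrite -expRD ler_expR; have := thd i; rewrite ler_norml => /andP[_ h]; lra.
have lo i : expR (a i) * expR (C - d) <= expR (a i + C + th i).
  by rewrite -expRD ler_expR; have := thd i; rewrite ler_norml => /andP[h _]; lra.
have e2 : expR (2 * d) = expR (C + d) / expR (C - d).
  by rewrite -expRN -expRD; congr expR; ring.
have pq : p <= expR (2 * d) * q.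
  rewrite /p ler_pdivrMr // e2 /q.
  have -> : expR (C + d) / expR (C - d) * (expR (a k) / \sum_i expR (a i)) *
     \sum_i expR (a i + C + th i) = (expR (a k) * expR (C + d)) *
       ((\sum_i expR (a i + C + th i)) / expR (C - d) / \sum_i expR (a i)) by ring.
  rewrite -[leLHS]mulr1; apply: ler_pM; rewrite ?expR_ge0 //.
  rewrite ler_pdivlMr // mul1r ler_pdivlMr ?expR_gt0 // mulr_suml.
  exact: ler_sum.
have qp : q <= expR (2 * d) * p.
  rewrite /q ler_pdivrMr // e2 /p.
  have -> : expR (C + d) / expR (C - d) * (expR (a k + C + th k) / \sum_i expR (a i + C + th i)) *
     \sum_i expR (a i) = (expR (a k + C + th k) / expR (C - d)) *
       ((\sum_i expR (a i)) * expR (C + d) / \sum_i expR (a i + C + th i)) by ring.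
  rewrite -[leLHS]mulr1; apply: ler_pM; rewrite ?expR_ge0 //.
    by rewrite ler_pdivlMr ?expR_gt0.
  by rewrite ler_pdivlMr // mul1r mulr_suml; exact: ler_sum.
have d1 : 1 <= expR (2 * d).
  have d0 : 0 <= d by apply: le_trans (thd k); exact: normr_ge0.
  by apply: le_trans (expR_ge1Dx _); lra.
have := ler_wpM2l (_ : 0 <= expR (2 * d) - 1) q1; rewrite subr_ge0 => /(_ d1) hq.
have := ler_wpM2l (_ : 0 <= expR (2 * d) - 1) p1; rewrite subr_ge0 => /(_ d1) hp.
by rewrite ler_norml; apply/andP; split; lra.
Qed.

Section FiniteDlr.
Variables (R : realType) (L : {fset int}) (n : nat).
Hypothesis Ln : forall i, i \in L -> (`|i| <= n)%N.
Let V := 'I_(n.*2.+1).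
Implicit Types (s : {ffun V -> bool}) (t u : {ffun L -> bool}).

Definition extend s : config int :=
  fun i => if (`|i| <= n)%N then s (inord `|(i + n%:Z)%R|%N) else true.

Definition glue_ring t s : {ffun V -> bool} :=
  [ffun v => if insub (pos v) is Some j then t j else s v].

Lemma extend_pos s (v : V) : extend s (pos v) = s v.
Proof.
rewrite /extend pos_bound; congr (s _); apply: ord_inj; rewrite inordK /pos.
  by lia.
by have := ltn_ord v; lia.
Qed.

Lemma extend_glue t s : extend (glue_ring t s) = glue_config t (extend s).
Proof.
apply/funext => i; have [ni|ni] := leqP `|i| n.
  have [v <-] := pos_surj ni; rewrite extend_pos ffunE /glue_config.
  by case: insubP => //= _; rewrite extend_pos.
rewrite /extend /glue_config leqNgt ni /=; case: insubP => // j iL.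
by have := Ln iL; rewrite leqNgt ni.
Qed.

Lemma glue_ringK t u s : glue_ring t (glue_ring u s) = glue_ring t s.
Proof. by apply/ffunP => v; rewrite !ffunE; case: insubP. Qed.

Definition restrict_ring s : {ffun L -> bool} := [ffun j => extend s (val j)].

Lemma restrict_glue t s : restrict_ring (glue_ring t s) = t.
Proof.
apply/ffunP => j; rewrite ffunE extend_glue /glue_config.
by case: insubP => [k _ kj|]; [congr (t _); apply: val_inj|rewrite (valP j)].
Qed.

Lemma glue_restrict s : glue_ring (restrict_ring s) s = s.
Proof.
apply/ffunP => v; rewrite ffunE; case: insubP => // j _ jv.
by rewrite ffunE jv extend_pos.
Qed.

Lemma cylinder_extend t s : (extend s \in cylinder t) = (restrict_ring s == t).
Proof.
apply/idP/eqP => [|<-]; rewrite inE /cylinder /=.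
  by move=> H; apply/ffunP => j; rewrite ffunE H.
by move=> j; rewrite ffunE.
Qed.

Lemma sum_glue t (G : {ffun V -> bool} -> R) :
  \sum_s G s = \sum_(s | restrict_ring s == t) \sum_u G (glue_ring u s).
Proof.
rewrite (partition_big (glue_ring t) (fun s => restrict_ring s == t)) /=; last first.
  by move=> s _; rewrite restrict_glue.
apply: eq_bigr => s /eqP st.
rewrite (reindex_onto (fun u => glue_ring u s) restrict_ring) /=; last first.
  by move=> s' /eqP <-; rewrite glue_ringK glue_restrict.
apply: eq_bigl => u; rewrite glue_ringK restrict_glue eqxx andbT.
by rewrite -st glue_restrict eqxx.
Qed.

Lemma finite_dlr (E : {ffun V -> bool} -> R) (A : set (config int)) t :
  (forall u x, (glue_config u x \in A) = (x \in A)) ->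
  ev E (fun s => \1_(cylinder t `&` A) (extend s)) =
  ev E (fun s => expR (E (glue_ring t s)) / (\sum_u expR (E (glue_ring u s))) *
    \1_A (extend s)).
Proof.
move=> AL; rewrite /ev; congr (_ / _).
rewrite [RHS](sum_glue t) [LHS](bigID (fun s => restrict_ring s == t)) /=.
rewrite [X in _ + X]big1 ?addr0; last first.
  by move=> s st; rewrite indicE in_setI cylinder_extend (negPf st) mul0r.
apply: eq_bigr => s st.
have gA u : extend (glue_ring u s) \in A = (extend s \in A).
  by rewrite extend_glue AL.
under eq_bigr => u _ do rewrite indicE gA glue_ringK.
have -> : \sum_u expR (E (glue_ring t s)) / (\sum_i expR (E (glue_ring i (glue_ring u s)))) *
   (extend s \in A)%:R * expR (E (glue_ring u s)) =
   expR (E (glue_ring t s)) / (\sum_i expR (E (glue_ring i s))) * (extend s \in A)%:R *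
   \sum_u expR (E (glue_ring u s)).
  rewrite mulr_sumr; apply: eq_bigr => u _.
  by under eq_bigr => i _ do rewrite glue_ringK.
have Z0 : \sum_u expR (E (glue_ring u s)) != 0.
  rewrite gt_eqF // (bigD1 t) //= ltr_pwDl ?expR_gt0 // sumr_ge0 // => u _; exact: expR_ge0.
rewrite indicE in_setI cylinder_extend st /= mulrAC divfK //.
by rewrite -(eqP st) glue_restrict mulrC.
Qed.

End FiniteDlr.

Lemma pairE_lt (R : realType) m (K : 'I_m -> 'I_m -> R) (s : {ffun 'I_m -> bool}) :
  (forall u v, K u v = K v u) -> (forall u, K u u = 0) ->
  pairE K s = \sum_(e : 'I_m * 'I_m | (e.1 < e.2)%N) K e.1 e.2 * spin R (s e.1) * spin R (s e.2).
Proof.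
move=> Ks K0; rewrite pairE_pair (bigID (fun e : 'I_m * 'I_m => (e.1 < e.2)%N)) /=.
rewrite [X in _ + X](bigID (fun e : 'I_m * 'I_m => (e.2 < e.1)%N)) /= [X in _ + (_ + X)]big1 ?addr0; last first.
  move=> [u v] /= /andP[]; rewrite -!leqNgt => uv vu.
  by have -> : u = v; [apply: ord_inj; apply/eqP; rewrite eqn_leq uv vu|rewrite K0 !mul0r].
have swap_inj : injective (fun e : 'I_m * 'I_m => (e.2, e.1)) by move=> [u v] [u' v'] /= [-> ->].
rewrite [X in _ + X](reindex_inj swap_inj) /=.
rewrite [X in _ + X](eq_bigl (fun e : 'I_m * 'I_m => (e.1 < e.2)%N)); last first.
  by move=> [u v] /=; case: (ltngtP u v).
rewrite -big_split /=; apply: eq_bigr => -[u v] _ /=.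
by rewrite !chi2 (Ks v u); field.
Qed.

Section GibbsKernel.
Variables (R : realType) (J T : nat -> R) (L : {fset int}) (r : nat) (b : R).
Hypothesis (J0 : forall k, 0 <= J k) (Jz : J 0 = 0) (b0 : 0 <= b).
Hypothesis JT : forall a m, \sum_(a <= k < m) J k <= T a.
Hypothesis Lr : forall i, i \in L -> (`|i| <= r)%N.
Implicit Types (t u : {ffun L -> bool}) (x y : config int).

Definition ringE n (h : R) : {ffun 'I_(n.*2.+1) -> bool} -> R :=
  modelE (fun v w : 'I_(n.*2.+1) => b * ringJ J v w) (fun=> h).

(* The far bonds are cut off twice: from the line to the window, and from the
   window to the ring, whose short way round is at least [n - r] there. *)
Definition error n (h : R) : R := b * (#|` L|%:R * (6 * T (n - r))) + `|h| * #|` L|%:R.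

Lemma ringE_glue n h (s : {ffun 'I_(n.*2.+1) -> bool}) t : (r <= n)%N ->
  `|ringE h (glue_ring t s) - b * interaction J L (glue_config t (extend s)) -
   (b * (\sum_(e : 'I_(n.*2.+1) * 'I_(n.*2.+1) | (e.1 < e.2)%N && ~~ touching L e)
      ringJ J e.1 e.2 * spin R (s e.1) * spin R (s e.2)) +
    h * \sum_(v | pos v \notin L) spin R (s v))| <= error n h.
Proof.
move=> rn; have Ln i : i \in L -> (`|i| <= n)%N by move=> /Lr ir; exact: leq_trans ir rn.
set s' := glue_ring t s; set x := glue_config t (extend s).
have xs' : extend s' = x by exact: extend_glue.
have off v : pos v \notin L -> s' v = s v.
  by rewrite /s' ffunE => vL; case: insubP => //; rewrite (negPf vL).
rewrite /ringE modelE_const pairE_lt; last 2 first.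
- by move=> v w; exact: ringJ_sym.
- by move=> v; rewrite /ringJ /ndist subnn min0n.
rewrite (bigID (touching L (n := n))) /=.
rewrite [X in _ + _ * X](bigID (fun v => pos v \in L)) /=.
have -> : \sum_(e : 'I_(n.*2.+1) * 'I_(n.*2.+1) | (e.1 < e.2)%N && ~~ touching L e)
      ringJ J e.1 e.2 * spin R (s' e.1) * spin R (s' e.2) =
   \sum_(e : 'I_(n.*2.+1) * 'I_(n.*2.+1) | (e.1 < e.2)%N && ~~ touching L e)
      ringJ J e.1 e.2 * spin R (s e.1) * spin R (s e.2).
  apply: eq_bigr => e /andP[lt]; rewrite /touching lt /= negb_or => /andP[n1 n2].
  by rewrite !off.
have -> : \sum_(v | pos v \notin L) chi R [:: v] s' = \sum_(v | pos v \notin L) spin R (s v).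
  by apply: eq_bigr => v vL; rewrite chi1 off.
have -> : \sum_(e : 'I_(n.*2.+1) * 'I_(n.*2.+1) | (e.1 < e.2)%N && touching L e)
      ringJ J e.1 e.2 * spin R (s' e.1) * spin R (s' e.2) =
   \sum_(e | touching L (n := n) e) ringJ J e.1 e.2 * spin R (x (pos e.1)) * spin R (x (pos e.2)).
  apply: eq_big => [e|e _]; last by rewrite -xs' !extend_pos.
  by rewrite /touching; case: (_ < _)%N.
set S1 := \sum_(e | touching L e) _; set S2 := \sum_(e | _ && ~~ _) _.
set S3 := \sum_(v | _ \in _) _; set S4 := \sum_(v | _ \notin _) _; set Ix := interaction _ _ _.
have -> : b * (S1 + S2) + h * (S3 + S4) - b * Ix - (b * S2 + h * S4) = b * (S1 - Ix) + h * S3 by ring.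
apply: le_trans (ler_normD _ _) _; rewrite !normrM (ger0_norm b0); apply: lerD.
  apply: ler_wpM2l => //.
  have h1 := interaction_approx J0 JT Lr x rn; have h2 := ring_interaction_approx J0 JT Lr x rn.
  have -> : #|` L|%:R * (6 * T (n - r)) = #|` L|%:R * (2 * (T (n - r) + T (n - r))) +
     #|` L|%:R * (2 * T (n - r)) by ring.
  rewrite -[S1 - Ix](subrKA (\sum_(e | touching L (n := n) e)
      J (e.2 - e.1)%N * spin R (x (pos e.1)) * spin R (x (pos e.2)))).
  apply: le_trans (ler_normD _ _) _; apply: lerD; first exact: h2.
  by rewrite distrC.
apply: ler_wpM2l => //; apply: le_trans (ler_norm_sum _ _ _) _.
rewrite (eq_bigr (fun=> 1)) => [|v _]; last by rewrite norm_chi.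
rewrite sumr_const ler_nat.
rewrite cardE -(size_map (@pos n)); apply: uniq_leq_size.
  by rewrite map_inj_uniq ?enum_uniq //; exact: pos_inj.
by move=> i /mapP[v]; rewrite mem_enum => vL ->.
Qed.

Lemma gibbs_kernelE t x : gibbs_kernel b J t x =
  expR (b * interaction J L (glue_config t x)) /
  \sum_(u : {ffun L -> bool}) expR (b * interaction J L (glue_config u x)).
Proof. by []. Qed.

Lemma ring_kernel_close n h (s : {ffun 'I_(n.*2.+1) -> bool}) t : (r <= n)%N ->
  `|expR (ringE h (glue_ring t s)) / (\sum_(u : {ffun L -> bool}) expR (ringE h (glue_ring u s))) -
    gibbs_kernel b J t (extend (n := n) s)| <= expR (2 * error n h) - 1.
Proof.
move=> rn; rewrite gibbs_kernelE.
pose C := b * (\sum_(e : 'I_(n.*2.+1) * 'I_(n.*2.+1) | (e.1 < e.2)%N && ~~ touching L e)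
      ringJ J e.1 e.2 * spin R (s e.1) * spin R (s e.2)) +
    h * \sum_(v | pos v \notin L) spin R (s v).
pose a (u : {ffun L -> bool}) := b * interaction J L (glue_config u (extend s)).
pose th (u : {ffun L -> bool}) := ringE h (glue_ring u s) - a u - C.
have := @softmax_close _ _ a th C (error n h) t (fun u => ringE_glue h s u rn).
have E u : a u + C + th u = ringE h (glue_ring u s) by rewrite /th; ring.
by rewrite E; under eq_bigr do rewrite E.
Qed.

Lemma gibbs_kernel01 t x : 0 <= gibbs_kernel b J t x <= 1.
Proof.
rewrite gibbs_kernelE; set Z := \sum_u _.
have Z0 : 0 < Z.
  by rewrite /Z (bigD1 t) //= ltr_pwDl ?expR_gt0 // sumr_ge0 // => u _; exact: expR_ge0.
apply/andP; split; first by rewrite divr_ge0 ?expR_ge0 // ltW.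
rewrite ler_pdivrMr // mul1r /Z (bigD1 t) //= lerDl.
by apply: sumr_ge0 => u _; exact: expR_ge0.
Qed.

Lemma gibbs_kernel_outside t x y : (forall i, i \notin L -> x i = y i) ->
  gibbs_kernel b J t x = gibbs_kernel b J t y.
Proof.
move=> xy; have E u : glue_config u x = glue_config u y.
  by apply/funext => i; rewrite /glue_config; case: insubP => // /xy.
by rewrite !gibbs_kernelE E; under eq_bigr do rewrite E.
Qed.

Lemma gibbs_kernel_window n t x y : (r <= n)%N -> (forall i, i \in window n.+1 -> x i = y i) ->
  `|gibbs_kernel b J t x - gibbs_kernel b J t y| <=
  expR (2 * (b * (#|` L|%:R * (4 * T (n - r))))) - 1.
Proof.
move=> rn xy; rewrite !gibbs_kernelE.
pose a (u : {ffun L -> bool}) := b * interaction J L (glue_config u y).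
pose th (u : {ffun L -> bool}) := b * interaction J L (glue_config u x) - a u.
have E u : a u + 0 + th u = b * interaction J L (glue_config u x) by rewrite /th; ring.
have := @softmax_close _ _ a th 0 (b * (#|` L|%:R * (4 * T (n - r)))) t _.
rewrite E; under eq_bigr do rewrite E; apply => u.
rewrite /th /a -mulrBr normrM (ger0_norm b0); apply: ler_wpM2l => //.
have h1 := interaction_approx J0 JT Lr (glue_config u x) rn.
have h2 := interaction_approx J0 JT Lr (glue_config u y) rn.
have e : \sum_(e | touching L (n := n) e) J (e.2 - e.1)%N *
     spin R (glue_config u x (pos e.1)) * spin R (glue_config u x (pos e.2)) =
   \sum_(e | touching L (n := n) e) J (e.2 - e.1)%N *
     spin R (glue_config u y (pos e.1)) * spin R (glue_config u y (pos e.2)).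
  have gl (v : 'I_(n.*2.+1)) : glue_config u x (pos v) = glue_config u y (pos v).
    rewrite /glue_config; case: insubP => // _; apply: xy.
    by rewrite mem_window ltnS pos_bound.
  by apply: eq_bigr => e _; rewrite !gl.
rewrite e in h1; move: h1 h2; set S := \sum_(e | _) _ => h1 h2.
have -> : #|` L|%:R * (4 * T (n - r)) = #|` L|%:R * (2 * T (n - r)) + #|` L|%:R * (2 * T (n - r)) by ring.
rewrite -[X in `|X|](subrKA S); apply: le_trans (ler_normD _ _) _; apply: lerD => //.
by rewrite distrC.
Qed.

End GibbsKernel.

Lemma expR_sub1_small (R : realType) (e : R) : 0 < e ->
  exists2 d : R, 0 < d & forall x, x <= d -> expR x - 1 <= e.
Proof.
move=> e0; exists (ln (1 + e)); first by rewrite ln_gt0 // ltrDl.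
by move=> x xd; rewrite lerBlDl -[1 + e]lnK ?ler_expR // posrE addr_gt0.
Qed.

Lemma ev_cmul (R : realType) (V : finType) (t : {ffun V -> bool}) (E f : {ffun V -> bool} -> R) :
  ev E f = ev (fun s => E (cmul t s)) (fun s => f (cmul t s)).
Proof. by rewrite /ev; congr (_ / _); exact: reindex_cmul. Qed.

Section RingLimit.
Variables (R : realType) (J T : nat -> R) (b : R) (l : (nat -> R) -> R).
Variables (n : nat -> nat) (h : nat -> R).
Hypothesis (J0 : forall k, 0 <= J k) (Jz : J 0 = 0) (b0 : 0 <= b).
Hypothesis JT : forall a m, \sum_(a <= k < m) J k <= T a.
Hypothesis T0 : T @ \oo --> 0.
Hypothesis gl : generalized_limit l.
Hypothesis nk : forall k, (k <= n k)%N.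
Hypothesis h0 : h @ \oo --> 0.

Definition ring_state k (F : config int -> R) : R :=
  ev (@ringE R J b (n k) (h k)) (fun s => F (extend s)).

Definition ring_mean (F : config int -> R) : R := l (ring_state ^~ F).

Lemma bounded_ring_state F : bounded_fct F -> bounded_seq (ring_state ^~ F).
Proof. by move=> [K FK]; exists K => k; apply: ev_norm_le. Qed.

Lemma ring_mean_is_mean : is_mean ring_mean.
Proof.
split.
- move=> F G bF bG; rewrite -(gl_add gl); try exact: bounded_ring_state.
  by congr l; apply/funext => k; exact: evD.
- move=> c F bF; rewrite -(gl_scale gl); last exact: bounded_ring_state.
  by congr l; apply/funext => k; exact: evZ.
- move=> F G bF bG FG; apply: (gl_le gl); try exact: bounded_ring_state.
  by exists 0%N => k _; apply: ev_le.
- by move=> c; rewrite -[RHS](gl_cst gl); congr l; apply/funext => k; exact: ev_cst.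
Qed.

Lemma tail_small (e : R) : 0 < e -> exists N, forall k, (N <= k)%N -> T k <= e.
Proof.
move=> e0; have /cvgrPdist_le/(_ e e0)[N _ HN] := T0; exists N => k Nk.
by have := HN k Nk; rewrite sub0r normrN; exact: le_trans (ler_norm _).
Qed.

Lemma error_small (L : {fset int}) r (d : R) : 0 < d ->
  exists N, forall k, (N <= k)%N -> (r <= n k)%N /\ 2 * error T L r b (n k) (h k) <= d.
Proof.
move=> d0; set K : R := #|` L|%:R; have K0 : 0 <= K by [].
pose c := 2 * (b * (K * 6) + K) + 1.
have c0 : 0 < c.
  by rewrite ltr_wpDl // mulr_ge0 // addr_ge0 // mulr_ge0 // mulr_ge0.
have e0 : 0 < d / c by rewrite divr_gt0.
have [N1 HN1] := tail_small e0.
have /cvgrPdist_le/(_ _ e0)[N2 _ HN2] := h0.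
exists (N1 + N2 + r)%N => k Nk; have knk := nk k.
split; first by lia.
have t1 : T (n k - r)%N <= d / c by apply: HN1; lia.
have t2 : `|h k| <= d / c by have := HN2 k; rewrite /= sub0r normrN; apply; lia.
have dc : c * (d / c) = d by rewrite mulrC divfK // gt_eqF.
rewrite /error -/K -[leRHS]dc {1}/c.
have b1 := ler_wpM2l (mulr_ge0 b0 K0) t1.
have b2 := ler_wpM2l K0 t2; have := ltW e0.
by move: (T _) (d / c) b1 b2 => x y; lra.
Qed.

Lemma kernel_uniformly_local (L : {fset int}) (t : {ffun L -> bool}) r :
  (forall i, i \in L -> (`|i| <= r)%N) -> uniformly_local (gibbs_kernel b J t).
Proof.
move=> Lr e e0; have [d d0 dP] := expR_sub1_small e0.
set K : R := #|` L|%:R; have K0 : 0 <= K by [].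
pose c := 8 * (b * K) + 1.
have c0 : 0 < c by rewrite ltr_wpDl // mulr_ge0 // mulr_ge0.
have [N HN] := tail_small (divr_gt0 d0 c0).
exists (N + r).+1 => x y xy.
apply: le_trans (gibbs_kernel_window J0 b0 JT Lr t _ xy) _; first by lia.
apply: dP; have t1 : T (N + r - r)%N <= d / c by apply: HN; lia.
have dc : c * (d / c) = d by rewrite mulrC divfK // gt_eqF.
rewrite -/K -[leRHS]dc {1}/c; have b1 := ler_wpM2l (mulr_ge0 b0 K0) t1.
have := ltW (divr_gt0 d0 c0).
by move: (T _) (d / c) b1 => u v; lra.
Qed.

Lemma ring_mean_gibbs (mu : probability configZ R) :
  (forall A : set (config int), clopen A -> mu A = (ring_mean (\1_A))%:E) ->
  is_gibbs b J mu.
Proof.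
move=> muM L t; pose r := (\max_(i <- L) `|i|%N)%N.
have Lr i : i \in L -> (`|i| <= r)%N.
  by move=> iL; apply: (@leq_bigmax_seq _ _ xpredT (fun i : int => `|i|%N)).
have cE : clopen (cylinder t).
  apply: (@local_clopen _ (enum_fset L)) => x y xy xt i.
  by rewrite -xt xy // (valP i).
have ul := kernel_uniformly_local t Lr.
apply: cond_probability_local => //.
- exact: clopen_measurable.
- exact: gibbs_kernel01.
- exact: gibbs_kernel_outside.
move=> q A qL lA; have cA : clopen A := local_clopen lA.
rewrite muM; last exact: clopenI2.
rewrite (integral_uniformly_local ring_mean_is_mean muM) //; last exact: gibbs_kernel01.
congr (_%:E); apply/eqP; rewrite -subr_eq0 -normr_le0; apply/ler_addgt0Pr => e e0.
rewrite add0r; have [d d0 dP] := expR_sub1_small e0.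
have [N HN] := error_small L r d0.
apply: (gl_dist gl).
- by apply: bounded_ring_state; exact: bounded_indic.
- apply: bounded_ring_state; apply: bounded_fctM; last exact: bounded_indic.
  by apply: bounded01; exact: gibbs_kernel01.
exists N => k /HN[rn Hd]; rewrite /ring_state.
have Ln i : i \in L -> (`|i| <= n k)%N by move=> /Lr ir; exact: leq_trans ir rn.
rewrite (finite_dlr Ln); last first.
  have gA u x y : (forall i, i \notin L -> x i = y i) -> A x -> A y.
    by move=> xy; apply: lA => i /qL/xy.
  have go (u : {ffun L -> bool}) x i : i \notin L -> glue_config u x i = x i.
    by rewrite /glue_config => iL; case: insubP => // j jL; case/negP: iL.
  move=> u x; apply/idP/idP; rewrite !inE; apply: gA => // i iL; by rewrite go.
rewrite -evN -evD; apply: ev_norm_le => s; rewrite -mulrBl normrM.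
have i1 : `|\1_A (extend s) : R| <= 1 by rewrite indicE; case: (_ \in _); rewrite ?normr1 ?normr0.
apply: le_trans (dP _ Hd).
apply: le_trans (ler_pM _ _ (ring_kernel_close J0 Jz b0 JT Lr (h k) s t rn) i1) _ => //.
by rewrite mulr1.
Qed.

Lemma ring_limit_gibbs : exists2 mu, is_gibbs b J mu &
  forall A : set (config int), clopen A -> mu A = (ring_mean (\1_A))%:E.
Proof.
have [mu muM] := clopen_extension (mean_finitely_additive ring_mean_is_mean).
by exists mu => //; exact: ring_mean_gibbs.
Qed.

End RingLimit.

Lemma pairE_flip (R : realType) (V : finType) (J : V -> V -> R) s :
  pairE J (cmul [ffun=> false] s) = pairE J s.
Proof.
rewrite !pairE_pair; apply: eq_bigr => e _.
by rewrite chi_cmul chi2 !ffunE mulrNN mulr1 mul1r.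
Qed.

Lemma mag_oppr (R : realType) (V : finType) (J : V -> V -> R) (o : V) (b h : R) :
  mag J o b (- h) = - mag J o b h.
Proof.
pose t : {ffun V -> bool} := [ffun=> false].
have Et s : modelE (fun x y => b * J x y) (fun=> - h) (cmul t s) =
    modelE (fun x y => b * J x y) (fun=> h) s.
  rewrite !modelE_const mulNr -mulrN pairE_flip; congr (_ + _ * _).
  by rewrite -sumrN; apply: eq_bigr => v _; rewrite chi_cmul chi1 ffunE mulN1r opprK.
rewrite /mag (ev_cmul t) -evN; congr (ev _ _); apply/funext => s; first exact: Et.
by rewrite chi_cmul chi1 ffunE mulN1r.
Qed.

Lemma ev_indic_zero (R : realType) (J : nat -> R) b n h (o : 'I_(n.*2.+1)) : pos o = 0 ->
  ev (@ringE R J b n h) (fun s => \1_[set x : config int | x 0 = true] (extend s)) =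
  1 / 2 + 1 / 2 * mag (ringJ J (n := n.*2.+1)) o b h.
Proof.
move=> o0; rewrite /mag -evZ -[X in X + _](ev_cst (@ringE R J b n h)) -evD.
congr (_ / _); apply: eq_bigr => s _; congr (_ * _).
rewrite chi1 -(extend_pos s o) o0 indicE; case E : (extend s 0).
  by rewrite mem_set //=; field.
by rewrite memNset /= ?E //; field.
Qed.

(* Otherwise limits of the ring measures with fields [1 / k] and [- 1 / k] are
   Gibbs measures with magnetizations at least [e] apart. *)
Lemma unique_gibbs_magnetization (R : realType) (J T : nat -> R) (b e : R) :
  (forall k, 0 <= J k) -> J 0 = 0 -> 0 <= b ->
  (forall a m, \sum_(a <= k < m) J k <= T a) -> T @ \oo --> 0 ->
  unique_gibbs b J -> 0 < e ->
  exists N (H : R), 0 < H /\ forall n (o : 'I_(n.*2.+1)), (N <= n)%N -> pos o = 0 ->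
    mag (ringJ J (n := n.*2.+1)) o b H <= e.
Proof.
move=> J0 Jz b0 JT T0 [nu _ nuU] e0; apply: contrapT => no.
have /choice[f Hf] : forall k : nat, exists n, (k <= n)%N /\ exists2 o : 'I_(n.*2.+1),
    pos o = 0 & e < mag (ringJ J (n := n.*2.+1)) o b k.+1%:R^-1.
  move=> k; apply: contrapT => nk; apply: no; exists k, k.+1%:R^-1; split; first by rewrite invr_gt0.
  move=> n o kn o0; rewrite leNgt; apply/negP => lt; apply: nk; exists n; split=> //.
  by exists o.
have fk k : (k <= f k)%N by have [? _] := Hf k.
have [l gl] := generalized_limit_exists R.
pose h k : R := k.+1%:R^-1.
have hp : h @ \oo --> 0 by exact: cvg_harmonic.
have hm : (fun k => - h k) @ \oo --> 0 by rewrite -oppr0; exact: cvgN.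
have [m1 g1 M1] := ring_limit_gibbs J0 Jz b0 JT T0 gl fk hp.
have [m2 g2 M2] := ring_limit_gibbs J0 Jz b0 JT T0 gl fk hm.
pose A := [set x : config int | x 0 = true].
have cA : clopen A by exact: clopen_coordinate.
have mA : measurable (A : set configZ) by exact: clopen_measurable.
have : ring_mean J b l f h \1_A = ring_mean J b l f (fun k => - h k) \1_A.
  apply: EFin_inj; rewrite -M1 // -M2 //.
  by transitivity (nu A); [exact: nuU|symmetry; exact: nuU].
apply/eqP; rewrite -subr_eq0 /ring_mean -(gl_sub gl);
  try by apply: bounded_ring_state; exact: bounded_indic.
rewrite gt_eqF //; apply: lt_le_trans e0 _; apply: (gl_ge_cst gl).
  rewrite /ring_state; exists 2 => k; apply: le_trans (ler_normB _ _) _.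
  by apply: lerD; apply: ev_norm_le => s; rewrite indicE; case: (_ \in _); rewrite ?normr1 ?normr0.
exists 0%N => k _; have [_] := Hf k; case=> o o0 ofk; apply: le_trans (ltW ofk) _.
by rewrite /ring_state !(ev_indic_zero _ _ _ o0) mag_oppr -/(h k); lra.
Qed.

(** * The Dyson coupling *)

Section Dyson.
Variable R : realType.
Implicit Types (p : R) (a k m : nat).

Lemma dyson_coupling_ge0 p k : 0 <= dyson_coupling p k.
Proof. by rewrite /dyson_coupling; case: ifP => // _; exact: powR_ge0. Qed.

Lemma dyson_couplingS p k : dyson_coupling p k.+1 = expR (- p * ln k.+1%:R).
Proof. by rewrite /dyson_coupling /= /powR pnatr_eq0. Qed.

Lemma dyson_coupling_step p j : 0 <= p ->
  p * dyson_coupling (p + 1) j.+2 <= dyson_coupling p j.+1 - dyson_coupling p j.+2.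
Proof.
move=> p0; rewrite !dyson_couplingS; set x : R := j.+1%:R; set y : R := j.+2%:R.
have x0 : 0 < x by []; have y0 : 0 < y by [].
have xy : x / y = 1 - y^-1 by rewrite /y -natr1 -/x; field; rewrite gt_eqF // ltr_wpDl.
have ln_xy : y^-1 <= ln y - ln x.
  have := expR_ge1Dx (ln (x / y)); rewrite lnK ?posrE ?divr_gt0 //.
  by rewrite {2}xy ln_div ?posrE //; move: (ln x) (ln y) y^-1 => u v w; lra.
have -> : expR (- (p + 1) * ln y) = expR (- p * ln y) * y^-1.
  by rewrite -{3}[y]lnK ?posrE // -expRN -expRD; congr expR; ring.
have -> : expR (- p * ln x) = expR (- p * ln y) * expR (p * (ln y - ln x)).
  by rewrite -expRD; congr expR; ring.
have h := expR_ge1Dx (p * (ln y - ln x)); have h' := ler_wpM2l p0 ln_xy.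
have e0 := expR_ge0 (- p * ln y).
have := ler_wpM2l e0 (le_trans (lerD (lexx 1) h') h).
by rewrite mulrDr mulr1; move: (expR _) (y^-1) => u v; lra.
Qed.

Definition dyson_tail p a : R := (1 + p^-1) * dyson_coupling p (maxn a 1).

Lemma dyson_sum p a m : 0 < p -> (0 < a)%N ->
  \sum_(a.+1 <= k < m) dyson_coupling (p + 1) k <= p^-1 * dyson_coupling p a.
Proof.
move=> p0 a0.
suff H n : \sum_(a.+1 <= k < a.+1 + n) dyson_coupling (p + 1) k <=
    p^-1 * (dyson_coupling p a - dyson_coupling p (a + n)).
  have [ma|am] := leqP m a.+1.
    by rewrite big_geq // mulr_ge0 ?dyson_coupling_ge0 // invr_ge0 ltW.
  have := H (m - a.+1)%N; rewrite subnKC; last exact: ltnW.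
  move/le_trans; apply; apply: ler_wpM2l; first by rewrite invr_ge0 ltW.
  by rewrite gerBl dyson_coupling_ge0.
elim: n => [|n IH]; first by rewrite !addn0 big_geq // subrr mulr0.
rewrite addnS big_nat_recr /=; last by rewrite leq_addr.
case: a a0 IH => [//|a] _ IH.
have := dyson_coupling_step (a + n) (ltW p0).
rewrite addnS !addSn -ler_pdivlMl // => h; rewrite addSn in IH.
apply: le_trans (lerD IH h) _; rewrite -mulrDr; apply: ler_wpM2l; first by rewrite invr_ge0 ltW.
by rewrite subrKA.
Qed.

Lemma dyson_tailP p a m : 0 < p ->
  \sum_(a <= k < m) dyson_coupling (p + 1) k <= dyson_tail p a.
Proof.
move=> p0.
have H a' : (0 < a')%N -> \sum_(a' <= k < m) dyson_coupling (p + 1) k <= dyson_tail p a'.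
  move=> a0; have i0 : 0 <= p^-1 by rewrite invr_ge0 ltW.
  have t0 : 0 <= dyson_tail p a' by rewrite mulr_ge0 ?dyson_coupling_ge0 // addr_ge0.
  have [ma|am] := leqP m a'; first by rewrite big_geq.
  rewrite big_ltn // /dyson_tail (maxn_idPl _) // mulrDl mul1r; apply: lerD; last exact: dyson_sum.
  case: a' a0 {t0 am} => // a' _; rewrite !dyson_couplingS ler_expR opprD mulrDl.
  rewrite !mulNr mul1r; have : 0 <= ln (a'.+1%:R : R) by rewrite ln_ge0 // ler1n.
  by lra.
have [/H//|] := ltnP 0 a; rewrite leqn0 => /eqP ->.
case: m H => [|m] H; first by rewrite big_geq // mulr_ge0 ?dyson_coupling_ge0 // addr_ge0 // invr_ge0 ltW.
by rewrite big_ltn // {1}/dyson_coupling /= add0r; exact: H.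
Qed.

Lemma dyson_coupling_cvg0 p : 0 < p -> dyson_coupling p @ \oo --> 0.
Proof.
move=> p0; apply/cvgrPdist_le => e e0.
pose N := Num.bound (expR (- ln e / p)).
exists N.+1 => // -[//|k] /= Nk.
rewrite sub0r normrN ger0_norm ?dyson_coupling_ge0 // dyson_couplingS.
rewrite -[leRHS]lnK ?posrE // ler_expR mulNr lerNl -ler_pdivrMl // mulrC.
rewrite -[leLHS]expRK ler_ln ?posrE ?expR_gt0 //.
apply: (le_trans (ltW (archi_boundP (expR_ge0 _)))); rewrite -/N ler_nat.
exact: ltnW.
Qed.

Lemma dyson_tail_cvg0 p : 0 < p -> dyson_tail p @ \oo --> 0.
Proof.
move=> p0; rewrite -[X in _ --> X](mulr0 (1 + p^-1)); apply: cvgM; first exact: cvg_cst.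
rewrite -(cvg_shiftS (fun a => dyson_coupling p (maxn a 1))).
have -> : (fun n => dyson_coupling p (maxn n.+1 1)) = (fun n => dyson_coupling p n.+1).
  by apply/funext => n; rewrite (maxn_idPl _).
by rewrite cvg_shiftS; exact: dyson_coupling_cvg0.
Qed.

Lemma dyson_tail_sqr_sum p a m : 1 < 2 * p ->
  \sum_(a <= k < m) dyson_tail p k.+1 ^+ 2 <= (1 + p^-1) ^+ 2 * dyson_tail (2 * p - 1) a.+1.
Proof.
move=> p1.
have E k : dyson_tail p k.+1 ^+ 2 = (1 + p^-1) ^+ 2 * dyson_coupling (2 * p - 1 + 1) k.+1.
  rewrite /dyson_tail (maxn_idPl _) // exprMn; congr (_ * _).
  by rewrite !dyson_couplingS -expRM_natl; congr expR; ring.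
under eq_bigr do rewrite E; rewrite -mulr_sumr ler_wpM2l ?sqr_ge0 //.
rewrite -(big_add1 _ _ a m.+1 xpredT (fun k => dyson_coupling (2 * p - 1 + 1) k)).
by apply: dyson_tailP; rewrite subr_gt0.
Qed.

End Dyson.

(** * The eigenfunction *)

Section Transfer.
Variable R : realType.
Implicit Types (x y : config nat) (a : bool).

Definition ccons a x : config nat := fun i => if i is j.+1 then x j else a.

Lemma ccons_shift y : y = ccons (y 0) (left_shift y).
Proof. by apply/funext => -[]. Qed.

Lemma transferE (psi f : config nat -> R) x :
  transfer psi f x = \sum_(a : bool) expR (psi (ccons a x)) * f (ccons a x).
Proof.
rewrite /transfer (_ : left_shift @^-1` [set x] = [set` [:: ccons true x; ccons false x]]).
  rewrite -fsbig_seq; first by rewrite big_cons big_seq1 big_bool.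
  rewrite /= andbT inE; apply/negP => /eqP/(congr1 (fun z : config nat => z 0)).
  by [].
apply/seteqP; split=> y /=.
  by move=> <-; rewrite [in X in X \in _](ccons_shift y) !inE; case: (y 0); rewrite eqxx ?orbT.
by rewrite !inE => /orP[/eqP ->|/eqP ->]; apply/funext.
Qed.

End Transfer.

Section Field.
Variables (R : realType) (c T : nat -> R).
Hypothesis c0 : forall k, 0 <= c k.
Hypothesis cT : forall a m, \sum_(a <= k < m) c k <= T a.
Implicit Types (x y : config nat) (i j m n : nat).

Definition field_term i x j : R := c (i.+1 + j) * spin R (x j).

Definition field i x : R := limn (series (field_term i x)).

Lemma shifted_sum_le i m n : \sum_(m <= j < n) c (i.+1 + j) <= T (i.+1 + m).
Proof.
have -> : \sum_(m <= j < n) c (i.+1 + j) = \sum_(i.+1 + m <= k < i.+1 + n) c k.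
  rewrite -[(i.+1 + m)%N]addnC -[(i.+1 + n)%N]addnC big_addn addnK.
  by apply: eq_bigr => j _; rewrite addnC.
exact: cT.
Qed.

Lemma field_cvg i x : series (field_term i x) @ \oo --> field i x.
Proof.
apply: normed_cvg; apply: nondecreasing_is_cvgn.
  by apply: nondecreasing_series => n _ _; exact: normr_ge0.
exists (T (i.+1 + 0)%N) => _ [n _ <-]; rewrite /= /series /=.
apply: le_trans (shifted_sum_le i 0 n); apply: ler_sum => j _.
by rewrite /field_term normrM norm_spin mulr1 ger0_norm.
Qed.

Lemma field_dist i m x y : (forall j, (j < m)%N -> x j = y j) ->
  `|field i x - field i y| <= 2 * T (i.+1 + m).
Proof.
move=> xy.
have cv : (fun n => `|series (field_term i x) n - series (field_term i y) n|) @ \oo -->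
    `|field i x - field i y|.
  by apply: cvg_norm; apply: cvgB; exact: field_cvg.
apply: (ler_cvg_to cv (cvg_cst (2 * T (i.+1 + m)))); near=> n.
rewrite /series /= -sumrB (big_cat_nat (n := m)) //=; last by near: n; exists m.
rewrite big_nat big1 ?add0r; last by move=> j /andP[_ jm]; rewrite /field_term xy // subrr.
apply: le_trans (ler_norm_sum _ _ _) _.
apply: (@le_trans _ _ (2 * \sum_(m <= j < n) c (i.+1 + j))).
  rewrite mulr_sumr; apply: ler_sum => j _; rewrite /field_term -mulrBr normrM ger0_norm //.
  rewrite [leRHS]mulrC ler_wpM2l //; apply: le_trans (ler_normB _ _) _.
  by rewrite !norm_spin.
by rewrite ler_wpM2l // shifted_sum_le.
Unshelve. all: by end_near. Qed.

Lemma field_le i x : `|field i x| <= T i.+1.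
Proof.
apply: (ler_cvg_to (cvg_norm (@field_cvg i x)) (cvg_cst (T i.+1))); near=> n.
rewrite /series /=; apply: le_trans (ler_norm_sum _ _ _) _.
have := shifted_sum_le i 0 n; rewrite addn0; apply: le_trans; apply: ler_sum => j _.
by rewrite /field_term normrM norm_spin mulr1 ger0_norm.
Unshelve. all: by end_near. Qed.

Lemma field_cons i a x : field i (ccons a x) = c i.+1 * spin R a + field i.+1 x.
Proof.
apply/cvg_lim => //; rewrite -cvg_shiftS.
have -> : (fun n => series (field_term i (ccons a x)) n.+1) =
    (fun n => c i.+1 * spin R a + series (field_term i.+1 x) n).
  apply/funext => n; rewrite /series /= big_nat_recl // /field_term /= addn0; congr (_ + _).
  by apply: eq_bigr => j _; rewrite addnS.
by apply: cvgD; [exact: cvg_cst|exact: field_cvg].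
Qed.

End Field.

Lemma bounded_mul_cvg0 (R : realType) (u v : nat -> R) :
  bounded_seq u -> v @ \oo --> 0 -> (fun n => u n * v n) @ \oo --> 0.
Proof.
move=> [K uK] v0; have K0 : 0 <= K by apply: le_trans (uK 0%N); exact: normr_ge0.
apply/cvgrPdist_le => e e0; have K1 : 0 < K + 1 by rewrite ltr_wpDl.
move/cvgrPdist_le : v0 => /(_ _ (divr_gt0 e0 K1)); apply: filterS => n.
rewrite !sub0r !normrN normrM => vn; rewrite -[leRHS](divfK (lt0r_neq0 K1)) mulrC.
by apply: ler_pM => //; apply: le_trans (uK n) _; rewrite lerDl.
Qed.

Lemma arithmetic_mean_le (R : realType) (u : nat -> R) (k : R) n :
  (forall i, u i <= k) -> arithmetic_mean u n <= k.
Proof.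
move=> uk; rewrite /arithmetic_mean /series /= ler_pdivrMl // mulr_natl.
by apply: le_trans (ler_sum _ (fun i _ => uk i)) _; rewrite sumr_const_nat subn0.
Qed.

Lemma arithmetic_meanD (R : realType) (u v : nat -> R) n :
  arithmetic_mean (fun i => u i + v i) n = arithmetic_mean u n + arithmetic_mean v n.
Proof. by rewrite /arithmetic_mean /series /= big_split mulrDr. Qed.

Lemma arithmetic_meanZ (R : realType) (k : R) (u : nat -> R) n :
  arithmetic_mean (fun i => k * u i) n = k * arithmetic_mean u n.
Proof. by rewrite /arithmetic_mean /series /= -mulr_sumr mulrCA. Qed.

Lemma arithmetic_mean_norm (R : realType) (u : nat -> R) (k : R) n :
  (forall i, `|u i| <= k) -> `|arithmetic_mean u n| <= k.
Proof.
move=> uk; have uk' i : - k <= u i <= k by rewrite -ler_norml.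
rewrite ler_norml arithmetic_mean_le ?andbT => [|i]; last by have /andP[] := uk' i.
rewrite lerNl -mulN1r -arithmetic_meanZ arithmetic_mean_le // => i.
by rewrite mulN1r lerNl; have /andP[] := uk' i.
Qed.

Lemma ch_sub1_pd (R : realType) (V : finType) (f : {ffun V -> bool} -> R) :
  pd f -> pd (fun s => ch (f s) - 1).
Proof.
elim=> [k l k0|f1 f2 p1 h1 p2 h2].
  have h : 0 <= ch k - 1 by rewrite subr_ge0 ch_ge1.
  by apply: (pd_ext _ (pd_const V h)) => s; rewrite ch_chi.
have [c1 s1 _] := pd_ch_sh p1; have [_ s2 _] := pd_ch_sh p2.
apply: (pd_ext _ (pd_add (pd_add (pd_mul c1 h2) h1) (pd_mul s1 s2))) => s.
by rewrite chD; ring.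
Qed.

Lemma ev_chi1_pairE (R : realType) (V : finType) (J : V -> V -> R) v :
  ev (pairE J) (chi R [:: v]) = 0.
Proof.
pose t : {ffun V -> bool} := [ffun=> false].
suff : ev (pairE J) (chi R [:: v]) = - ev (pairE J) (chi R [:: v]) by lra.
rewrite {1}(ev_cmul t) -evN; congr (ev _ _); apply/funext => s; first exact: pairE_flip.
by rewrite chi_cmul chi1 ffunE mulN1r.
Qed.

Section Cons.
Variables (R : realType) (n : nat).

Definition scons (a : bool) (s : {ffun 'I_n -> bool}) : {ffun 'I_n.+1 -> bool} :=
  [ffun v => if unlift ord0 v is Some w then s w else a].

Lemma scons0 a s : scons a s ord0 = a.
Proof. by rewrite ffunE unlift_none. Qed.

Lemma scons_lift a s i : scons a s (lift ord0 i) = s i.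
Proof. by rewrite ffunE liftK. Qed.

Lemma sum_scons (F : {ffun 'I_n.+1 -> bool} -> R) :
  \sum_s F s = \sum_(a : bool) \sum_s F (scons a s).
Proof.
rewrite pair_big /= (reindex (fun p : bool * {ffun 'I_n -> bool} => scons p.1 p.2)) //=.
exists (fun s : {ffun 'I_n.+1 -> bool} => (s ord0, [ffun i => s (lift ord0 i)])).
  move=> [a s] _ /=; rewrite scons0; congr (_, _); apply/ffunP => i.
  by rewrite ffunE scons_lift.
move=> s _; apply/ffunP => v; rewrite ffunE /=.
by case: unliftP => [w ->|->]; rewrite ?ffunE.
Qed.

End Cons.

Section Eigenfunction.
Variables (R : realType) (c T T2 : nat -> R) (X : R).
Hypotheses (c0 : forall k, 0 <= c k) (cz : c 0 = 0).
Hypothesis cT : forall a m, \sum_(a <= k < m) c k <= T a.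
Hypothesis TT : forall a m, \sum_(a <= k < m) T k.+1 ^+ 2 <= T2 a.
Hypothesis T20 : T2 @ \oo --> 0.
Hypothesis X0 : 0 <= X.
Hypothesis cX : forall m (v : 'I_m),
  \sum_w ev (pairE (@intervalJ R c m)) (chi R [:: v; w]) <= X.
Implicit Types (x y : config nat) (n m : nat) (a : bool).

Let E n := pairE (@intervalJ R c n).
Let W n (s : {ffun 'I_n -> bool}) : R := fieldE (fun i : 'I_n => c i.+1) s.
Let F n x (s : {ffun 'I_n -> bool}) : R := fieldE (fun i : 'I_n => field c i x) s.
(* The spins [s i] sit on the sites [-1 - i] to the left of the half-line
   carrying [x], with free boundary conditions further left. *)
Let Z n : R := \sum_s expR (E (n := n) s).
Let ratio n : R := Z n.+1 / Z n.
Let u n x : R := ev (E (n := n)) (fun s => expR (F x s)).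
Let psi x : R := spin R (x 0) * field c 0 (left_shift x).

Lemma fieldE_sub (V : finType) (h h' : V -> R) s :
  fieldE h s - fieldE h' s = fieldE (fun v => h v - h' v) s.
Proof. by rewrite /fieldE -sumrB; apply: eq_bigr => v _; rewrite mulrBl. Qed.

Lemma fieldE_scale (V : finType) k (h : V -> R) s :
  k * fieldE h s = fieldE (fun v => k * h v) s.
Proof. by rewrite /fieldE mulr_sumr; apply: eq_bigr => v _; rewrite mulrA. Qed.

Lemma pairE_scons n a s : E (scons a s) = E (n := n) s + spin R a * W s.
Proof.
rewrite /E /pairE big_ord_recl /= big_ord_recl /= {1}/intervalJ /ndist subnn addn0 cz mul0r mul0r add0r.
under [X in _ + X = _]eq_bigr => i _ do rewrite big_ord_recl /=.
rewrite [X in _ + X]big_split /= addrA addrC; congr (_ + _).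
  apply: eq_bigr => i _; apply: eq_bigr => j _.
  by rewrite !chi2 !scons_lift.
rewrite /W /fieldE mulr_sumr -big_split /=; apply: eq_bigr => i _.
rewrite !chi2 chi1 !scons_lift !scons0 /intervalJ /ndist /= /bump /= !add1n !subn0 !sub0n addn0 add0n.
by field.
Qed.

Lemma fieldE_scons n a x s :
  F x (scons a s) = spin R a * field c 0 x + \sum_i field c (i : 'I_n).+1 x * spin R (s i).
Proof.
rewrite /F /fieldE big_ord_recl chi1 scons0 mulrC; congr (_ + _).
by apply: eq_bigr => i _; rewrite chi1 scons_lift.
Qed.

Lemma partE n x : \sum_(s : {ffun 'I_n -> bool}) expR (F x s) * expR (E s) = u n x * Z n.
Proof. exact: ev_sumE. Qed.

Lemma Z_gt0 n : 0 < Z n.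
Proof. exact: part_gt0. Qed.

Lemma transfer_u n x : transfer psi (u n) x = ratio n * u n.+1 x.
Proof.
have Zn := Z_gt0 n.
suff : Z n * transfer psi (u n) x = u n.+1 x * Z n.+1.
  by rewrite /ratio => h; apply: (mulfI (lt0r_neq0 Zn)); rewrite h; field; rewrite gt_eqF.
rewrite -partE sum_scons transferE mulr_sumr; apply: eq_bigr => a _.
rewrite mulrCA [Z n * _]mulrC -partE mulr_sumr; apply: eq_bigr => s _.
rewrite -!expRD; congr expR; rewrite pairE_scons fieldE_scons.
rewrite /psi /=; rewrite (_ : left_shift (ccons a x) = x); last exact/funext.
rewrite addrA; have -> : F (ccons a x) s =
   spin R a * W s + \sum_i field c (i : 'I_n).+1 x * spin R (s i).
  rewrite /F /W /fieldE mulr_sumr -big_split /=; apply: eq_bigr => i _.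
  by rewrite (field_cons c0 cT) !chi1; ring.
by ring.
Qed.

Lemma ratioE n : ratio n = 2 * ev (E (n := n)) (fun s => ch (W s)).
Proof.
rewrite /ratio /ev mulrA; congr (_ / _).
rewrite /Z sum_scons exchange_big /= mulr_sumr; apply: eq_bigr => s _.
by rewrite big_bool /= !pairE_scons /= mul1r mulN1r !expRD /ch; field.
Qed.

Lemma intervalJ_ge0 n (v w : 'I_n) : 0 <= intervalJ c v w.
Proof. exact: c0. Qed.

Lemma ratio_nondecreasing : nondecreasing_seq ratio.
Proof.
apply/nondecreasing_seqP => n; rewrite !ratioE ler_wpM2l //.
have pW m : pd (W (n := m)) by exact: pd_fieldE.
have [pc _ _] := pd_ch_sh (pW n).
apply: (@le_trans _ _ (ev (E (n := n.+1)) (fun s => ch (W (pullback (widen_ord (leqnSn n)) s))))).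
  apply: (@ev_embed _ _ _ (widen_ord (leqnSn n))) => //; try exact: intervalJ_ge0.
  by move=> v w /(congr1 val) /= /ord_inj.
rewrite -subr_ge0 -evN -evD; apply: ev_pd_ge0.
  by apply: pd_pairE; exact: intervalJ_ge0.
pose f s := W (pullback (widen_ord (leqnSn n)) s); pose g s := c n.+1 * chi R [:: ord_max : 'I_n.+1] s.
have pf : pd f by exact: pd_pullback.
have pg : pd g by apply: pd_scale => //; exact: pd_chi.
have [cf sf _] := pd_ch_sh pf; have [_ sg _] := pd_ch_sh pg.
apply: (pd_ext _ (pd_add (pd_mul cf (ch_sub1_pd pg)) (pd_mul sf sg))) => s.
have -> : W s = f s + g s.
  rewrite /W /fieldE big_ord_recr /=; congr (_ + _).
  by apply: eq_bigr => i _; rewrite !chi1 ffunE.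
by rewrite chD /f; ring.
Qed.

Lemma W_le n (s : {ffun 'I_n -> bool}) : `|W s| <= T 1.
Proof.
apply: le_trans (ler_norm_sum _ _ _) _.
have := shifted_sum_le cT 0 0 n; rewrite big_mkord; apply: le_trans; apply: ler_sum => i _.
by rewrite normrM norm_chi mulr1 ger0_norm.
Qed.

Lemma ratio_le n : ratio n <= 2 * expR (T 1).
Proof.
rewrite ratioE ler_wpM2l // -(ev_cst (E (n := n)) (expR (T 1))); apply: ev_le => s.
have /ler_normlP[h1 h2] := W_le s; rewrite /ch ler_pdivrMr // mulr_natr mulr2n.
by apply: lerD; rewrite ler_expR.
Qed.

Lemma ratio_cvg : exists2 lam : R, 0 < lam & ratio @ \oo --> lam.
Proof.
have cr : cvgn ratio.
  apply: nondecreasing_is_cvgn; first exact: ratio_nondecreasing.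
  by exists (2 * expR (T 1)) => _ [n _ <-]; exact: ratio_le.
exists (limn ratio) => //; apply: (@lt_le_trans _ _ (ratio 0)).
  by rewrite divr_gt0 // Z_gt0.
exact: nondecreasing_cvgn_le ratio_nondecreasing cr 0%N.
Qed.

Lemma u_ge1 n x : 1 <= u n x.
Proof.
have -> : 1 = ev (E (n := n)) (fun s => 1 + F x s).
  rewrite evD ev_cst /F /fieldE ev_sum big1 ?addr0 // => i _.
  by rewrite evZ ev_chi1_pairE mulr0.
by apply: ev_le => s; exact: expR_ge1Dx.
Qed.

Lemma sqr_sum_le n m k (h : 'I_n -> R) : 0 <= k -> (forall i, `|h i| <= k * T (i.+1 + m)) ->
  \sum_i h i ^+ 2 <= k ^+ 2 * T2 m.
Proof.
move=> k0 hT; apply: (@le_trans _ _ (k ^+ 2 * \sum_(m <= j < n + m) T j.+1 ^+ 2)); last first.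
  by rewrite ler_wpM2l ?sqr_ge0.
rewrite -{1}[m]add0n big_addn addnK big_mkord mulr_sumr; apply: ler_sum => i _.
rewrite -exprMn -[leLHS]real_normK ?num_real // ler_sqr ?nnegrE //.
by apply: le_trans (hT i); exact: normr_ge0.
Qed.

Lemma exp_bound n k x : 0 <= k ->
  ev (E (n := n)) (fun s => expR (k * F x s)) <= expR ((1 / 2 + X) * (k ^+ 2 * T2 0)).
Proof.
move=> k0; have Js (v w : 'I_n) : intervalJ c v w = intervalJ c w v.
  by rewrite /intervalJ; congr c; rewrite /ndist addnC.
have := gaussian_bound (@intervalJ_ge0 n) Js (@cX n)
   (fun i : 'I_n => k * field c i x).
under [X in ev _ X]eq_fun do rewrite -fieldE_scale.
move/le_trans; apply; rewrite ler_expR ler_wpM2l ?addr_ge0 //.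
apply: sqr_sum_le => // i; rewrite normrM ger0_norm // ler_wpM2l // addn0.
exact: field_le.
Qed.

Lemma u_le n x : u n x <= expR ((1 / 2 + X) * T2 0).
Proof.
have := @exp_bound n 1 x ler01; rewrite expr1n (mul1r (T2 0)); apply: le_trans.
by rewrite le_eqVlt; apply/orP; left; apply/eqP; congr ev; apply/funext => s; rewrite mul1r.
Qed.

Lemma expR_dist (a b d : R) : 0 < d ->
  `|expR a - expR b| <= (2 * d)^-1 * (a - b) ^+ 2 + d * (expR (2 * a) + expR (2 * b)).
Proof.
move=> d0.
have key (p q : R) : expR p - expR q <= `|p - q| * (expR p + expR q).
  apply: (@le_trans _ _ (`|p - q| * expR p)); last by rewrite ler_wpM2l // lerDl expR_ge0.
  have := expR_ge1Dx (q - p); rewrite expRD expRN => h.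
  have := ler_wpM2l (expR_ge0 p) h; rewrite mulrCA divff ?mulr1 ?gt_eqF ?expR_gt0 //.
  have := ler_wpM2r (expR_ge0 p) (ler_norm (p - q)); lra.
have h : `|expR a - expR b| <= `|a - b| * (expR a + expR b).
  rewrite ler_norml lerNl opprB key andbT (le_trans (key b a)) //.
  by rewrite distrC [expR b + _]addrC.
apply: le_trans h _; rewrite -[(a - b) ^+ 2]real_normK ?num_real //.
have -> : expR (2 * a) = expR a ^+ 2 by rewrite expRM_natl.
have -> : expR (2 * b) = expR b ^+ 2 by rewrite expRM_natl.
set w := `|a - b|; set p := expR a; set q := expR b.
(* AM-GM, with the remainder written as a sum of squares. *)
have -> : (2 * d)^-1 * w ^+ 2 + d * (p ^+ 2 + q ^+ 2) =
    w * (p + q) + (2 * d)^-1 * ((w - d * (p + q)) ^+ 2 + d ^+ 2 * (p - q) ^+ 2).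
  by field; rewrite gt_eqF.
rewrite lerDl; apply: mulr_ge0; first by rewrite invr_ge0 mulr_ge0 // ltW.
by apply: addr_ge0; rewrite -?exprMn sqr_ge0.
Qed.

Lemma u_dist n m x y (d : R) : 0 < d -> (forall j, (j < m)%N -> x j = y j) ->
  `|u n x - u n y| <= (2 * d)^-1 * (X * (4 * T2 m)) +
     d * (2 * expR ((1 / 2 + X) * (4 * T2 0))).
Proof.
move=> d0 xy; rewrite /u -evN -evD.
have n1 (f : {ffun 'I_n -> bool} -> R) : `|ev (E (n := n)) f| <= ev (E (n := n)) (fun s => `|f s|).
  rewrite ler_norml -evN; apply/andP; split; apply: ev_le => s; last exact: ler_norm.
  by rewrite lerNl -normrN ler_norm.
apply: le_trans (n1 _) _.
apply: le_trans (ev_le _ (fun s => expR_dist (F x s) (F y s) d0)) _.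
rewrite evD !evZ evD; apply: lerD.
  apply: ler_wpM2l; first by rewrite invr_ge0 mulr_ge0 // ltW.
  under [X in ev _ X]eq_fun do rewrite fieldE_sub.
  apply: le_trans (ev_fieldE_sqr (@intervalJ_ge0 n) (@cX n) _) _.
  rewrite ler_wpM2l //; have -> : 4 = 2 ^+ 2 :> R by ring.
  by apply: sqr_sum_le => // i; exact: field_dist.
apply: ler_wpM2l; first exact: ltW.
rewrite mulr_natl mulr2n; have -> : 4 = 2 ^+ 2 :> R by ring.
by apply: lerD; exact: exp_bound.
Qed.

(* Cesaro means make the generalized limit shift invariant, which turns
   [transfer_u] into an eigenvalue equation. *)
Lemma eigenfunction_exists : exists (h : config nat -> R) (lam C : R),
  [/\ 0 < lam, continuous h, forall x, 1 <= h x <= C &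
      forall x, transfer psi h x = lam * h x].
Proof.
have [lam lam0 rl] := ratio_cvg; have [l gl] := generalized_limit_exists R.
pose C := expR ((1 / 2 + X) * T2 0).
have uC n x : `|u n x| <= C.
  by rewrite ger0_norm ?u_le // (le_trans ler01) // u_ge1.
pose A x := arithmetic_mean (u ^~ x).
have bA x : bounded_seq (A x) by exists C => n; exact: arithmetic_mean_norm.
exists (fun x => l (A x)), lam, C; split=> //.
- move=> x; apply/cvgrPdist_le => e e0.
  pose K := 2 * expR ((1 / 2 + X) * (4 * T2 0)).
  have K0 : 0 < K by rewrite mulr_gt0 // expR_gt0.
  pose d := e / 2 / K; have d0 : 0 < d by rewrite !divr_gt0.
  pose e' := e / 2 / ((2 * d)^-1 * (X * 4) + 1).
  have q0 : 0 <= (2 * d)^-1 * (X * 4).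
    by rewrite mulr_ge0 ?mulr_ge0 // invr_ge0 mulr_ge0 // ltW.
  have q1 : 0 < (2 * d)^-1 * (X * 4) + 1 by rewrite ltr_wpDl.
  have e'0 : 0 < e' by rewrite !divr_gt0.
  have /cvgrPdist_le/(_ _ e'0)[m _ Hm] := T20.
  have Tm : T2 m <= e'.
    by have := Hm m (leqnn m); rewrite /= sub0r normrN; exact: le_trans (ler_norm _).
  apply: filterS (nbhs_window x (iota 0 m)) => y /= yx.
  apply: (gl_dist gl) => //; exists 0%N => n _; rewrite -mulN1r -arithmetic_meanZ -arithmetic_meanD.
  apply: arithmetic_mean_norm => i; rewrite mulN1r.
  have xy j : (j < m)%N -> x j = y j by move=> jm; rewrite yx // mem_iota.
  apply: le_trans (u_dist i d0 xy) _; rewrite -/K.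
  have -> : d * K = e / 2 by rewrite /d divfK // gt_eqF.
  rewrite [leRHS]splitr lerD2r (_ : _ * _ = (2 * d)^-1 * (X * 4) * T2 m); last by ring.
  apply: le_trans (ler_wpM2l q0 Tm) _.
  have -> : e / 2 = ((2 * d)^-1 * (X * 4) + 1) * e' by rewrite /e' [RHS]mulrC divfK // gt_eqF.
  by rewrite ler_wpM2r ?lerDl // ltW.
- move=> x; apply/andP; split.
    apply: (gl_ge_cst gl) => //; exists 0%N => n _; rewrite -lerN2 -mulN1r -arithmetic_meanZ.
    by apply: arithmetic_mean_le => i; rewrite mulN1r lerN2 u_ge1.
  by apply: (gl_le_cst gl) => //; exists 0%N => n _; apply: arithmetic_mean_le => i; exact: u_le.
move=> x; rewrite transferE.
have bP a : bounded_seq (fun n => expR (psi (ccons a x)) * A (ccons a x) n).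
  exact: bounded_scale.
under eq_bigr => a _ do rewrite -(gl_scale gl) //.
rewrite -(gl_sum gl) // -(gl_scale gl) //; apply/eqP; rewrite -subr_eq0.
rewrite -(gl_sub gl); [|exact: bounded_sum|exact: bounded_scale].
apply/eqP; apply: (gl_cvg gl); last first.
  have [K HK] := bounded_add (bounded_sum (index_enum bool) xpredT bP)
     (bounded_scale (-1) (bounded_scale lam (bA x))).
  by exists K => n; have := HK n; rewrite mulN1r.
have -> : (fun n => \sum_a expR (psi (ccons a x)) * A (ccons a x) n - lam * A x n) =
   (fun n => arithmetic_mean (fun i => u i.+1 x * (ratio i - lam)) n +
             lam * ((u n.+1 x - u 0 x) * harmonic n)).
  apply/funext => n.
  have -> : \sum_a expR (psi (ccons a x)) * A (ccons a x) n =
      arithmetic_mean (fun i => ratio i * u i.+1 x) n.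
    rewrite big_bool /A -!arithmetic_meanZ /= -arithmetic_meanD; congr arithmetic_mean.
    by apply/funext => i; rewrite -transfer_u transferE big_bool.
  have -> : (u n.+1 x - u 0 x) * harmonic n = arithmetic_mean (fun i => u i.+1 x - u i x) n.
    by rewrite /arithmetic_mean /series /= (telescope_sumr (u ^~ x)) // mulrC.
  rewrite -mulN1r /A -!arithmetic_meanZ -!arithmetic_meanD; congr arithmetic_mean.
  by apply/funext => i; ring.
rewrite -[0]addr0; apply: cvgD.
  apply: cesaro; apply: bounded_mul_cvg0; first by exists C.
  by rewrite -(subrr lam); apply: cvgB => //; exact: cvg_cst.
rewrite -(mulr0 lam); apply: cvgM; first exact: cvg_cst.
apply: bounded_mul_cvg0; last exact: cvg_harmonic.
exists (C + C) => n; apply: le_trans (ler_normB _ _) _; exact: lerD.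
Qed.

End Eigenfunction.

(** * The spectral radius *)

Local Open Scope complex_scope.

Lemma coordinatewise_continuous (g : config nat -> config nat) :
  (forall i, exists j, forall x y, x j = y j -> g x i = g y i) -> continuous g.
Proof.
move=> gP x; apply/cvg_sup => i U [V [[W oW <-] /= Wx WU]].
have [j gj] := gP i; apply: filterS (nbhs_coordinate x j) => y /= yx.
by apply: WU => /=; rewrite (gj y x).
Qed.

Lemma ccons_continuous a : continuous (ccons a).
Proof.
apply: coordinatewise_continuous => -[|i]; first by exists 0%N.
by exists i.
Qed.

Section Geometric.
Variable R : realType.

Lemma geometric_cvg (a : nat -> R) (k q : R) : 0 <= k -> 0 <= q < 1 ->
  (forall n, `|a n.+1 - a n| <= k * q ^+ n) ->
  forall n, `|limn a - a n| <= k / (1 - q) * q ^+ n.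
Proof.
move=> k0 /andP[q0 q1] aq; have q1' : 0 < 1 - q by rewrite subr_gt0.
set K := k / (1 - q); have K0 : 0 <= K by rewrite divr_ge0 // ltW.
have kE : k = K * (1 - q) by rewrite /K divfK // gt_eqF.
have step n j : `|a (n + j)%N - a n| <= K * q ^+ n - K * q ^+ (n + j).
  elim: j => [|j IH]; first by rewrite addn0 !subrr normr0.
  rewrite addnS -(subrKA (a (n + j)%N)) exprS.
  apply: le_trans (ler_normD _ _) _; apply: le_trans (lerD (aq _) IH) _.
  by rewrite kE; move: (q ^+ _) (q ^+ _) => u v; lra.
have ge0 n : 0 <= K * q ^+ n by rewrite mulr_ge0 // exprn_ge0.
have qn : (fun n => K * q ^+ n) @ \oo --> 0.
  rewrite -[X in _ --> X](mulr0 K); apply: cvgM; first exact: cvg_cst.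
  by apply: cvg_expr; rewrite ger0_norm.
have cb : cvgn (fun n => a n + K * q ^+ n).
  apply: nonincreasing_is_cvgn.
    apply/nonincreasing_seqP => n; have /ler_normlP[_] := aq n.
    by rewrite kE exprS; move: (q ^+ n) => u; lra.
  exists (a 0%N - K) => _ [n _ <-]; have /ler_normlP[+ _] := step 0%N n.
  by rewrite add0n expr0; have := ge0 n; lra.
have ca : cvgn a.
  have -> : a = (fun n => a n + K * q ^+ n - K * q ^+ n) by apply/funext => n; rewrite addrK.
  by apply: is_cvgB => //; apply/cvg_ex; exists 0.
move=> n; apply: (ler_cvg_to (cvg_norm (cvgB ca (cvg_cst (a n)))) (cvg_cst (K * q ^+ n))).
near=> m; have nm : (n <= m)%N by near: m; exists n.
have := step n (m - n)%N; rewrite subnKC // => /le_trans; apply.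
by have := ge0 m; lra.
Unshelve. all: by end_near. Qed.

Lemma geometric_le0 (a k q : R) : 0 <= q < 1 -> (forall n, a <= k * q ^+ n) -> a <= 0.
Proof.
move=> /andP[q0 q1] ak.
have qn : (fun n => k * q ^+ n) @ \oo --> 0.
  rewrite -[X in _ --> X](mulr0 k); apply: cvgM; first exact: cvg_cst.
  by apply: cvg_expr; rewrite ger0_norm.
by apply: (ler_cvg_to (cvg_cst a) qn); near=> n.
Unshelve. all: by end_near. Qed.

End Geometric.

Section Modulus.
Variable R : realType.
Implicit Types z w : R[i].

Lemma modulusE z : `|z| = (modulus z)%:C.
Proof. exact: normc_def. Qed.

Lemma modulus_ge0 z : 0 <= modulus z.
Proof. exact: sqrtr_ge0. Qed.

Lemma modulusM z w : modulus (z * w) = modulus z * modulus w.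
Proof. by apply: complexI; rewrite rmorphM /= -!modulusE normrM. Qed.

Lemma modulusV z : modulus z^-1 = (modulus z)^-1.
Proof. by apply: complexI; rewrite fmorphV /= -!modulusE normfV. Qed.

Lemma modulusD z w : modulus (z + w) <= modulus z + modulus w.
Proof. by rewrite -lecR rmorphD /= -!modulusE ler_normD. Qed.

Lemma modulusN z : modulus (- z) = modulus z.
Proof. by apply: complexI; rewrite -!modulusE normrN. Qed.

Lemma modulusR (r : R) : 0 <= r -> modulus r%:C = r.
Proof. by move=> r0; rewrite /modulus /= expr0n addr0 sqrtr_sqr ger0_norm. Qed.

Lemma modulus0 : modulus (0 : R[i]) = 0.
Proof. exact: (modulusR (lexx 0)). Qed.

Lemma modulus_eq0 z : modulus z <= 0 -> z = 0.
Proof.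
move=> z0; apply/eqP; rewrite -normr_eq0 modulusE.
by have -> : modulus z = 0 by apply/eqP; rewrite eq_le z0 modulus_ge0.
Qed.

Lemma Re_le_modulus z : `|complex.Re z| <= modulus z.
Proof. by rewrite -sqrtr_sqr ler_wsqrtr // lerDl sqr_ge0. Qed.

Lemma Im_le_modulus z : `|complex.Im z| <= modulus z.
Proof. by rewrite -sqrtr_sqr ler_wsqrtr // lerDr sqr_ge0. Qed.

Lemma modulus_le_ReIm z : modulus z <= `|complex.Re z| + `|complex.Im z|.
Proof.
rewrite -[leRHS]ger0_norm ?addr_ge0 // -sqrtr_sqr ler_wsqrtr // sqrrD !real_normK ?num_real //.
by rewrite addrAC lerDl mulrn_wge0 // mulr_ge0.
Qed.

End Modulus.

Section SpectralRadius.
Variables (R : realType) (psi h : config nat -> R) (lam C : R).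
Hypothesis psi_cont : continuous psi.
Hypothesis h_cont : continuous h.
Hypothesis h1C : forall x, 1 <= h x <= C.
Hypothesis lam0 : 0 < lam.
Let L := transfer psi.
Hypothesis Lh : forall x, L h x = lam * h x.
Implicit Types (f g : config nat -> R[i]) (x y : config nat) (z : R[i]).

Let w a x := expR (psi (ccons a x)).

Lemma w_continuous a : continuous (w a).
Proof.
move=> x; apply: continuous_comp; last exact: continuous_expR.
by apply: continuous_comp; [exact: ccons_continuous|exact: psi_cont].
Qed.

Lemma transfer_continuous (f : config nat -> R) : continuous f -> continuous (L f).
Proof.
move=> cf x.
have -> : L f = (fun x => w true x * f (ccons true x) + w false x * f (ccons false x)).
  by apply/funext => y; rewrite /L transferE big_bool.
have cfa a : {for x, continuous (fun y => f (ccons a y))}.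
  by apply: continuous_comp; [exact: ccons_continuous|exact: cf].
by apply: cvgD; apply: cvgM; [exact: w_continuous|exact: cfa|exact: w_continuous|exact: cfa].
Qed.

Lemma complexifyE f x : complexify L f x = \sum_(a : bool) (w a x)%:C * f (ccons a x).
Proof.
rewrite /complexify /L !transferE !big_bool /=.
by apply/eqP; rewrite eq_complex /=; apply/andP; split; apply/eqP; simpc; rewrite /w;
  case: (f (ccons true x)) => a b; case: (f (ccons false x)) => c d /=; ring.
Qed.

Lemma complexifyB f g x :
  complexify L (fun y => f y - g y) x = complexify L f x - complexify L g x.
Proof. by rewrite !complexifyE -sumrB; apply: eq_bigr => a _; rewrite mulrBr. Qed.

Lemma complexify_le f (K : R) : (forall x, modulus (f x) <= K * h x) ->
  forall x, modulus (complexify L f x) <= K * lam * h x.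
Proof.
move=> fK x; rewrite complexifyE big_bool; apply: le_trans (modulusD _ _) _.
rewrite !modulusM !modulusR ?expR_ge0 // -mulrA -Lh /L transferE big_bool mulrDr.
by rewrite ![K * (expR _ * _)]mulrCA; apply: lerD; rewrite ler_wpM2l ?expR_ge0.
Qed.

Lemma ccontinuous_bounded f : ccontinuous f -> exists2 K : R, 0 <= K & forall x, modulus (f x) <= K.
Proof.
have bd (g : config nat -> R) : continuous g -> exists K : R, forall x, `|g x| <= K.
  move=> cg; have /compact_bounded[M [_ HM]] : compact (g @` [set: config nat]).
    by apply: continuous_compact; [exact: continuous_subspaceT|exact: config_compact].
  exists (M + 1) => x; apply: HM; [by rewrite ltrDl|by exists x].
move=> [/bd[K HK] /bd[K' HK']]; exists (K + K').
  by apply: addr_ge0; [apply: le_trans (HK point)|apply: le_trans (HK' point)].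
by move=> x; apply: le_trans (modulus_le_ReIm _) _; exact: lerD.
Qed.

Section Resolvent.
Variable z : R[i].
Hypothesis lamz : lam < modulus z.

Let q := lam / modulus z.

Lemma modz_gt0 : 0 < modulus z.
Proof. exact: lt_trans lamz. Qed.

Lemma z_neq0 : z != 0.
Proof. by apply/eqP => z0; have := modz_gt0; rewrite z0 modulus0 ltxx. Qed.

Lemma q01 : 0 <= q < 1.
Proof.
by rewrite divr_ge0 ?(ltW lam0) ?(ltW modz_gt0) //= ltr_pdivrMr ?modz_gt0 // mul1r.
Qed.

Fixpoint neumann f n : config nat -> R[i] :=
  if n is n'.+1 then fun x => z^-1 * (f x + complexify L (neumann f n') x) else fun=> 0.

Definition neumann_limit f : config nat -> R[i] := fun x =>
  limn (fun n => complex.Re (neumann f n x)) +i* limn (fun n => complex.Im (neumann f n x)).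

(* Measured against the weight [h], the operator has norm exactly [lam]. *)
Lemma iterate_le (e : nat -> config nat -> R[i]) (K : R) :
  (forall x, modulus (e 0%N x) <= K * h x) ->
  (forall n x, e n.+1 x = z^-1 * complexify L (e n) x) ->
  forall n x, modulus (e n x) <= K * q ^+ n * h x.
Proof.
move=> e0 eS; elim=> [|n IH] x; first by rewrite expr0 mulr1.
rewrite eS modulusM modulusV; apply: le_trans (ler_wpM2l _ (complexify_le IH x)) _.
  by rewrite invr_ge0 modulus_ge0.
by rewrite exprS /q le_eqVlt; apply/orP; left; apply/eqP; ring.
Qed.

Let B := 2 * (C / modulus z / (1 - q)).

Lemma h_ge0 x : 0 <= h x.
Proof. by have /andP[h1 _] := h1C x; exact: le_trans h1. Qed.

Lemma neumann_dist f (K : R) : 0 <= K -> (forall x, modulus (f x) <= K) ->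
  forall n x, modulus (neumann_limit f x - neumann f n x) <= K * B * q ^+ n.
Proof.
move=> K0 fK n x.
have d m y : modulus (neumann f m.+1 y - neumann f m y) <= K / modulus z * q ^+ m * h y.
  apply: (iterate_le (e := fun m y => neumann f m.+1 y - neumann f m y)) => [y'|m' y'].
    rewrite /= subr0 (_ : complexify L _ _ = 0).
      rewrite addr0 modulusM modulusV mulrC -[leLHS]mulr1.
      have /andP[h1 _] := h1C y'.
      by apply: ler_pM => //; rewrite ?divr_ge0 ?modulus_ge0 // ler_wpM2r ?invr_ge0 ?modulus_ge0.
    by rewrite complexifyE big1 // => a _; rewrite mulr0.
  by rewrite [in LHS]/= -mulrBr opprD addrACA subrr add0r complexifyB.
have k0 : 0 <= K / modulus z * C.
  have /andP[h1 hC] := h1C x; rewrite mulr_ge0 ?divr_ge0 ?modulus_ge0 //.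
  exact: le_trans (h_ge0 x) hC.
have d' m : modulus (neumann f m.+1 x - neumann f m x) <= K / modulus z * C * q ^+ m.
  apply: le_trans (d m x) _; rewrite mulrAC; apply: ler_wpM2r.
    by rewrite exprn_ge0 //; have /andP[] := q01.
  by rewrite ler_wpM2l ?divr_ge0 ?modulus_ge0 //; have /andP[] := h1C x.
apply: le_trans (modulus_le_ReIm _) _.
have ReD u v : complex.Re (u - v) = complex.Re u - complex.Re v :> R by case: u v => ? ? [].
have ImD u v : complex.Im (u - v) = complex.Im u - complex.Im v :> R by case: u v => ? ? [].
have r1 m : `|complex.Re (neumann f m.+1 x) - complex.Re (neumann f m x)| <=
    K / modulus z * C * q ^+ m.
  by rewrite -ReD; apply: le_trans (d' m); exact: Re_le_modulus.
have r2 m : `|complex.Im (neumann f m.+1 x) - complex.Im (neumann f m x)| <=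
    K / modulus z * C * q ^+ m.
  by rewrite -ImD; apply: le_trans (d' m); exact: Im_le_modulus.
rewrite ReD ImD; apply: le_trans (lerD (geometric_cvg k0 q01 r1 n) (geometric_cvg k0 q01 r2 n)) _.
by rewrite /B le_eqVlt; apply/orP; left; apply/eqP; ring.
Qed.

Lemma ccontinuous_neumann f n : ccontinuous f -> ccontinuous (neumann f n).
Proof.
move=> [cr ci]; elim: n => [|n [IHr IHi]]; first by split; move=> x; exact: cvg_cst.
have cL : ccontinuous (fun x => f x + complexify L (neumann f n) x).
  split=> x.
    have -> : (fun x => complex.Re (f x + complexify L (neumann f n) x)) =
        (fun x => complex.Re (f x) + L (fun y => complex.Re (neumann f n y)) x).
      by apply/funext => y; rewrite /complexify; case: (f y).
    by apply: cvgD; [exact: cr|exact: transfer_continuous].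
  have -> : (fun x => complex.Im (f x + complexify L (neumann f n) x)) =
        (fun x => complex.Im (f x) + L (fun y => complex.Im (neumann f n y)) x).
    by apply/funext => y; rewrite /complexify; case: (f y).
  by apply: cvgD; [exact: ci|exact: transfer_continuous].
move: cL => [c1 c2]; split=> x /=.
  have -> : (fun x => complex.Re (z^-1 * (f x + complexify L (neumann f n) x))) =
      (fun x => complex.Re z^-1 * complex.Re (f x + complexify L (neumann f n) x) -
         complex.Im z^-1 * complex.Im (f x + complexify L (neumann f n) x)).
    by apply/funext => y; case: (z^-1) => ? ?; case: (_ + _).
  by apply: cvgB; apply: cvgM; [exact: cvg_cst|exact: c1|exact: cvg_cst|exact: c2].
have -> : (fun x => complex.Im (z^-1 * (f x + complexify L (neumann f n) x))) =
    (fun x => complex.Re z^-1 * complex.Im (f x + complexify L (neumann f n) x) +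
       complex.Im z^-1 * complex.Re (f x + complexify L (neumann f n) x)).
  by apply/funext => y; case: (z^-1) => ? ?; case: (_ + _).
by apply: cvgD; apply: cvgM; [exact: cvg_cst|exact: c2|exact: cvg_cst|exact: c1].
Qed.

Lemma uniform_limit_continuous (g : nat -> config nat -> R) (g0 : config nat -> R) (k : R) :
  0 <= k -> (forall n, continuous (g n)) -> (forall n x, `|g0 x - g n x| <= k * q ^+ n) ->
  continuous g0.
Proof.
move=> k0 cg gq x; apply/cvgrPdist_le => e e0.
have e30 : 0 < e / 3 by rewrite divr_gt0.
have [n Hn] : exists n, k * q ^+ n <= e / 3.
  apply: contrapT => no; have : e / 3 <= 0.
    apply: (geometric_le0 (k := k) q01) => n; rewrite leNgt; apply/negP => lt.
    by apply: no; exists n; exact: ltW.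
  by rewrite leNgt e30.
have := cg n x => /cvgrPdist_le/(_ _ e30); apply: filterS => y xy.
have h1 := le_trans (gq n x) Hn; have h2 := le_trans (gq n y) Hn; rewrite distrC in h2.
have -> : g0 x - g0 y = (g0 x - g n x) + (g n x - g n y) + (g n y - g0 y) by ring.
apply: le_trans (ler_normD _ _) _; have := ler_normD (g0 x - g n x) (g n x - g n y).
by move=> h3; lra.
Qed.

Lemma resolvent_outside : resolvent L z.
Proof.
have q0 : 0 <= q by have /andP[] := q01.
have B0 : 0 <= B.
  rewrite mulr_ge0 // divr_ge0 ?divr_ge0 ?modulus_ge0 //; last first.
    by have /andP[_ h1] := q01; rewrite subr_ge0 ltW.
  by have /andP[_] := h1C point; apply: le_trans; exact: h_ge0.
have ReD u v : complex.Re (u - v) = complex.Re u - complex.Re v :> R by case: u v => ? ? [].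
have ImD u v : complex.Im (u - v) = complex.Im u - complex.Im v :> R by case: u v => ? ? [].
have eqz f g (k : R) : (forall n x, modulus (f x - g x) <= k * q ^+ n) -> f = g.
  move=> H; apply/funext => x; apply/eqP; rewrite -subr_eq0; apply/eqP; apply: modulus_eq0.
  exact: geometric_le0 q01 (H ^~ x).
exists neumann_limit, B; split.
- move=> f cf; have [K K0 fK] := ccontinuous_bounded cf.
  have kB : 0 <= K * B by rewrite mulr_ge0.
  split.
    apply: (uniform_limit_continuous (g := fun n x => complex.Re (neumann f n x)) kB).
      by move=> n; have [] := ccontinuous_neumann n cf.
    move=> n x; rewrite -ReD; apply: le_trans (Re_le_modulus _) _; exact: neumann_dist.
  apply: (uniform_limit_continuous (g := fun n x => complex.Im (neumann f n x)) kB).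
    by move=> n; have [] := ccontinuous_neumann n cf.
  move=> n x; rewrite -ImD; apply: le_trans (Im_le_modulus _) _; exact: neumann_dist.
- move=> f cf K fK x; have K0 : 0 <= K by apply: le_trans (fK x); exact: modulus_ge0.
  by have := neumann_dist K0 fK 0 x; rewrite subr0 expr0 mulr1 [B * K]mulrC.
- move=> f cf; have [K K0 fK] := ccontinuous_bounded cf.
  set F := fun x => _.
  pose K' := modulus z * K + K * lam * C.
  have fKh x : modulus (f x) <= K * h x.
    by apply: le_trans (fK x) _; rewrite ler_peMr //; have /andP[] := h1C x.
  have FK x : modulus (F x) <= K'.
    apply: le_trans (modulusD _ _) _; rewrite modulusN modulusM; apply: lerD.
      by rewrite ler_wpM2l ?modulus_ge0.
    apply: le_trans (complexify_le fKh x) _; rewrite ler_wpM2l ?mulr_ge0 ?(ltW lam0) //.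
    by have /andP[] := h1C x.
  have K'0 : 0 <= K' by apply: le_trans (FK point); exact: modulus_ge0.
  have eF n x : modulus (f x - neumann F n x) <= K * q ^+ n * h x.
    apply: (iterate_le (e := fun m y => f y - neumann F m y)) => [y|m y]; first by rewrite subr0.
    rewrite complexifyB /= {1}/F; move: (complexify L f y) (complexify L _ y) => a b.
    by field; exact: z_neq0.
  apply: (eqz _ _ (K' * B + K * C)) => n x.
  rewrite -(subrKA (neumann F n x)) mulrDl; apply: le_trans (modulusD _ _) _.
  apply: lerD; first exact: neumann_dist.
  rewrite -modulusN opprB; apply: le_trans (eF n x) _; rewrite mulrAC.
  by rewrite ler_wpM2r ?exprn_ge0 // ler_wpM2l //; have /andP[] := h1C x.
- move=> f cf; have [K K0 fK] := ccontinuous_bounded cf.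
  apply: (eqz _ _ (modulus z * (K * B) * q + K * B * lam * C)) => n x.
  set S := neumann_limit f.
  have -> : z * S x - complexify L S x - f x =
     z * (S x - neumann f n.+1 x) - complexify L (fun y => S y - neumann f n y) x.
    rewrite complexifyB /=; move: (complexify L S x) (complexify L _ x) => a b.
    by field; exact: z_neq0.
  rewrite mulrDl; apply: le_trans (modulusD _ _) _; rewrite modulusN modulusM; apply: lerD.
    rewrite -mulrA -exprS -mulrA ler_wpM2l ?modulus_ge0 //; exact: neumann_dist.
  have Sh y : modulus (S y - neumann f n y) <= K * B * q ^+ n * h y.
    apply: le_trans (neumann_dist K0 fK n y) _; rewrite ler_peMr //.
      by apply: mulr_ge0; [exact: mulr_ge0|exact: exprn_ge0].
    by have /andP[] := h1C y.
  apply: le_trans (complexify_le Sh x) _.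
  have -> : K * B * lam * C * q ^+ n = K * B * q ^+ n * lam * C by ring.
  rewrite ler_wpM2l //; last by have /andP[] := h1C x.
  by apply: mulr_ge0 (ltW lam0); apply: mulr_ge0; [exact: mulr_ge0|exact: exprn_ge0].
Qed.

End Resolvent.

(* An inverse would map [0 = (lam - L) h] to [h], while its bound forces the
   image of [0] to vanish. *)
Lemma spectrum_eigenvalue : spectrum L lam%:C.
Proof.
move=> [S [M [_ SM SR _]]].
have ch : ccontinuous (fun x => (h x)%:C).
  by split; [exact: h_cont|move=> x; exact: cvg_cst].
have e0 : (fun x => lam%:C * (h x)%:C - complexify L (fun x => (h x)%:C) x) = (fun=> 0).
  apply/funext => x; rewrite /complexify /= [L _ _ in X in _ - X]Lh.
  rewrite /L [X in _ +i* X]transferE big1 ?subr_eq0 => [|a _]; last by rewrite mulr0.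
  by rewrite -rmorphM subrr.
have := SR _ ch; rewrite e0 => S0.
have c0 : ccontinuous (fun _ : config nat => 0 : R[i]) by split=> x; exact: cvg_cst.
have := SM _ c0 0 _ point; rewrite S0 mulr0 modulusR ?h_ge0 // => H.
have /andP[h1 _] := h1C point.
by have : (1 : R) <= 0 by [apply: le_trans h1 _; apply: H => x; rewrite modulus0]; rewrite ler10.
Qed.

Lemma spectral_radius_eigenvalue : spectral_radius L = lam.
Proof.
have ub : ubound [set modulus z | z in spectrum L] lam.
  move=> _ [z zs <-]; rewrite leNgt; apply/negP => lt; apply: zs.
  exact: resolvent_outside.
have ms : [set modulus z | z in spectrum L] lam.
  by exists lam%:C; [exact: spectrum_eigenvalue|rewrite modulusR // ltW].
apply/eqP; rewrite eq_le; apply/andP; split.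
  by apply: ge_sup => //; exists lam.
by apply: ub_le_sup => //; exists lam.
Qed.

End SpectralRadius.

Lemma interaction_potential_continuous (R : realType) (c T : nat -> R) :
  (forall k, 0 <= c k) -> (forall a m, \sum_(a <= k < m) c k <= T a) -> T @ \oo --> 0 ->
  continuous (fun x : config nat => spin R (x 0%N) * field c 0 (left_shift x)).
Proof.
move=> c0 cT T0 x; apply/cvgrPdist_le => e e0.
have e20 : 0 < e / 2 by rewrite divr_gt0.
have /cvgrPdist_le/(_ _ e20)[m _ Hm] := T0.
have Tm : T (1 + m)%N <= e / 2.
  have := Hm (1 + m)%N (leq_addl _ _); rewrite sub0r normrN; exact: le_trans (ler_norm _).
apply: filterS (nbhs_window x (iota 0 m.+1)) => y yx.
have yx' j : (j <= m)%N -> x j = y j by move=> jm; symmetry; apply: yx; rewrite mem_iota.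
rewrite (yx' 0%N) // -mulrBr normrM norm_spin mul1r.
apply: le_trans (field_dist c0 cT 0 (m := m) _) _; first by move=> j jm; exact: yx'.
by rewrite -ler_pdivlMl // mulrC.
Qed.

Lemma field_scale (R : realType) (J T : nat -> R) (b : R) i x :
  (forall k, 0 <= J k) -> (forall a m, \sum_(a <= k < m) J k <= T a) ->
  field (fun k => b * J k) i x = b * field J i x.
Proof.
move=> J0 JT; apply/cvg_lim => //.
have -> : series (field_term (fun k => b * J k) i x) = (fun n => b * series (field_term J i x) n).
  apply/funext => n; rewrite /series /= mulr_sumr; apply: eq_bigr => j _.
  by rewrite /field_term mulrA.
by apply: cvgM; [exact: cvg_cst|exact: field_cvg J0 JT i x].
Qed.

Lemma dyson_potentialE (R : realType) (alpha : R) (T : nat -> R) x :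
  (forall a m, \sum_(a <= k < m) dyson_coupling alpha k <= T a) ->
  dyson_potential alpha x = spin R (x 0%N) * field (dyson_coupling alpha) 0 (left_shift x).
Proof.
move=> JT; congr (_ * _); apply/cvg_lim => //; rewrite -cvg_shiftS.
have -> : (fun n => \sum_(1 <= k < n.+1) dyson_coupling alpha k * spin R (x k)) =
    series (field_term (dyson_coupling alpha) 0 (left_shift x)).
  by apply/funext => n; rewrite /series /= big_add1.
exact: field_cvg (dyson_coupling_ge0 alpha) JT 0 _.
Qed.

Lemma unique_gibbs_above (R : realType) (J : nat -> R) (b : R) : 0 <= b ->
  (b%:E < critical_value J)%E -> exists2 b' : R, b < b' & unique_gibbs b' J.
Proof.
move=> b0; rewrite /critical_value; case: xgetP => [c _ [c0 cU _]|_] lt; last first.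
  by move: lt; rewrite ltNge lee_fin b0.
have [b' bb' b'c] : exists2 b' : R, b < b' & (b'%:E < c)%E.
  case: c lt {c0 cU} => [c||] //= lt.
    have bc : b < c by rewrite -lte_fin.
    by exists ((b + c) / 2); rewrite ?lte_fin midf_lt.
  by exists (b + 1); rewrite ?ltry // ltrDl.
by exists b' => //; apply: cU => //; exact: le_trans (ltW bb').
Qed.

Lemma unique_gibbs_susceptibility (R : realType) (J T : nat -> R) (b b' : R) :
  (forall k, 0 <= J k) -> J 0 = 0 -> (forall a m, \sum_(a <= k < m) J k <= T a) ->
  T @ \oo --> 0 -> 0 <= b -> b < b' -> unique_gibbs b' J ->
  exists2 X : R, 0 <= X & forall m (v : 'I_m),
    \sum_w ev (pairE (@intervalJ R (fun k => b * J k) m)) (chi R [:: v; w]) <= X.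
Proof.
move=> J0 Jz JT T0 b0 bb' ub; have b'0 : 0 < b' by exact: le_lt_trans bb'.
pose M := Num.min (1 / 4) ((b' - b) / (4 * b')).
have M0 : 0 < M by rewrite lt_min !divr_gt0 ?subr_gt0 ?mulr_gt0.
have M4 : M <= 1 / 4 by rewrite ge_min lexx.
have Mb : b <= b' * (1 - 4 * M).
  have : M <= (b' - b) / (4 * b') by rewrite ge_min lexx orbT.
  by rewrite ler_pdivlMr ?mulr_gt0 // => h; lra.
have [N [H [H0 HN]]] := unique_gibbs_magnetization J0 Jz (ltW b'0) JT T0 ub M0.
exists (expR 3 / H); first by rewrite divr_ge0 ?expR_ge0 // ltW.
move=> m v; pose n := (N + m)%N.
have rt := @ringJ_transitive R J (n.*2.+1).
have mn : (m + m <= n.*2.+1)%N by rewrite addnn leqW // leq_double leq_addl.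
apply: (interval_susceptibility J0 mn b0) => o.
have r0 := ringJ_ge0 J0 (n := n.*2.+1); have rs := @ringJ_sym R J (n.*2.+1).
apply: (susceptibility_bound r0 rs rt b0 (ltW b'0) H0 _ Mb); first by rewrite ltW.
have [c c0] := @pos_surj n 0 (leq0n n).
have -> : mag (ringJ J (n := n.*2.+1)) o b' H = mag (ringJ J (n := n.*2.+1)) c b' H.
  exact: (mag_trans rt).
by apply: HN => //; exact: leq_addr.
Qed.

Theorem corollary3 (R : realType) (alpha beta : R)
    (alpha_gt1 : 1 < alpha) (alpha_gt : 3 / 2 < alpha)
    (beta_ge0 : 0 <= beta)
    (beta_lt : (beta%:E < critical_value (dyson_coupling alpha))%E) :
  let L := transfer (fun x => beta * dyson_potential alpha x) in
  exists h : config nat -> R,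
    [/\ continuous h, h <> (fun=> 0)
      & L h = (fun x => spectral_radius L * h x)].
Proof.
move=> L; pose J := dyson_coupling alpha; pose p := alpha - 1.
have p0 : 0 < p by rewrite subr_gt0.
have p2 : 1 < 2 * p by rewrite /p; lra.
have pE : alpha = p + 1 by rewrite subrK.
have J0 := dyson_coupling_ge0 alpha.
have JT a m : \sum_(a <= k < m) J k <= dyson_tail p a by rewrite /J pE; exact: dyson_tailP.
have [b' bb' ub] := unique_gibbs_above beta_ge0 beta_lt.
have [X X0 HX] := unique_gibbs_susceptibility J0 (erefl _) JT (dyson_tail_cvg0 p0) beta_ge0 bb' ub.
pose c k := beta * J k; pose T k := beta * dyson_tail p k.
pose T2 k := beta ^+ 2 * ((1 + p^-1) ^+ 2 * dyson_tail (2 * p - 1) k.+1).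
have c0 k : 0 <= c k by rewrite mulr_ge0.
have cT a m : \sum_(a <= k < m) c k <= T a by rewrite -mulr_sumr ler_wpM2l.
have scale0 (k : R) (s : nat -> R) : s @ \oo --> 0 -> (fun n => k * s n) @ \oo --> 0.
  by move=> s0; rewrite -[X in _ --> X](mulr0 k); apply: cvgM => //; exact: cvg_cst.
have T20 : T2 @ \oo --> 0.
  apply/scale0/scale0; rewrite cvg_shiftS; apply: dyson_tail_cvg0; rewrite subr_gt0 //.
have TT a m : \sum_(a <= k < m) T k.+1 ^+ 2 <= T2 a.
  under eq_bigr do rewrite exprMn.
  by rewrite -mulr_sumr ler_wpM2l ?sqr_ge0 // dyson_tail_sqr_sum.
have cz : c 0 = 0 by rewrite /c /J /dyson_coupling mulr0.
have [h [lam [C [lam0 hc h1C Lh]]]] := eigenfunction_exists c0 cz cT TT T20 X0 HX.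
have psiE : (fun x => beta * dyson_potential alpha x) =
    (fun x => spin R (x 0%N) * field c 0 (left_shift x)).
  by apply/funext => x; rewrite (dyson_potentialE x JT) (field_scale _ _ _ J0 JT) mulrCA.
have psic := interaction_potential_continuous c0 cT (scale0 _ _ (dyson_tail_cvg0 p0)).
exists h; split=> //.
  move=> h0; have /andP[] := h1C point; by rewrite h0 ler10.
rewrite /L psiE (spectral_radius_eigenvalue psic hc h1C lam0 Lh).
exact/funext.
Qed.
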